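(* If $\rho,\theta\in H^1(0,1)$, then the following asymptotic relations hold. 1. For fixed $\lambda\ge 0$ and $\varepsilon>0$, $$\lim_{\kappa\to\infty}\lim_{s\to 0}\frac{d_{\mathrm{HV}}^2(\rho,\rho+s\theta)}{s^2}=\|\theta\|_{L^2}^2 .$$ 2. For fixed $\kappa,\varepsilon>0$, $$\lim_{\lambda\to\infty}\lim_{s\to 0}\frac{d_{\mathrm{HV}}^2(\rho,\rho+s\theta)}{s^2}=\|\theta\|_{L^2}^2 .$$ 3. For fixed $\lambda\ge 0$ and $\kappa>0$, $$\lim_{\varepsilon\to\infty}\lim_{s\to 0}\frac{d_{\mathrm{HV}}^2(\rho,\rho+s\theta)}{s^2}=\|\theta\|_{L^2}^2 .$$
   Context: For parameters $\kappa,\varepsilon>0$, $\lambda\ge 0$ and real functions $\rho_0,\rho_1\in L^2$ on $(0,1)$, the squared HV metric (which depends on $\kappa,\lambda,\varepsilon$) is $$d_{\mathrm{HV}}^2(\rho_0,\rho_1)=\inf_{(f,v,z)\in\mathcal A(\rho_0,\rho_1)}\frac12\int_0^1\int_0^1\big(\kappa v^2+\lambda v_x^2+\varepsilon v_{xx}^2+z^2\big)\,dx\,dt,$$ where $\mathcal A(\rho_0,\rho_1)$ is the set of triples $(f,v,z)$ of functions of $(x,t)$ ($x$ space, $t$ time) with $f\in L^2((0,1),L^2(0,1))\cap C([0,1],H^{-1}(0,1))$, $v\in L^2((0,1),H^2(0,1)\cap H^1_0(0,1))$, $z\in L^2((0,1),L^2(0,1))$, such that $\partial_t f+\partial_x f\cdot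 v=z$ weakly and $f(\cdot,0)=\rho_0$, $f(\cdot,1)=\rho_1$.
   Formalization: The three limits are proved equal to (1/2)‖θ‖² in L² instead of ‖θ‖²: with the factor 1/2 in the definition of the squared HV metric, taking v=0, z=sθ bounds the quotient by (1/2)‖θ‖², so the stated value is impossible unless θ=0. *)

(* Defs.v *)
From HB Require Import structures.
From mathcomp Require Import all_boot all_order all_algebra.
From mathcomp Require Import all_classical all_reals all_analysis.

Set Implicit Arguments.
Unset Strict Implicit.
Unset Printing Implicit Defensive.
Import Order.TTheory GRing.Theory Num.Theory.
Import numFieldNormedType.Exports.
Local Open Scope classical_set_scope.
Local Open Scope ring_scope.

Section FunctionSpaces.
Context {R : realType}.
Implicit Types (u g : R -> R) (F : (R -> R) -> R).

Local Notation mu := (@lebesgue_measure R).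
Local Notation I := (`]0, 1[%classic : set R).

(* Elements of L^2, H^k, H^1_0 on (0,1) are represented by functions R -> R of
   which only the restriction to (0,1) matters; sq* are squared norms. *)
Definition sqL2 u : \bar R := (\int[mu]_(x in I) ((u x) ^+ 2)%:E)%E.

Definition L2 u : Prop := measurable_fun I u /\ (sqL2 u < +oo)%E.

Definition testfun (phi : R -> R) : Prop :=
  (forall n x, derivable (derive1n n phi) x 1) /\
  (exists a b : R, [/\ 0 < a, b < 1 &
     forall x, ~ (a <= x <= b) -> phi x = 0]).

Definition is_wderiv u g : Prop :=
  L2 g /\
  forall phi, testfun phi ->
    \int[mu]_(x in I) (u x * derive1 phi x) = - \int[mu]_(x in I) (g x * phi x).

(* The weak derivative of u when u is in H^1 (unique up to a null set), 0
   otherwise. *)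
Definition wderiv u : R -> R := xget (fun=> 0) [set g | is_wderiv u g].

Definition H1 u : Prop := L2 u /\ exists g, is_wderiv u g.

Definition sqH1 u : \bar R := (sqL2 u + sqL2 (wderiv u))%E.

Definition H10 u : Prop :=
  H1 u /\ exists phi : nat -> R -> R,
    (forall n, testfun (phi n)) /\
    sqH1 (fun x => u x - phi n x) @[n --> \oo] --> 0%E.

Definition H2 u : Prop := H1 u /\ H1 (wderiv u).

Definition sqH2 u : \bar R :=
  (sqL2 u + sqL2 (wderiv u) + sqL2 (wderiv (wderiv u)))%E.

(* H^{-1} is the dual of H^1_0. *)
Definition normHm1 F : \bar R :=
  ereal_sup [set `|F phi|%:E | phi in [set phi | H10 phi /\ (sqH1 phi <= 1)%E]].

Definition Hm1 F : Prop :=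
  (forall (a : R) phi psi, H10 phi -> H10 psi ->
     F (fun x => a * phi x + psi x) = a * F phi + F psi) /\
  (normHm1 F < +oo)%E.

Definition continuous_Hm1 (F : R -> (R -> R) -> R) : Prop :=
  (forall t, `[0, 1]%classic t -> Hm1 (F t)) /\
  (forall t, `[0, 1]%classic t ->
     normHm1 (fun phi => F t' phi - F t phi)
       @[t' --> within `[0, 1]%classic (nbhs t)] --> 0%E).

Definition represents u F : Prop :=
  forall phi, H10 phi -> F phi = \int[mu]_(x in I) (u x * phi x).

(* Functions of space and time are written u t x, time first. *)
Definition simple_in (X : set (R -> R)) (s : R -> R -> R) : Prop :=
  exists (m : nat) (A : 'I_m -> set R) (e : 'I_m -> R -> R),
    (forall i, measurable (A i) /\ X (e i)) /\
    s = (fun t x => \sum_(i < m) \1_(A i) t * e i x).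

(* L^2((0,1), X) for the Hilbert space X of squared norm N: strongly measurable
   (Bochner) maps t |-> u t with square-integrable norm.  As u is a function of
   (x,t), it is also asked to be jointly measurable; when X embeds in L^2(0,1),
   every Bochner class has such a representative. *)
Definition L2_in_time (X : set (R -> R)) (N : (R -> R) -> \bar R)
    (u : R -> R -> R) : Prop :=
  [/\ measurable_fun (I `*` I) (fun p : R * R => u p.1 p.2),
      exists s : nat -> R -> R -> R, (forall n, simple_in X (s n)) /\
        {ae mu, forall t, I t -> X (u t) /\
           N (fun x => u t x - s n t x) @[n --> \oo] --> 0%E} &
      (\int[mu]_(t in I) N (u t) < +oo)%E].

Definition dt (phi : R -> R -> R) : R -> R -> R :=
  fun t x => derive1 (fun t' => phi t' x) t.

Definition dx (phi : R -> R -> R) : R -> R -> R :=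
  fun t x => derive1 (phi t) x.

(* C^\infty_c((0,1)^2): all iterated partial derivatives, in any order, exist
   and are continuous. *)
Definition testfun2 (phi : R -> R -> R) : Prop :=
  (forall l : seq bool,
     let psi := foldr (fun b : bool => if b then dx else dt) phi l in
     (forall t x, derivable (fun t' => psi t' x) t 1 /\
                  derivable (psi t) x 1) /\
     continuous (fun p : R * R => psi p.1 p.2)) /\
  (exists a b : R, [/\ 0 < a, b < 1 &
     forall t x, ~ (a <= t <= b /\ a <= x <= b) -> phi t x = 0]).

(* Weak form of f_t + f_x v = z; the derivatives of f are moved onto phi and
   phi * v, and (phi v)_x is expanded by the product rule. *)
Definition weak_transport (f v z : R -> R -> R) : Prop :=
  forall phi, testfun2 phi ->
    \int[mu]_(t in I) (\int[mu]_(x in I)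
       (f t x * dt phi t x
        + f t x * (dx phi t x * v t x + phi t x * wderiv (v t) x)
        + z t x * phi t x)) = 0.

(* f in C([0,1], H^{-1}) with f(0) = rho0 and f(1) = rho1: the class of f has a
   continuous H^{-1}-valued representative F, whose values at individual times
   need not be functions. *)
Definition continuous_path (rho0 rho1 : R -> R) (f : R -> R -> R) : Prop :=
  exists F : R -> (R -> R) -> R,
    [/\ continuous_Hm1 F,
        {ae mu, forall t, I t -> represents (f t) (F t)},
        represents rho0 (F 0) &
        represents rho1 (F 1)].

Definition admissible (rho0 rho1 : R -> R) (f v z : R -> R -> R) : Prop :=
  [/\ L2_in_time L2 sqL2 f,
      L2_in_time (H2 `&` H10) sqH2 v,
      L2_in_time L2 sqL2 z,
      weak_transport f v z &
      continuous_path rho0 rho1 f].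

(* Because of the factor 1/2, the competitor v = 0, z = s theta,
   f = rho + t s theta gives sqdHV rho (rho + s theta) <= s^2/2 * sqL2 theta:
   the limits of sqdHV / s^2 carry the same factor 1/2. *)
Definition action (kappa lambda eps : R) (v z : R -> R -> R) : \bar R :=
  ((2^-1)%:E * \int[mu]_(t in I) \int[mu]_(x in I)
     (kappa * v t x ^+ 2 + lambda * wderiv (v t) x ^+ 2
      + eps * wderiv (wderiv (v t)) x ^+ 2 + z t x ^+ 2)%:E)%E.

Definition sqdHV (kappa lambda eps : R) (rho0 rho1 : R -> R) : \bar R :=
  ereal_inf [set a | exists f v z : R -> R -> R,
    admissible rho0 rho1 f v z /\ a = action kappa lambda eps v z].

Definition HV_quotient (kappa lambda eps : R) (rho theta : R -> R) (s : R)
    : \bar R :=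
  (sqdHV kappa lambda eps rho (fun x => rho x + s * theta x)%R
     * ((s ^+ 2)^-1)%R%:E)%E.

(* lim_{a -> +oo} lim_{s -> 0} q a s = l, including the existence in R of the
   inner limit for every a > 0. *)
Definition iterated_lim (q : R -> R -> \bar R) (l : \bar R) : Prop :=
  exists L : R -> R,
    (forall a, 0 < a -> q a s @[s --> 0^'] --> (L a)%:E) /\
    (L a)%:E @[a --> +oo] --> l.

End FunctionSpaces.

(* Main.v *)
Require Import Defs.
From HB Require Import structures.
From mathcomp Require Import all_boot all_order all_algebra.
From mathcomp Require Import all_classical all_reals all_analysis.
From mathcomp Require Import measurable_realfun ring lra.

Set Implicit Arguments.
Unset Strict Implicit.
Unset Printing Implicit Defensive.
Import Order.TTheory GRing.Theory Num.Theory.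
Import numFieldNormedType.Exports.
Local Open Scope classical_set_scope.
Local Open Scope ring_scope.

(** The limit as [s] tends to 0 is the minimum of a quadratic functional, the
cost of the problem linearised at [rho].  To first order in [s] the transport
equation only sees [theta = z - v rho_x] (all divided by [s]) averaged over
time; by convexity the best velocity and source are then constant in time, and
the limit is the infimum over [V] in $H^2 \cap H^1_0$ of
$\frac12 \int \kappa V^2 + \lambda V_x^2 + \varepsilon V_{xx}^2 +
(\theta + V \rho_x)^2$.  This number is [lincost_inf]; [V] is parametrised by
its second derivative [g], as [V = P g] and [V_x = mz g].

The upper bound [sqdHV_le] is explicit: with [f = rho + s t theta] and [v = s V]
the equation forces [z = s (theta + V rho_x) + s^2 t V theta_x], and the cost is
[s^2] times that of [V] up to an error of order [|s|^3].

For the lower bound, the cost may be assumed to be of order [s^2], so that [z]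
and [v_xx] are of order [s] in $L^1$ in time with values in $L^2$.  The
difficulty is that [f] is merely square integrable in space, while [f_x v] has
to be replaced by [rho_x v].  The remedy is to measure [f - rho] by its mean-zero
primitive [h]: half the time derivative of the squared norm of [h] can be
integrated by parts until no derivative of [f] is left ([energy_density]), and
a continuity argument bounds [h], uniformly in time, by a quantity of order [s]
([transport_stability]).  Hence the pairing of [s theta] with a smooth function
[psi] is that of the time average of [z - v rho_x], up to an error of order
[s^2] ([transport_linearization]).  Taking [psi] close in $L^2$ to
[theta + V rho_x] for a near-minimiser [V], the Euler-Lagrange equation
([near_minimiser]) identifies this pairing with the tangent plane of the
quadratic cost at [s V], and convexity concludes ([int_energy_quotient]).  A
preliminary step, [admissible_transported], extracts from an admissible triple
jointly measurable fields and an evolution equation valid at almost every time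
for all test functions of [x] at once.

Finally [lincost_inf] is at most half the squared norm of [theta] (take
[V = 0]).  As [V] vanishes at both ends, [|V|] is bounded by the norm of [V_x],
and the squared norm of [V_x] by the product of the norms of [V] and [V_xx]; so
whichever coefficient tends to infinity, the velocity cost exceeds [C] times the
squared norm of [V_x] for every [C], which forces the influence of [V] to
disappear in the limit ([lincost_inf_ge], [iterated_HV_quotient]). *)

(** * Comparison of integrals almost everywhere *)

Section AlmostEverywhere.
Context d (T : measurableType d) (R : realType) (mu : {measure set T -> \bar R}).
Local Open Scope ereal_scope.
Import HBNNSimple.

(** The integral of a nonnegative function, measurable or not, is a supremum
over simple functions below it, and each of these may be set to zero on a null
set.  The integrands to come, such as [t |-> \int_x F (wderiv (v t) x)],
involve a representative [wderiv (v t)] picked separately for each [t]. *)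
Lemma ge0_le_integral_ae (D : set T) (f g : T -> \bar R) :
  (forall x, D x -> 0 <= f x) -> (forall x, D x -> 0 <= g x) ->
  (\forall x \ae mu, D x -> f x <= g x) ->
  \int[mu]_(x in D) f x <= \int[mu]_(x in D) g x.
Proof.
move=> f0 g0 [N [mN N0 fgN]].
rewrite !ge0_integralE//; apply: ge_ereal_sup => _ [h /= hf <-].
pose h' := proj_nnsfun h (measurableC mN).
have h'E x : h' x = (h x * \1_(~` N) x)%R by [].
have -> : sintegral mu h = sintegral mu h'.
  rewrite -!integralT_nnsfun; apply: ae_eq_integral => //.
  - exact/measurable_EFinP.
  - exact/measurable_EFinP.
  - exists N; split => // x /= /not_implyP[_] hh.
    apply: contrapT => Nx; apply: hh; congr EFin; rewrite -[RHS]/(h' x) h'E indicE mem_set// mulr1; reflexivity.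
apply: ereal_sup_ubound; exists h' => // x.
rewrite h'E indicE; case: (boolP (x \in ~` N)) => [|_]; last first.
  by rewrite mulr0 patchE; case: ifPn => // /[!inE] /g0.
rewrite mulr1 inE => Nx; apply: (le_trans (hf x)).
rewrite !patchE; case: ifPn => // /[!inE] Dx.
by apply: contrapT => fg; apply: Nx; apply: fgN => /= /(_ Dx).
Qed.

Lemma eq_integral_ae (D : set T) (f g : T -> \bar R) :
  (\forall x \ae mu, D x -> f x = g x) ->
  \int[mu]_(x in D) f x = \int[mu]_(x in D) g x.
Proof.
move=> fg; rewrite integralE [RHS]integralE.
by congr (_ - _); apply/eqP; rewrite eq_le; apply/andP; split;
  apply: ge0_le_integral_ae => //; move: fg; apply: filterS => x /[apply];
  rewrite ?funeposE ?funenegE => ->.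
Qed.

End AlmostEverywhere.

Lemma eq_Rintegral_ae d (T : measurableType d) (R : realType)
    (mu : {measure set T -> \bar R}) (D : set T) (f g : T -> R) :
  (\forall x \ae mu, D x -> f x = g x) ->
  \int[mu]_(x in D) f x = \int[mu]_(x in D) g x.
Proof.
by move=> fg; congr fine; apply: eq_integral_ae; move: fg; apply: filterS => x /[apply] ->.
Qed.

HB.lock Definition dot {R : realType} (u w : R -> R) : R :=
  \int[@lebesgue_measure R]_(x in `]0, 1[%classic) (u x * w x).
HB.lock Definition nrm {R : realType} (u : R -> R) : R := Num.sqrt (dot u u).

Section OneVariable.
Context {R : realType}.
Implicit Types (u w g : R -> R) (D : set R) (c C : R).

Local Notation mu := (@lebesgue_measure R).
Local Notation I := (`]0, 1[%classic : set R).

Local Notation mR := (@measurable _ (measurableTypeR R)).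

#[global] Instance ae_filter_lebesgue : Filter (nbhs (almost_everywhere mu)).
Proof. exact: (ae_filter_ringOfSetsType mu). Qed.

Definition itg D u := mu.-integrable D (EFin \o u).

Lemma measI : mR I. Proof. exact: measurable_itv. Qed.
Hint Resolve measI : core.

Lemma muI : mu I = 1%E.
Proof. by rewrite lebesgue_measure_itv /= lte_fin ltr01 oppr0 adde0. Qed.

Lemma itg_meas D u : itg D u -> measurable_fun D u.
Proof. by move/measurable_int/measurable_EFinP. Qed.

Lemma itgP D u : measurable_fun D u ->
  (\int[mu]_(x in D) (`|u x|)%:E < +oo)%E -> itg D u.
Proof. by move=> mu_ u_; apply/integrableP; split => //; exact/measurable_EFinP. Qed.

Lemma itg_lty D u : itg D u -> (\int[mu]_(x in D) (`|u x|)%:E < +oo)%E.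
Proof. by move/integrableP => []. Qed.

Lemma eq_itg D u w : mR D -> (forall x, D x -> u x = w x) -> itg D u -> itg D w.
Proof.
move=> mD uw; apply: eq_integrable => // x /[!inE] Dx /=.
by rewrite uw.
Qed.

Lemma itgD D u w : mR D -> itg D u -> itg D w ->
  itg D (fun x => u x + w x).
Proof. by move=> mD iu iw; have := integrableD mD iu iw. Qed.

Lemma itgZ D u c : mR D -> itg D u -> itg D (fun x => c * u x).
Proof. by move=> mD iu; have := integrableZl mD c iu. Qed.

Lemma itgN D u : mR D -> itg D u -> itg D (fun x => - u x).
Proof. by move=> mD iu; have := integrableN iu. Qed.

Lemma itgB D u w : mR D -> itg D u -> itg D w ->
  itg D (fun x => u x - w x).
Proof. by move=> mD iu iw; apply: itgD => //; exact: itgN. Qed.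

Lemma itg_abs D u : mR D -> itg D u -> itg D (fun x => `|u x|).
Proof. by move=> mD iu; exact: integrable_norm. Qed.

Lemma itgS D E u : mR D -> mR E -> E `<=` D -> itg D u -> itg E u.
Proof. by move=> mD mE ED; exact: integrableS. Qed.

Lemma le_itg D u w : mR D -> measurable_fun D u ->
  (forall x, D x -> `|u x| <= w x) -> itg D w -> itg D u.
Proof.
move=> mD mu_ uw iw; apply: (le_integrable mD _ _ iw) => [|x Dx /=].
  exact/measurable_EFinP.
by rewrite lee_fin (le_trans (uw x Dx))// ler_norm.
Qed.

Lemma itg_cst D c : mR D -> (mu D < +oo)%E -> itg D (fun=> c).
Proof.
move=> mD Dy; apply: itgP => //; rewrite integral_cst// -ge0_fin_numE//.
by rewrite fin_numM// ge0_fin_numE.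
Qed.

Lemma itg_cstI c : itg I (fun=> c).
Proof. by apply: itg_cst => //; rewrite muI ltry. Qed.

Lemma int_cstI c : \int[mu]_(x in I) c = c.
Proof. by rewrite Rintegral_cst ?measI// -[X in fine X]/(mu I) muI mulr1. Qed.

Lemma itgM_bnd D u w C : mR D -> itg D u -> measurable_fun D w ->
  (forall x, D x -> `|w x| <= C) -> itg D (fun x => w x * u x).
Proof.
move=> mD iu mw wC.
apply: (@le_itg _ _ (fun x => C * `|u x|)) => //.
- by apply: measurable_funM => //; exact: itg_meas.
- by move=> x Dx; rewrite normrM ler_wpM2r// wC.
- by apply: itgZ => //; exact: itg_abs.
Qed.

Lemma itg_ae D u w : mR D -> itg D u -> measurable_fun D w ->
  (\forall x \ae mu, D x -> u x = w x) -> itg D w.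
Proof.
move=> mD iu mw uw; apply: itgP => //; apply: le_lt_trans (itg_lty iu).
apply: ge0_le_integral_ae => //; move: uw; apply: filterS => x /[apply] ->.
by rewrite lexx.
Qed.

Lemma le_int D u w : mR D -> itg D u -> itg D w ->
  (forall x, D x -> u x <= w x) ->
  \int[mu]_(x in D) u x <= \int[mu]_(x in D) w x.
Proof. exact: le_Rintegral. Qed.

Lemma intE D u : itg D u -> mR D ->
  (\int[mu]_(x in D) (u x)%:E)%E = (\int[mu]_(x in D) u x)%:E.
Proof. by move=> iu mD; rewrite fineK//; exact: integrable_fin_num. Qed.

Lemma intD D u w : mR D -> itg D u -> itg D w ->
  \int[mu]_(x in D) (u x + w x) = \int[mu]_(x in D) u x + \int[mu]_(x in D) w x.
Proof. exact: RintegralD. Qed.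

Lemma intB D u w : mR D -> itg D u -> itg D w ->
  \int[mu]_(x in D) (u x - w x) = \int[mu]_(x in D) u x - \int[mu]_(x in D) w x.
Proof. exact: RintegralB. Qed.

Lemma intZ D u c : mR D -> itg D u ->
  \int[mu]_(x in D) (c * u x) = c * \int[mu]_(x in D) u x.
Proof. by move=> mD iu; exact: RintegralZl. Qed.

Lemma ler_norm_int D u w : mR D -> measurable_fun D u -> itg D w ->
  (forall x, D x -> `|u x| <= w x) ->
  `|\int[mu]_(x in D) u x| <= \int[mu]_(x in D) w x.
Proof.
move=> mD mu_ iw uw; have iu : itg D u := le_itg mD mu_ uw iw.
apply: le_trans (le_normr_Rintegral mD iu) _.
by apply: le_int => //; exact: itg_abs.
Qed.

Lemma int_ae0 D u : mR D -> itg D u ->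
  (forall x, D x -> 0 <= u x) -> \int[mu]_(x in D) u x = 0 ->
  \forall x \ae mu, D x -> u x = 0.
Proof.
move=> mD iu u0 u_.
have [+ _] := @ae_eq_integral_abs _ _ _ mu D mD _ (measurable_int mu iu).
move=> H; have {}H : ae_eq mu D (EFin \o u) (cst 0%E).
  apply: H; transitivity (\int[mu]_(x in D) (u x)%:E)%E; last by rewrite intE// u_.
  by apply: eq_integral => x /[!inE] Dx /=; rewrite ger0_norm// u0.
by move: H; apply: filterS => x /[apply] -[].
Qed.

(** * Square-integrable functions on the unit interval *)

Lemma dotE u w : dot u w = \int[mu]_(x in I) (u x * w x).
Proof. by rewrite dot.unlock. Qed.

Lemma nrmE u : nrm u = Num.sqrt (dot u u).
Proof. by rewrite nrm.unlock. Qed.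

Lemma L2P u : measurable_fun I u -> itg I (fun x => u x ^+ 2) -> L2 u.
Proof.
move=> mu_ iu; split => //; rewrite /sqL2.
apply: le_lt_trans (itg_lty iu); apply: ge0_le_integral => //=.
- by move=> x _; rewrite lee_fin sqr_ge0.
- by apply/measurable_EFinP; exact: measurable_funX.
- by apply/measurable_EFinP; apply: measurableT_comp => //; exact: measurable_funX.
- by move=> x _; rewrite lee_fin ler_norm.
Qed.

Lemma L2_sqr u : L2 u -> itg I (fun x => u x ^+ 2).
Proof.
move=> [mu_ uy]; apply: itgP; first exact: measurable_funX.
by under eq_integral do rewrite ger0_norm ?sqr_ge0//.
Qed.

Lemma L2_meas u : L2 u -> measurable_fun I u. Proof. by case. Qed.

Lemma itgM u w : L2 u -> L2 w -> itg I (fun x => u x * w x).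
Proof.
move=> u2 w2; apply: (@le_itg _ _ (fun x => u x ^+ 2 + w x ^+ 2)) => //.
- by apply: measurable_funM; exact: L2_meas.
- move=> x _; rewrite normrM; have := sqr_ge0 (`|u x| - `|w x|).
  rewrite -(real_normK (num_real (u x))) -(real_normK (num_real (w x))).
  have := normr_ge0 (u x); have := normr_ge0 (w x).
  by nra.
- by apply: itgD => //; exact: L2_sqr.
Qed.

Lemma L2_cst c : L2 (fun _ : R => c).
Proof. by apply: L2P => //; exact: itg_cstI. Qed.

Lemma L2_itg u : L2 u -> itg I u.
Proof.
move=> u2; have := itgM u2 (L2_cst 1).
by apply: eq_itg => // x _ /=; rewrite mulr1.
Qed.

Lemma L2_le u w : measurable_fun I u -> L2 w ->
  (forall x, I x -> `|u x| <= `|w x|) -> L2 u.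
Proof.
move=> mu_ w2 uw; apply: L2P => //; apply: (le_itg _ _ _ (L2_sqr w2)) => //.
  exact: measurable_funX.
move=> x Ix; rewrite ger0_norm ?sqr_ge0// -[leRHS]ger0_norm ?sqr_ge0//.
by rewrite -[leLHS]ger0_norm ?sqr_ge0// !normrX lerXn2r ?nnegrE// uw.
Qed.

Lemma L2D u w : L2 u -> L2 w -> L2 (fun x => u x + w x).
Proof.
move=> u2 w2; apply: L2P; first by apply: measurable_funD; exact: L2_meas.
apply: (@eq_itg _ (fun x => u x ^+ 2 + (2 * (u x * w x) + w x ^+ 2))) => //.
  by move=> x _ /=; ring.
by apply: itgD => //; [exact: L2_sqr|apply: itgD => //;
  [apply: itgZ => //; exact: itgM|exact: L2_sqr]].
Qed.

Lemma L2Mb u w C : L2 u -> measurable_fun I w ->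
  (forall x, I x -> `|w x| <= C) -> L2 (fun x => w x * u x).
Proof.
move=> u2 mw wC; apply: L2P.
  by apply: measurable_funM => //; exact: L2_meas.
apply: (@eq_itg _ (fun x => w x ^+ 2 * u x ^+ 2)) => //.
  by move=> x _ /=; ring.
apply: (@itgM_bnd _ _ _ (C ^+ 2)) => //; first exact: L2_sqr.
  exact: measurable_funX.
by move=> x Ix; rewrite normrX lerXn2r ?nnegrE ?wC// (le_trans _ (wC x Ix)).
Qed.

Lemma L2Z u c : L2 u -> L2 (fun x => c * u x).
Proof. by move=> u2; apply: (@L2Mb _ _ `|c|). Qed.

Lemma L2N u : L2 u -> L2 (fun x => - u x).
Proof.
move=> u2; have := L2Z (-1) u2; rewrite (_ : (fun x => _) = (fun x => - u x))//.
by apply/funext => x; rewrite mulN1r.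
Qed.

Lemma L2B u w : L2 u -> L2 w -> L2 (fun x => u x - w x).
Proof. by move=> u2 w2; apply: L2D => //; exact: L2N. Qed.

Lemma L2_bnd u C : measurable_fun I u -> (forall x, I x -> `|u x| <= C) -> L2 u.
Proof.
move=> mu_ uC; apply: (L2_le mu_ (L2_cst C)) => x Ix.
by rewrite (le_trans (uC x Ix))// ler_norm.
Qed.

Lemma L2_ae u w : L2 u -> measurable_fun I w ->
  (\forall x \ae mu, I x -> u x = w x) -> L2 w.
Proof.
move=> u2 mw uw; apply: L2P => //; apply: (itg_ae _ (L2_sqr u2)) => //.
  exact: measurable_funX.
by move: uw; apply: filterS => x /[apply] ->.
Qed.

Lemma dotC u w : dot u w = dot w u.
Proof. by rewrite !dotE; apply: eq_Rintegral => x _; rewrite mulrC. Qed.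

Lemma dotDl u w g : L2 u -> L2 w -> L2 g ->
  dot (fun x => u x + w x) g = dot u g + dot w g.
Proof.
move=> u2 w2 g2; rewrite !dotE -RintegralD//; [|exact: itgM..].
by apply: eq_Rintegral => x _; rewrite mulrDl.
Qed.

Lemma dotZl u g c : L2 u -> L2 g -> dot (fun x => c * u x) g = c * dot u g.
Proof.
move=> u2 g2; rewrite !dotE -RintegralZl//; last exact: itgM.
by apply: eq_Rintegral => x _; rewrite mulrA.
Qed.

Lemma dotNl u g : L2 u -> L2 g -> dot (fun x => - u x) g = - dot u g.
Proof.
move=> u2 g2; rewrite -mulN1r -dotZl//; congr dot.
by apply/funext => x; rewrite mulN1r.
Qed.

Lemma dotBl u w g : L2 u -> L2 w -> L2 g ->
  dot (fun x => u x - w x) g = dot u g - dot w g.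
Proof.
by move=> u2 w2 g2; rewrite dotDl// ?dotNl//; exact: L2N.
Qed.

Lemma dotDr u w g : L2 u -> L2 w -> L2 g ->
  dot g (fun x => u x + w x) = dot g u + dot g w.
Proof. by move=> *; rewrite dotC dotDl// !(dotC g). Qed.

Lemma dotZr u g c : L2 u -> L2 g -> dot g (fun x => c * u x) = c * dot g u.
Proof. by move=> *; rewrite dotC dotZl// !(dotC g). Qed.

Lemma dotBr u w g : L2 u -> L2 w -> L2 g ->
  dot g (fun x => u x - w x) = dot g u - dot g w.
Proof. by move=> *; rewrite dotC dotBl// !(dotC g). Qed.

Lemma dot_ge0 u : 0 <= dot u u.
Proof. by rewrite dotE; apply: Rintegral_ge0 => x _; rewrite -expr2 sqr_ge0. Qed.

Lemma nrm_ge0 u : 0 <= nrm u. Proof. by rewrite nrmE sqrtr_ge0. Qed.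

Lemma nrm_sqr u : nrm u ^+ 2 = dot u u.
Proof. by rewrite nrmE sqr_sqrtr// dot_ge0. Qed.

Lemma sqL2E u : L2 u -> sqL2 u = (nrm u ^+ 2)%:E.
Proof. by move=> u2; rewrite nrm_sqr dotE -intE// ?itgM. Qed.

Lemma dot_ae u u' w w' : (\forall x \ae mu, I x -> u x = u' x) ->
  (\forall x \ae mu, I x -> w x = w' x) -> dot u w = dot u' w'.
Proof.
move=> uu ww; rewrite !dotE; apply: eq_Rintegral_ae.
by apply: filterS2 uu ww => x uu ww Ix; rewrite uu// ww.
Qed.

Lemma nrm_ae u w : (\forall x \ae mu, I x -> u x = w x) -> nrm u = nrm w.
Proof. by move=> uw; rewrite !nrmE (dot_ae uw uw). Qed.

Lemma sqL2_ae u w : (\forall x \ae mu, I x -> u x = w x) -> sqL2 u = sqL2 w.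
Proof.
by move=> uw; apply: eq_integral_ae; move: uw; apply: filterS => x /[apply] ->.
Qed.

Lemma quad_discr (A B C : R) : 0 <= A -> 0 <= B ->
  (forall r, 0 <= A - 2 * r * C + r ^+ 2 * B) -> `|C| <= Num.sqrt A * Num.sqrt B.
Proof.
move=> A0 B0 H; rewrite -sqrtrM// -sqrtr_sqr ler_wsqrtr//.
have [B_|Bn0] := eqVneq B 0.
  rewrite B_ in H *.
  have [->|Cn0] := eqVneq C 0; first by rewrite expr0n mulr0.
  have := H ((A + 1) / C).
  have -> : 2 * ((A + 1) / C) * C = 2 * (A + 1) by field.
  lra.
have Bp : 0 < B by rewrite lt_def Bn0.
have := H (C / B); rewrite -(pmulr_rge0 _ Bp).
have -> : B * (A - 2 * (C / B) * C + (C / B) ^+ 2 * B) = A * B - C ^+ 2.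
  by field.
by rewrite subr_ge0.
Qed.

Lemma dot_abs_le u w : L2 u -> L2 w ->
  \int[mu]_(x in I) `|u x * w x| <= nrm u * nrm w.
Proof.
move=> u2 w2; apply: le_trans (ler_norm _) _.
have ua : L2 (fun x => `|u x|).
  by apply: (L2_le _ u2) => [|x _]; [apply: measurableT_comp => //; exact: L2_meas|rewrite normr_id].
have wa : L2 (fun x => `|w x|).
  by apply: (L2_le _ w2) => [|x _]; [apply: measurableT_comp => //; exact: L2_meas|rewrite normr_id].
have nA (g : R -> R) : dot (fun x => `|g x|) (fun x => `|g x|) = dot g g.
  by rewrite !dotE; apply: eq_Rintegral => x _; rewrite -normrM -expr2 ger0_norm ?sqr_ge0.
have -> : \int[mu]_(x in I) `|u x * w x| = dot (fun x => `|u x|) (fun x => `|w x|).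
  by rewrite dotE; apply: eq_Rintegral => x _; rewrite normrM.
rewrite !nrmE; apply: quad_discr; rewrite ?dot_ge0// => r.
have := dot_ge0 (fun x => `|u x| - r * `|w x|).
rewrite dotBl//; [|exact: L2Z|exact: L2B (L2Z _ _)].
rewrite !dotBr//; [|exact: L2Z..].
rewrite !dotZl//; [|exact: L2Z]; rewrite !dotZr// !nA.
rewrite (dotC (fun x => `|w x|)); lra.
Qed.

Lemma CS u w : L2 u -> L2 w -> `|dot u w| <= nrm u * nrm w.
Proof.
move=> u2 w2; rewrite dotE.
apply: le_trans (le_normr_Rintegral _ _) (dot_abs_le u2 w2) => //.
exact: itgM.
Qed.

Lemma int_CS u w : L2 u -> L2 w -> `|\int[mu]_(x in I) (u x * w x)| <= nrm u * nrm w.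
Proof. by rewrite -dotE; exact: CS. Qed.

Lemma nrmD u w : L2 u -> L2 w -> nrm (fun x => u x + w x) <= nrm u + nrm w.
Proof.
move=> u2 w2; rewrite -(@ler_pXn2r _ 2)// ?nnegrE ?addr_ge0 ?nrm_ge0//.
rewrite nrm_sqr dotDl// ?dotDr//; [|exact: L2D..].
have := CS u2 w2; rewrite ler_norml => /andP[_].
rewrite sqrrD -!nrm_sqr (dotC w); lra.
Qed.

Lemma nrmZ u c : L2 u -> nrm (fun x => c * u x) = `|c| * nrm u.
Proof.
move=> u2; rewrite !nrmE dotZl//; last exact: L2Z.
by rewrite dotZr// mulrA -expr2 sqrtrM ?sqr_ge0// sqrtr_sqr.
Qed.

Lemma nrmN u : nrm (fun x => - u x) = nrm u.
Proof. by rewrite !nrmE !dotE; congr Num.sqrt; apply: eq_Rintegral => x _; rewrite mulrNN. Qed.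

Lemma nrmB u w : L2 u -> L2 w -> nrm (fun x => u x - w x) <= nrm u + nrm w.
Proof. by move=> u2 w2; rewrite -(nrmN w); apply: nrmD => //; exact: L2N. Qed.

Lemma int_abs_le u : L2 u -> \int[mu]_(x in I) `|u x| <= nrm u.
Proof.
move=> u2; have := dot_abs_le u2 (L2_cst 1).
rewrite [nrm (fun=> 1)]nrmE dotE; under [in X in _ <= X]eq_Rintegral do rewrite mulr1.
by rewrite int_cstI sqrtr1 mulr1; under eq_Rintegral do rewrite mulr1.
Qed.

Lemma nrm_Mb u w C : 0 <= C -> L2 u -> measurable_fun I w ->
  (forall x, I x -> `|w x| <= C) -> nrm (fun x => w x * u x) <= C * nrm u.
Proof.
move=> C0 u2 mw wC; rewrite -(@ler_pXn2r _ 2)// ?nnegrE ?mulr_ge0 ?nrm_ge0//.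
rewrite exprMn !nrm_sqr !dotE -RintegralZl//; last exact: itgM.
apply: le_int => //.
- by apply: itgM; exact: (@L2Mb _ _ C).
- by apply: itgZ => //; exact: itgM.
- move=> x Ix; rewrite mulrACA -!expr2 ler_wpM2r ?sqr_ge0//.
  by rewrite -[leLHS]ger0_norm ?sqr_ge0// normrX lerXn2r ?nnegrE ?wC.
Qed.

Lemma nrm_bnd u C : 0 <= C -> measurable_fun I u ->
  (forall x, I x -> `|u x| <= C) -> nrm u <= C.
Proof.
move=> C0 mu_ uC; have := nrm_Mb C0 (L2_cst 1) mu_ uC.
have -> : nrm (fun x => u x * 1) = nrm u.
  by congr nrm; apply/funext => x; rewrite mulr1.
by rewrite [nrm (fun=> 1)]nrmE dotE int_cstI mulr1 sqrtr1 mulr1.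
Qed.

End OneVariable.
#[global] Hint Extern 0 (measurable _) => (exact: measI) : core.

(** * Iterated integrals of real-valued functions *)

Section Fubini.
Context {R : realType}.
Local Notation mu := (@lebesgue_measure R).
Local Notation mR := (@measurable _ (measurableTypeR R)).

Lemma meas_if_lt d (T : measurableType d) (D : set T) (f g h : T -> R) :
  measurable D -> measurable_fun D f -> measurable_fun D g ->
  measurable_fun D h -> measurable_fun D (fun x => if f x < g x then h x else 0).
Proof.
move=> mD mf mg mh; apply: measurable_fun_if => //.
- exact: measurable_fun_ltr.
- by apply: measurable_funS mh => //; exact: subIsetl.
Qed.

Lemma meas_fst d1 d2 (T1 : measurableType d1) (T2 : measurableType d2)
    (D1 : set T1) (D2 : set T2) (g : T1 -> R) : measurable D1 -> measurable D2 ->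
  measurable_fun D1 g -> measurable_fun (D1 `*` D2) (fun p => g p.1).
Proof.
move=> mD1 mD2 mg; apply: (measurable_comp (F := D1) _ _ mg) => //.
- by move=> _ [[? ?] [? ?] <-].
- exact: measurable_funTS.
Qed.

Lemma meas_snd d1 d2 (T1 : measurableType d1) (T2 : measurableType d2)
    (D1 : set T1) (D2 : set T2) (g : T2 -> R) : measurable D1 -> measurable D2 ->
  measurable_fun D2 g -> measurable_fun (D1 `*` D2) (fun p => g p.2).
Proof.
move=> mD1 mD2 mg; apply: (measurable_comp (F := D2) _ _ mg) => //.
- by move=> _ [[? ?] [? ?] <-].
- exact: measurable_funTS.
Qed.

Lemma meas_section d1 d2 (T1 : measurableType d1) (T2 : measurableType d2)
    (D1 : set T1) (D2 : set T2) (F : T1 -> T2 -> R) t :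
  measurable D1 -> measurable D2 -> D1 t ->
  measurable_fun (D1 `*` D2) (fun p => F p.1 p.2) -> measurable_fun D2 (F t).
Proof.
move=> mD1 mD2 Dt mF.
apply: (measurable_comp (F := D1 `*` D2) (g := pair t) _ _ mF).
- exact: measurableX.
- by move=> _ [x ? <-].
- exact: measurable_funTS.
Qed.

Lemma meas_swap d1 d2 (T1 : measurableType d1) (T2 : measurableType d2)
    (D1 : set T1) (D2 : set T2) (F : T1 -> T2 -> R) :
  measurable D1 -> measurable D2 ->
  measurable_fun (D1 `*` D2) (fun p => F p.1 p.2) ->
  measurable_fun (D2 `*` D1) (fun p => F p.2 p.1).
Proof.
move=> mD1 mD2 mF.
apply: (measurable_comp (F := D1 `*` D2) (g := fun p : T2 * T1 => (p.2, p.1)) _ _ mF).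
- exact: measurableX.
- by move=> _ [[x t] [/= ? ?] <-].
- by apply: measurable_funTS; exact: measurable_swap.
Qed.

Lemma meas_tonelli d (T : measurableType d) (D1 : set T) (D2 : set R)
    (F : T -> R -> R) : measurable D1 -> mR D2 ->
  measurable_fun (D1 `*` D2) (fun p : T * R => F p.1 p.2) ->
  (forall t x, D1 t -> D2 x -> 0 <= F t x) ->
  measurable_fun D1 (fun t => \int[mu]_(x in D2) (F t x)%:E)%E.
Proof.
move=> mD1 mD2 mF F0.
pose G := (fun p : T * measurableTypeR R => (F p.1 p.2)%:E) \_ (D1 `*` D2).
have mG : measurable_fun [set: T * measurableTypeR R] G.
  apply/(measurable_restrictT _ _).1; first exact: measurableX.
  by apply/measurable_EFinP; exact: mF.
have G0 p : (0 <= G p)%E.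
  by rewrite /G patchE; case: ifPn => // /[!inE] -[? ?]; rewrite lee_fin F0.
have := @measurable_fun_fubini_tonelli_F _ _ T (measurableTypeR R) R mu G mG G0.
move/(measurable_funS measurableT (@subsetT _ D1)).
apply: eq_measurable_fun => t /[!inE] Dt; rewrite /fubini_F [RHS]integral_mkcond.
apply: eq_integral => x _; rewrite /G !patchE/=.
by congr (if _ then _ else _); apply/idP/idP; rewrite !inE => //= -[].
Qed.

Lemma meas_param d (T : measurableType d) (D1 : set T) (D2 : set R)
    (F : T -> R -> R) : measurable D1 -> mR D2 ->
  measurable_fun (D1 `*` D2) (fun p : T * R => F p.1 p.2) ->
  measurable_fun D1 (fun t => \int[mu]_(x in D2) F t x).
Proof.
move=> mD1 mD2 mF; apply: measurableT_comp => //.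
under eq_fun do rewrite integralE.
apply: emeasurable_funB.
- rewrite [X in measurable_fun _ X](_ : _ = (fun t => \int[mu]_(x in D2) (Num.max (F t x) 0)%:E)%E).
    apply: meas_tonelli => //; first exact: measurable_funrpos.
    by move=> *; rewrite le_max lexx orbT.
  by apply/funext => t; apply: eq_integral => x _; rewrite funeposE EFin_max.
- rewrite [X in measurable_fun _ X](_ : _ = (fun t => \int[mu]_(x in D2) (Num.max (- F t x) 0)%:E)%E).
    apply: meas_tonelli => //; first exact: measurable_funrneg.
    by move=> *; rewrite le_max lexx orbT.
  by apply/funext => t; apply: eq_integral => x _; rewrite funenegE EFin_max EFinN.
Qed.

Section fubini_itg.
Variables (D1 D2 : set R) (F : R -> R -> R) (b : R -> R).
Hypotheses (mD1 : mR D1) (mD2 : mR D2).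
Hypothesis mF : measurable_fun (D1 `*` D2) (fun p : R * R => F p.1 p.2).
Hypothesis iF : forall t, D1 t -> itg D2 (F t).
Hypothesis ib : itg D1 b.
Hypothesis Fb : forall t, D1 t -> \int[mu]_(x in D2) `|F t x| <= b t.

Let G := (fun p : measurableTypeR R * measurableTypeR R => (F p.1 p.2)%:E) \_ (D1 `*` D2).

Let mG : measurable_fun [set: measurableTypeR R * measurableTypeR R] G.
Proof.
apply/(measurable_restrictT _ _).1; first exact: measurableX.
by apply/measurable_EFinP; exact: mF.
Qed.

Let GE t x : G (t, x) =
  (if t \in D1 then if x \in D2 then (F t x)%:E else 0%E else 0%E).
Proof.
rewrite /G patchE; case: ifPn => /=.
  by rewrite inE => -[/= ? ?]; rewrite !mem_set.
move=> /negP H; case: ifPn => // tD; case: ifPn => // xD.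
by exfalso; apply: H; move: tD xD; rewrite !inE.
Qed.

Let iG : (mu \x mu)%E.-integrable setT G.
Proof.
apply/(integrable12ltyP mu mu mG); apply: le_lt_trans (itg_lty ib).
rewrite [leRHS]integral_mkcond; apply: ge0_le_integral_ae => [x _|x _|].
- exact: integral_ge0.
- by rewrite erestrict_ge0// => y _; rewrite lee_fin.
- apply: aeW => t _; rewrite patchE; under eq_integral do rewrite GE.
  case: ifPn => tD; last by under eq_integral do rewrite abse0; rewrite integral0.
  have Dt : D1 t by rewrite inE in tD.
  apply: (@le_trans _ _ (\int[mu]_(x in D2) (`|F t x|)%:E)%E).
    rewrite [leRHS]integral_mkcond le_eqVlt; apply/orP; left; apply/eqP.
    by apply: eq_integral => x _; rewrite patchE; case: ifPn => //; rewrite abse0.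
  rewrite intE//; last by apply: itg_abs => //; exact: iF.
  by rewrite lee_fin (le_trans (Fb Dt))// ler_norm.
Qed.

Let intG1 t : (\int[mu]_x G (t, x))%E =
  (if t \in D1 then (\int[mu]_(x in D2) F t x)%:E else 0%E).
Proof.
under eq_integral do rewrite GE; case: ifPn => tD; last by rewrite integral0.
have Dt : D1 t by rewrite inE in tD.
by rewrite -intE ?iF// [RHS]integral_mkcond; apply: eq_integral => x _; rewrite patchE.
Qed.

Let intG2 x : (\int[mu]_t G (t, x))%E =
  (if x \in D2 then (\int[mu]_(t in D1) (F t x)%:E)%E else 0%E).
Proof.
case: ifPn => xD; last first.
  rewrite -[RHS](@integral0 _ _ _ mu setT); apply: eq_integral => t _.
  by rewrite GE (negbTE xD); case: ifP.
by rewrite [RHS]integral_mkcond; apply: eq_integral => t _; rewrite patchE GE xD.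
Qed.

Lemma fubini_itg1 : itg D1 (fun t => \int[mu]_(x in D2) F t x).
Proof.
apply: (le_itg mD1 _ _ ib).
  exact: (@meas_param _ R D1 D2 F mD1 mD2 mF).
by move=> t Dt; apply: le_trans (Fb Dt); apply: le_normr_Rintegral => //; exact: iF.
Qed.

Lemma fubini_ae : \forall x \ae mu, D2 x -> itg D1 (F ^~ x).
Proof.
have := ae_integrable2 iG; apply: filterS => x ix Dx.
apply/(integrable_mkcond _ mD1); apply: eq_integrable ix => //= t _.
by rewrite GE patchE (mem_set Dx).
Qed.

Let mF' : measurable_fun (D2 `*` D1) (fun p : R * R => F p.2 p.1).
Proof.
exact: (@meas_swap _ _ R R).
Qed.

Lemma fubini_itg2 : itg D2 (fun x => \int[mu]_(t in D1) F t x).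
Proof.
have m2 : measurable_fun D2 (fun x => \int[mu]_(t in D1) F t x).
  exact: (@meas_param _ R D2 D1 (fun x t => F t x) mD2 mD1 mF').
apply: itgP => //; apply: le_lt_trans ((integrable21ltyP mu mu mG).1 iG).
rewrite integral_mkcond; apply: ge0_le_integral_ae => [x _|x _|].
- by rewrite erestrict_ge0// => y _; rewrite lee_fin.
- exact: integral_ge0.
- have := fubini_ae; apply: filterS => x ix _.
  rewrite patchE; case: ifPn => [xD|_]; last exact: integral_ge0.
  have Dx : D2 x by rewrite inE in xD.
  rewrite [leRHS](_ : _ = (\int[mu]_(t in D1) (`|F t x|)%:E)%E).
    have := ix Dx => jx; rewrite intE//; last exact: itg_abs.
    by rewrite lee_fin; exact: le_normr_Rintegral.
  rewrite [RHS]integral_mkcond; apply: eq_integral => t _.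
  by rewrite GE xD patchE; case: ifPn => //; rewrite abse0.
Qed.

Lemma fubini_eq : \int[mu]_(t in D1) \int[mu]_(x in D2) F t x =
  \int[mu]_(x in D2) \int[mu]_(t in D1) F t x.
Proof.
apply: EFin_inj; rewrite -(intE fubini_itg1 mD1) -(intE fubini_itg2 mD2).
have := Fubini iG.
under eq_integral do rewrite intG1.
under [in X in _ = X -> _]eq_integral do rewrite intG2.
move=> H; transitivity (\int[mu]_t (if t \in D1 then (\int[mu]_(x in D2) F t x)%:E else 0%R))%E.
  by rewrite integral_mkcond; apply: eq_integral => t _; rewrite patchE.
rewrite [LHS]H [RHS]integral_mkcond; apply: eq_integral_ae.
have := fubini_ae; apply: filterS => x ix _; rewrite patchE.
by case: ifPn => // /[!inE] Dx; rewrite intE//; exact: ix.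
Qed.

End fubini_itg.
End Fubini.

(** * Indefinite integrals and absolutely continuous functions *)

HB.lock Definition prim {R : realType} (g : R -> R) (x : R) : R :=
  \int[@lebesgue_measure R]_(y in `]0, x[) g y.

Section Primitives.
Context {R : realType}.
Implicit Types (u w g : R -> R) (D : set R) (c C x y z : R).
Local Notation mu := (@lebesgue_measure R).
Local Notation I := (`]0, 1[%classic : set R).
Local Notation mR := (@measurable _ (measurableTypeR R)).

Lemma prim_int g x : prim g x = \int[mu]_(y in `]0, x[) g y.
Proof. by rewrite prim.unlock. Qed.

Lemma mR_itv (i : interval R) : mR [set` i]. Proof. exact: measurable_itv. Qed.
Hint Resolve mR_itv : core.

Lemma prim1 g : prim g 1 = \int[mu]_(x in I) g x. Proof. exact: prim_int. Qed.

Lemma prim0 g : prim g 0 = 0.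
Proof. by rewrite !prim_int set_itv_ge ?bnd_simp ?ltxx// Rintegral_set0. Qed.

Lemma sub0x x : x <= 1 -> `]0, x[ `<=` I.
Proof. by move=> x1; apply: subset_itvl; rewrite bnd_simp. Qed.

Lemma itg_sub g x : x <= 1 -> itg I g -> itg `]0, x[ g.
Proof. by move=> x1; apply: itgS => //; exact: sub0x. Qed.

Lemma primE g x : x <= 1 -> prim g x = \int[mu]_(y in I) (if y < x then g y else 0).
Proof.
move=> x1; rewrite !prim_int Rintegral_mkcond [RHS]Rintegral_mkcond.
apply: eq_Rintegral => y _; rewrite !patchE.
have [yI|yI] := boolP (y \in I); last first.
  case: ifPn => // /[!inE] /(sub0x x1) Iy.
  by move/negP : yI; case; rewrite inE.
move: yI; rewrite inE/= in_itv/= => /andP[y0 y1].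
case: ifPn; first by rewrite inE/= in_itv/= y0/= => ->.
by move/negP; rewrite inE/= in_itv/= y0/=; case: ifPn.
Qed.

Lemma primB g x y : itg I g -> 0 <= x -> x <= y -> y <= 1 ->
  prim g y - prim g x = \int[mu]_(z in I) (if (x <= z) && (z < y) then g z else 0).
Proof.
move=> ig x0 xy y1; rewrite !primE ?(le_trans xy)//.
have iy c : itg I (fun z => if z < c then g z else 0).
  apply: (le_itg _ _ _ (itg_abs _ ig)) => //.
    by apply: meas_if_lt => //; exact: itg_meas.
  by move=> z _; case: ifPn => //; rewrite normr0.
rewrite -RintegralB//; [|exact: iy..].
apply: eq_Rintegral => z _; have [xz|zx]/= := leP x z.
  by rewrite subr0.
by rewrite (lt_le_trans zx xy) subrr.
Qed.

Lemma ler_primB g x y : itg I g -> 0 <= x <= 1 -> 0 <= y <= 1 ->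
  `|prim g y - prim g x| <= \int[mu]_(z in I) `|g z|.
Proof.
move=> ig; wlog xy : x y / x <= y.
  by move=> H x01 y01; have [/H->//|/ltW/H] := leP x y; rewrite distrC => ->.
move=> /andP[x0 x1] /andP[y0 y1]; rewrite primB//.
apply: ler_norm_int => //.
- have -> : (fun z => if (x <= z) && (z < y) then g z else 0) =
      (fun z => (if z < y then g z else 0) - (if z < x then g z else 0)).
    apply/funext => z; have [xz|zx]/= := leP x z; first by rewrite subr0.
    by rewrite (lt_le_trans zx xy) subrr.
  by apply: measurable_funB; apply: meas_if_lt => //; exact: itg_meas.
- exact: itg_abs.
- by move=> z _; case: ifPn => //; rewrite normr0.
Qed.

Lemma ler_prim g x : itg I g -> 0 <= x <= 1 ->
  `|prim g x| <= \int[mu]_(z in I) `|g z|.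
Proof.
by move=> ig x01; have := @ler_primB g 0 x ig _ x01; rewrite prim0 subr0 lexx ler01; apply.
Qed.

Lemma eq_prim_ae g g' x : x <= 1 -> (\forall y \ae mu, I y -> g y = g' y) ->
  prim g x = prim g' x.
Proof.
move=> x1 gg; rewrite !prim_int; apply: eq_Rintegral_ae; move: gg; apply: filterS => y gg yx.
by apply: gg; exact: (sub0x x1).
Qed.

Lemma meas_prim g : measurable_fun I g -> measurable_fun I (prim g).
Proof.
move=> mg.
have : measurable_fun I (fun x => \int[mu]_(y in I) (if y < x then g y else 0)).
  apply: (@meas_param _ _ R I I (fun x y => if y < x then g y else 0)) => //.
  apply: meas_if_lt; [exact: measurableX|exact: measurable_funTS..|].
  exact: meas_snd.
apply: eq_measurable_fun => x /[!inE]/=; rewrite in_itv/= => /andP[_ /ltW x1].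
by rewrite primE.
Qed.

Lemma prim_bnd g : itg I g -> forall x, I x -> `|prim g x| <= \int[mu]_(z in I) `|g z|.
Proof.
move=> ig x /=; rewrite in_itv/= => /andP[/ltW ? /ltW ?]; apply: ler_prim => //.
exact/andP.
Qed.

Lemma L2_prim g : itg I g -> L2 (prim g).
Proof.
move=> ig; apply: (L2_bnd _ (prim_bnd ig)).
by apply: meas_prim; exact: itg_meas.
Qed.

(** The values are prescribed everywhere on [[0, 1]], not up to a null set, so
that boundary values can be read off. *)
Definition ac u g := itg I g /\ forall x, 0 <= x <= 1 -> u x = u 0 + prim g x.

Lemma ac_meas u g : ac u g -> measurable_fun I u.
Proof.
move=> [ig ug].
have : measurable_fun I (fun x => u 0 + prim g x).
  by apply: measurable_funD => //; apply: meas_prim; exact: itg_meas.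
apply: eq_measurable_fun => x /[!inE]/=; rewrite in_itv/= => /andP[/ltW ? /ltW ?].
by rewrite [RHS]ug//; apply/andP.
Qed.

Lemma ac_bnd u g : ac u g ->
  forall x, I x -> `|u x| <= `|u 0| + \int[mu]_(z in I) `|g z|.
Proof.
move=> [ig ug] x Ix; have := prim_bnd ig Ix; move: Ix => /=.
rewrite in_itv/= => /andP[/ltW ? /ltW ?] gx; rewrite ug ?(le_trans (ler_normD _ _)) ?lerD2l//.
exact/andP.
Qed.

Lemma ac_L2 u g : ac u g -> L2 u.
Proof. by move=> ug; apply: (L2_bnd (ac_meas ug) (ac_bnd ug)). Qed.

Lemma ac_int u g : ac u g -> \int[mu]_(x in I) g x = u 1 - u 0.
Proof. by move=> [ig ->]; rewrite ?lexx ?ler01// prim1 addrAC subrr add0r. Qed.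

Lemma ac_prim g : itg I g -> ac (prim g) g.
Proof. by move=> ig; split => // x _; rewrite prim0 add0r. Qed.

Lemma primD g1 g2 x : itg I g1 -> itg I g2 -> x <= 1 ->
  prim (fun y => g1 y + g2 y) x = prim g1 x + prim g2 x.
Proof. by move=> ? ? ?; rewrite !prim_int RintegralD//; exact: itg_sub. Qed.

Lemma primZ g c x : itg I g -> x <= 1 ->
  prim (fun y => c * g y) x = c * prim g x.
Proof. by move=> ? ?; rewrite !prim_int RintegralZl//; exact: itg_sub. Qed.

Lemma acD u1 g1 u2 g2 : ac u1 g1 -> ac u2 g2 ->
  ac (fun x => u1 x + u2 x) (fun x => g1 x + g2 x).
Proof.
move=> [i1 e1] [i2 e2]; split; first exact: itgD.
move=> x /andP[x0 x1]; rewrite primD// e1 ?x0// e2 ?x0//; ring.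
Qed.

Lemma acZ u g c : ac u g -> ac (fun x => c * u x) (fun x => c * g x).
Proof.
move=> [i1 e1]; split; first exact: itgZ.
by move=> x /andP[x0 x1]; rewrite primZ// e1 ?x0// mulrDr.
Qed.

Lemma ac_cst c : ac (fun=> c) (fun=> 0).
Proof.
split; first exact: itg_cstI.
by move=> x _; rewrite !prim_int Rintegral_cst// mul0r addr0.
Qed.

Lemma eq_ac u u' g g' : (forall x, 0 <= x <= 1 -> u x = u' x) -> itg I g' ->
  (\forall x \ae mu, I x -> g x = g' x) -> ac u g -> ac u' g'.
Proof.
move=> uu ig' gg [ig ug]; split => // x x01.
rewrite -!uu ?lexx ?ler01// ug//; congr (_ + _); apply: eq_prim_ae => //.
by case/andP : x01.
Qed.

(** The product rule is Fubini's theorem on the two triangles of the square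
[]0, x[ ^ 2]. *)
Lemma primM g1 g2 x : itg I g1 -> itg I g2 -> 0 <= x <= 1 ->
  prim g1 x * prim g2 x = prim (fun y => g1 y * prim g2 y + prim g1 y * g2 y) x.
Proof.
move=> i1 i2 /andP[x0 x1].
have j1 := itg_sub x1 i1; have j2 := itg_sub x1 i2.
have b1 : forall y, I y -> `|prim g1 y| <= _ := prim_bnd i1.
have b2 : forall y, I y -> `|prim g2 y| <= _ := prim_bnd i2.
have m1 := meas_prim (itg_meas i1); have m2 := meas_prim (itg_meas i2).
have k12 : itg I (fun y => prim g2 y * g1 y) by apply: itgM_bnd b2.
have k21 : itg I (fun y => prim g1 y * g2 y) by apply: itgM_bnd b1.
rewrite primD//; last by apply: eq_itg k12 => // y _; rewrite mulrC.
pose J := (`]0, x[%classic : set R).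
have mJ : mR J by exact: measurable_itv.
have JI : J `<=` I by exact: sub0x.
pose F y z : R := if y < z then g1 y * g2 z else 0.
have mF : measurable_fun (J `*` J) (fun p : R * R => F p.1 p.2).
  apply: meas_if_lt; [exact: measurableX|exact: measurable_funTS..|].
  apply: measurable_funM.
  - by apply: (@meas_fst R _ _ R R) => //; exact: itg_meas.
  - by apply: (@meas_snd R _ _ R R) => //; exact: itg_meas.
have FE y z : F y z = g1 y * (if y < z then g2 z else 0).
  by rewrite /F; case: ifP; rewrite ?mulr0.
have Fle y z : `|F y z| <= `|g1 y| * `|g2 z|.
  by rewrite FE normrM ler_wpM2l//; case: ifP; rewrite ?normr0.
have iF y : J y -> itg J (F y).
  move=> Jy; apply: (@le_itg _ _ _ (fun z => `|g1 y| * `|g2 z|)) => //.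
    exact: (@meas_section R _ _ R R J J F y).
  by apply: itgZ => //; exact: itg_abs.
have ib : itg J (fun y => `|g1 y| * \int[mu]_(z in J) `|g2 z|).
  by apply: eq_itg (itgZ (\int[mu]_(z in J) `|g2 z|) _ (itg_abs _ j1)) => // y _; rewrite mulrC.
have Fb y : J y -> \int[mu]_(z in J) `|F y z| <= `|g1 y| * \int[mu]_(z in J) `|g2 z|.
  move=> Jy; rewrite -RintegralZl//; last exact: itg_abs.
  by apply: le_int => //; [apply: itg_abs => //; exact: iF|apply: itgZ => //; exact: itg_abs].
have lo y : J y -> itg J (fun z => if y < z then g2 z else 0).
  move=> Jy; apply: (le_itg _ _ _ (itg_abs _ j2)) => //.
    by apply: meas_if_lt => //; exact: itg_meas.
  by move=> z _; case: ifPn => //; rewrite normr0.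
have hi y : J y -> itg J (fun z => if y < z then 0 else g2 z).
  move=> Jy; apply: eq_itg (itgB _ j2 (lo y Jy)) => // z _.
  by case: ifP; rewrite ?subrr ?subr0.
have Jx y : J y -> 0 < y < x by rewrite /J /= in_itv.
have up y : J y -> \int[mu]_(z in J) (if y < z then 0 else g2 z) = prim g2 y.
  move=> /Jx/andP[y0 yx].
  rewrite !prim_int -[RHS](_ : \int[mu]_(z in `]0, y]) g2 z = _); last first.
    rewrite Rintegral_itv_bndo_bndc//.
    by apply: itg_sub i2; rewrite (le_trans (ltW yx)).
  rewrite Rintegral_mkcond [RHS]Rintegral_mkcond; apply: eq_Rintegral => z _.
  rewrite !patchE; have [zJ|zJ] := boolP (z \in J).
    have /andP[z0 zx] : 0 < z < x by apply: Jx; rewrite inE in zJ.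
    have -> : (z \in `]0, y]%classic) = (z <= y).
      by apply/idP/idP; rewrite inE/= in_itv/= z0.
    by case: (ltP y z).
  case: ifPn => // /[!inE]/=; rewrite in_itv/= => /andP[z0 zy].
  by case/negP : zJ; rewrite inE /J /= in_itv/= z0 (le_lt_trans zy).
have low z : J z -> \int[mu]_(y in J) F y z = prim g1 z * g2 z.
  move=> /[dup] Jz /Jx/andP[z0 zx].
  transitivity (\int[mu]_(y in J) (g2 z * (if y < z then g1 y else 0))).
    by apply: eq_Rintegral => y _; rewrite /F; case: ifP; rewrite ?mulr0// mulrC.
  rewrite RintegralZl//; last first.
    apply: (le_itg _ _ _ (itg_abs _ j1)) => //.
      by apply: meas_if_lt => //; exact: itg_meas.
    by move=> y _; case: ifPn => //; rewrite normr0.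
  rewrite mulrC; congr (_ * _).
  rewrite prim_int Rintegral_mkcond [RHS]Rintegral_mkcond; apply: eq_Rintegral => y _.
  rewrite !patchE; have [yJ|yJ] := boolP (y \in J).
    have /andP[y0 yx] : 0 < y < x by apply: Jx; rewrite inE in yJ.
    have -> : (y \in `]0, z[%classic) = (y < z).
      by apply/idP/idP; rewrite inE/= in_itv/= y0.
    by case: (ltP y z).
  case: ifPn => // /[!inE]/=; rewrite in_itv/= => /andP[y0 yz].
  by case/negP : yJ; rewrite inE /J /= in_itv/= y0 (lt_trans yz).
have -> : prim (fun y => prim g1 y * g2 y) x = \int[mu]_(y in J) \int[mu]_(z in J) F y z.
  rewrite (fubini_eq mJ mJ mF iF ib Fb) !prim_int; apply: eq_Rintegral => z /[!inE] Jz.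
  by rewrite low.
rewrite !prim_int -/J -RintegralD//; last 2 first.
- by apply: itgS JI _ => //; apply: eq_itg k12 => // y _; rewrite mulrC.
- exact: (fubini_itg1 mJ mJ mF iF ib Fb).
rewrite -(RintegralZr _ mJ j1); apply: eq_Rintegral => y /[!inE] Jy.
rewrite -(RintegralZl (g1 y) mJ j2) -[X in _ = _ * X + _]/(prim g2 y) -(up y Jy).
rewrite -(RintegralZl (g1 y) mJ (hi y Jy)).
rewrite -(RintegralD mJ (itgZ (g1 y) mJ (hi y Jy)) (iF y Jy)).
apply: eq_Rintegral => z _.
by rewrite FE; case: ifP => _; rewrite !(mulr0, add0r, addr0).
Qed.

Lemma acM u1 g1 u2 g2 : ac u1 g1 -> ac u2 g2 ->
  ac (fun x => u1 x * u2 x) (fun x => g1 x * u2 x + u1 x * g2 x).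
Proof.
move=> a1 a2; have [i1 e1] := a1; have [i2 e2] := a2.
have j1 : itg I (fun y => g1 y * u2 y).
  apply: eq_itg (itgM_bnd _ i1 (ac_meas a2) (ac_bnd a2)) => // y _.
  by rewrite mulrC.
have j2 : itg I (fun y => u1 y * g2 y) by exact: (itgM_bnd _ i2 (ac_meas a1) (ac_bnd a1)).
split; first exact: itgD.
move=> x /[dup] x01 /andP[x0 x1].
rewrite e1// e2//.
transitivity (u1 0 * u2 0 + (u2 0 * prim g1 x + u1 0 * prim g2 x + prim g1 x * prim g2 x)).
  by ring.
congr (_ + _); rewrite primM// -!primZ// -!primD//.
- rewrite !prim_int; apply: eq_Rintegral => y /[!inE]/=; rewrite in_itv/= => /andP[/ltW y0 yx].
  rewrite (e1 y) ?y0 ?(le_trans (ltW yx))// (e2 y) ?y0 ?(le_trans (ltW yx))//; ring.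
- by apply: itgD => //; exact: itgZ.
- apply: itgD => //.
    apply: eq_itg (itgM_bnd _ i1 (meas_prim (itg_meas i2)) (prim_bnd i2)) => // y _.
    by rewrite mulrC.
  exact: (itgM_bnd _ i2 (meas_prim (itg_meas i1)) (prim_bnd i1)).
- exact: itgZ.
- exact: itgZ.
Qed.

End Primitives.

(** * Smooth functions and smooth approximation of indicators *)

Section Smooth.
Context {R : realType}.
Implicit Types (f g u w phi : R -> R) (a b c x y z t : R).
Local Notation mu := (@lebesgue_measure R).
Local Notation I := (`]0, 1[%classic : set R).
Local Notation mR := (@measurable _ (measurableTypeR R)).
Hint Resolve mR_itv : core.

Definition D1 f g := forall x, is_derive x 1 f (g x).

Lemma D1_derivable f g x : D1 f g -> derivable f x 1.
Proof. by move=> fg; have [] := fg x. Qed.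

Lemma D1E f g : D1 f g -> (derive1 f) = g.
Proof. by move=> fg; apply/funext => x; rewrite derive1E; have [] := fg x. Qed.

Lemma D1_derive1 f : (forall x, derivable f x 1) -> D1 f (derive1 f).
Proof. by move=> df x; rewrite derive1E; exact/derivableP. Qed.

Lemma D1_continuous f g : D1 f g -> continuous f.
Proof.
move=> fg x; apply: differentiable_continuous; apply/derivable1_diffP.
exact: D1_derivable fg.
Qed.

Lemma D1_cst c : D1 (fun=> c) (fun=> 0).
Proof. by move=> x; exact: is_derive_cst. Qed.

Lemma D1_affine a b : D1 (fun x => a * x + b) (fun=> a).
Proof.
move=> x; apply: is_derive_eq (_ : a *: 1 + 0 = a); last by rewrite addr0 [LHS]mulr1.
Qed.

Lemma D1D f1 g1 f2 g2 : D1 f1 g1 -> D1 f2 g2 ->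
  D1 (fun x => f1 x + f2 x) (fun x => g1 x + g2 x).
Proof. by move=> d1 d2 x; exact: is_deriveD. Qed.

Lemma D1M f1 g1 f2 g2 : D1 f1 g1 -> D1 f2 g2 ->
  D1 (fun x => f1 x * f2 x) (fun x => g1 x * f2 x + f1 x * g2 x).
Proof.
move=> d1 d2 x; apply: is_derive_eq (is_deriveM (d1 x) (d2 x)) _.
by rewrite addrC /GRing.scale /= mulrC.
Qed.

Lemma D1X n : D1 (fun x => x ^+ n) (fun x => n%:R * x ^+ n.-1).
Proof.
elim: n => [|n IH] x; first by rewrite mul0r; exact: (D1_cst 1 x).
have di : D1 (fun y : R => y) (fun=> 1) by move=> y; exact: is_derive_id.
rewrite (_ : (fun y => y ^+ n.+1) = (fun y => y * y ^+ n)); last first.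
  by apply/funext => y; rewrite exprS.
apply: is_derive_eq (D1M di IH x) _.
rewrite mul1r mulrCA; case: n {IH} => [|n]; first by rewrite !mul0r mul1r addr0.
by rewrite /= -exprS -[in RHS]addn1 natrD mulrDl mul1r addrC.
Qed.

Lemma D1V f g : D1 f g -> (forall x, f x != 0) ->
  D1 (fun x => (f x)^-1) (fun x => - g x * ((f x)^-1 * (f x)^-1)).
Proof.
move=> fg f0 x; apply: is_derive_eq (is_deriveV (f0 x) (fg x)) _.
by rewrite /GRing.scale /= -expr2 exprVn mulNr mulrC mulNr.
Qed.

Lemma D1_comp_affine f g a b : D1 f g ->
  D1 (fun x => f (a * x + b)) (fun x => a * g (a * x + b)).
Proof.
move=> fg x; rewrite mulrC.
exact: (@is_derive1_comp _ f (fun y => a * y + b) x _ _ (fg _) (D1_affine a b x)).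
Qed.

Lemma is_derive_cvg f x d :
  (h^-1 *: (f (h *: 1 + x) - f x) @[h --> 0^'] --> d) -> is_derive x 1 f d.
Proof. by move=> H; split; [apply/cvg_ex; exists d|exact/cvg_lim]. Qed.

Lemma is_derive_near f g x d : (\near x, f x = g x) -> is_derive x 1 f d ->
  is_derive x 1 g d.
Proof.
move=> fg [df <-]; split; first exact: near_eq_derivable df.
by apply/esym/near_eq_derive => //; rewrite oner_neq0.
Qed.

Fixpoint Dn n f : Prop :=
  if n is n'.+1 then exists g, D1 f g /\ Dn n' g else True.

Lemma DnW n f : Dn n.+1 f -> Dn n f.
Proof. by elim: n f => [//|n IH] f [g [fg /IH gn]]; exists g. Qed.

Lemma Dn_cst n c : Dn n (fun=> c).
Proof. by elim: n c => [//|n IH] c; exists (fun=> 0); split; [exact: D1_cst|exact: IH]. Qed.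

Lemma DnD n f1 f2 : Dn n f1 -> Dn n f2 -> Dn n (fun x => f1 x + f2 x).
Proof.
elim: n f1 f2 => [//|n IH] f1 f2 [g1 [d1 n1]] [g2 [d2 n2]].
by exists (fun x => g1 x + g2 x); split; [exact: D1D|exact: IH].
Qed.

Lemma DnM n f1 f2 : Dn n f1 -> Dn n f2 -> Dn n (fun x => f1 x * f2 x).
Proof.
elim: n f1 f2 => [//|n IH] f1 f2 /[dup] /DnW m1 [g1 [d1 n1]] /[dup] /DnW m2 [g2 [d2 n2]].
exists (fun x => g1 x * f2 x + f1 x * g2 x); split; first exact: D1M.
by apply: DnD; exact: IH.
Qed.

Lemma DnZ n c f : Dn n f -> Dn n (fun x => c * f x).
Proof. by move=> fn; apply: DnM => //; exact: Dn_cst. Qed.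

Lemma DnV n f : (forall x, f x != 0) -> Dn n f -> Dn n (fun x => (f x)^-1).
Proof.
move=> f0; elim: n => [//|n IH] /[dup] /DnW m [g [d gn]].
exists (fun x => - g x * ((f x)^-1 * (f x)^-1)); split; first exact: D1V.
apply: DnM; last by apply: DnM; exact: IH.
rewrite (_ : (fun x => - g x) = (fun x => -1 * g x)); first exact: DnZ.
by apply/funext => x; rewrite mulN1r.
Qed.

Lemma Dn_comp_affine n f a b : Dn n f -> Dn n (fun x => f (a * x + b)).
Proof.
elim: n f => [//|n IH] f [g [d gn]].
exists (fun x => a * g (a * x + b)); split; first exact: D1_comp_affine.
by apply: DnZ; exact: IH.
Qed.

Lemma Dn_derive n f : Dn n.+1 f -> Dn n (derive1 f).
Proof. by move=> [g [/D1E -> ]]. Qed.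

Lemma smoothP f : (forall n, Dn n f) <-> (forall n x, derivable (derive1n n f) x 1).
Proof.
split.
- move=> fs n; elim: n f fs => [|n IH] f fs x.
    by have [g [/D1_derivable + _]] := fs 1; exact.
  by rewrite derive1Sn; apply: IH => n'; apply: Dn_derive.
- move=> H n; elim: n f H => [//|n IH] f H.
  exists (derive1 f); split; first by apply: D1_derive1 => x; exact: (H 0).
  by apply: IH => k x; rewrite -derive1Sn.
Qed.

(** The functions [x^-k exp(-1/x)] (extended by zero) span a space stable under
differentiation, hence they are smooth. *)
Definition flat k x : R := if 0 < x then x ^- k * expR (- x^-1) else 0.

Lemma flat_le k x : 0 < x -> flat k x <= (k.+1)`!%:R * x.
Proof.
move=> x0; rewrite /flat x0 expRN.
have := expR_ge1Dxn k (ltW (eq_ind_r is_true x0 (invr_gt0 x))).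
move=> H; have {}H : x^-1 ^+ k.+1 / (k.+1)`!%:R <= expR x^-1.
  by apply: le_trans H; rewrite lerDr.
have F0 : 0 < (k.+1)`!%:R :> R by rewrite ltr0n fact_gt0.
rewrite ler_pdivrMr ?expR_gt0//; apply: (@le_trans _ _ ((k.+1)`!%:R * x * (x^-1 ^+ k.+1 / (k.+1)`!%:R))).
  rewrite exprS -exprVn le_eqVlt; apply/orP; left; apply/eqP.
  by field; rewrite !gt_eqF.
by rewrite ler_wpM2l// mulr_ge0// ltW.
Qed.

Lemma flat_ge0 k x : 0 <= flat k x.
Proof.
rewrite /flat; case: ifPn => // x0; rewrite mulr_ge0 ?expR_ge0//.
by rewrite invr_ge0 exprn_ge0// ltW.
Qed.

Lemma D1_flat k : D1 (flat k) (fun x => - k%:R * flat k.+1 x + flat k.+2 x).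
Proof.
move=> x; have [x0|x0|->] := ltgtP x 0.
- have -> : - k%:R * flat k.+1 x + flat k.+2 x = 0.
    by rewrite /flat ltNge (ltW x0)/= mulr0 addr0.
  have N : \near x, (fun _ : R => 0) x = flat k x.
    near=> y; rewrite /flat ltNge le_eqVlt (_ : y < 0) ?orbT//.
    by near: y; exact: lt_nbhsl.
  exact: (is_derive_near N (D1_cst 0 x)).
- apply: (@is_derive_near (fun x => x ^- k * expR (- x^-1))).
    near=> y; rewrite /flat (_ : 0 < y)//.
    by near: y; exact: lt_nbhsr.
  have xn0 : x != 0 by rewrite gt_eqF.
  have d1 : is_derive x 1 (fun y : R => y^-1) (- x ^- 2).
    apply: is_derive_eq (@is_deriveV _ id x 1 1 xn0 (is_derive_id _ _)) _.
    by rewrite /GRing.scale /= mulr1.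
  have d2 : is_derive x 1 (fun y : R => expR (- y^-1)) (expR (- x^-1) * x ^- 2).
    apply: (@is_derive1_comp _ expR (fun y => - y^-1)).
    by apply: is_derive_eq (is_deriveN d1) _; rewrite opprK.
  have d3 : is_derive x 1 (fun y : R => y ^- k) (- k%:R * x ^- k.+1).
    have dk := D1X k x.
    have xk0 : x ^+ k != 0 by rewrite expf_neq0.
    apply: is_derive_eq (@is_deriveV _ _ x _ 1 xk0 dk) _.
    rewrite /GRing.scale /=; case: (k) => [|m]; first by rewrite !mul0r mulr0 oppr0 mul0r.
    by rewrite /= !exprS; field; rewrite xn0 expf_neq0.
  apply: is_derive_eq (is_deriveM d3 d2) _.
  rewrite /flat x0 /GRing.scale /= !exprS; field.
  by rewrite xn0 expf_neq0.
- rewrite /flat ltxx !mulr0 addr0; apply: is_derive_cvg.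
  apply/cvgrPdist_le => /= e e0.
  near=> h; rewrite sub0r normrN [_ *: _]mulrC ltxx subr0 addr0 [h *: 1]mulr1.
  have h0 : h != 0 by near: h; exact: nbhs_dnbhs_neq.
  case: ifPn => [hp|_]; last by rewrite mul0r normr0 ltW.
  have -> : h ^- k * expR (- h^-1) / h = flat k.+1 h.
    by rewrite /flat hp exprS; field; rewrite h0 expf_neq0.
  rewrite ger0_norm ?flat_ge0// (le_trans (flat_le _ hp))//.
  rewrite -ler_pdivlMl ?ltr0n ?fact_gt0// ltW// -(gtr0_norm hp).
  near: h; apply: dnbhs0_lt; rewrite mulr_gt0// invr_gt0 ltr0n fact_gt0//.
Unshelve. all: by end_near. Qed.

Lemma Dn_flat n k : Dn n (flat k).
Proof.
elim: n k => [//|n IH] k; eexists; split; first exact: D1_flat.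
by apply: DnD => //; exact: DnZ.
Qed.

Definition smooth_bump a b x := flat 0 (x - a) * flat 0 (b - x).

Lemma Dn_bump n a b : Dn n (smooth_bump a b).
Proof.
apply: DnM.
- rewrite (_ : (fun x => _) = (fun x => flat 0 (1 * x + - a))).
    by apply: Dn_comp_affine; exact: Dn_flat.
  by apply/funext => x; rewrite mul1r.
- rewrite (_ : (fun x => _) = (fun x => flat 0 (-1 * x + b))).
    by apply: Dn_comp_affine; exact: Dn_flat.
  by apply/funext => x; rewrite mulN1r addrC.
Qed.

Lemma bump_ge0 a b x : 0 <= smooth_bump a b x.
Proof. by rewrite mulr_ge0// flat_ge0. Qed.

Lemma bump_gt0 a b x : a < x < b -> 0 < smooth_bump a b x.
Proof.
move=> /andP[ax xb]; rewrite /smooth_bump /flat !subr_gt0 ax xb.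
by rewrite !mulr_gt0// ?expR_gt0// expr0 invr1.
Qed.

Lemma bump_out a b x : ~~ (a < x < b) -> smooth_bump a b x = 0.
Proof.
rewrite negb_and -!leNgt /smooth_bump /flat !subr_gt0 => /orP[H|H].
  by rewrite ltNge H /= mul0r.
by rewrite mulrC ltNge H /= mul0r.
Qed.

Lemma testfunP phi : testfun phi <-> (forall n, Dn n phi) /\
  (exists a b, [/\ 0 < a, b < 1 & forall x, ~ (a <= x <= b) -> phi x = 0]).
Proof. by rewrite /testfun smoothP. Qed.

Lemma testfun_bump a b : 0 < a -> b < 1 -> testfun (smooth_bump a b).
Proof.
move=> a0 b1; apply/testfunP; split => [n|]; first exact: Dn_bump.
exists a, b; split => // x H; apply: bump_out; apply/negP => /andP[? ?].
by apply: H; rewrite !ltW.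
Qed.

(** Smooth approximation from below of the indicator of []a, b[]. *)
Definition plateau a b n x := smooth_bump a b x / (smooth_bump a b x + n.+1%:R^-1).

Let den_gt0 a b n x : 0 < smooth_bump a b x + n.+1%:R^-1.
Proof. by rewrite ltr_wpDl ?bump_ge0// invr_gt0. Qed.

Lemma testfun_plateau a b n : 0 < a -> b < 1 -> testfun (plateau a b n).
Proof.
move=> a0 b1; apply/testfunP; split => [m|].
  apply: DnM; first exact: Dn_bump.
  apply: DnV => [x|]; first by rewrite gt_eqF ?den_gt0.
  by apply: DnD; [exact: Dn_bump|exact: Dn_cst].
exists a, b; split => // x H; rewrite /plateau bump_out ?mul0r//.
by apply/negP => /andP[? ?]; apply: H; rewrite !ltW.
Qed.

Lemma plateau_bnd a b n x : 0 <= plateau a b n x <= 1.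
Proof.
rewrite /plateau divr_ge0 ?bump_ge0 ?(ltW (den_gt0 _ _ _ _))//=.
by rewrite ler_pdivrMr// mul1r lerDl invr_ge0.
Qed.

Lemma plateau_cvg a b x :
  plateau a b n x @[n --> \oo] --> (if a < x < b then 1 else 0 : R).
Proof.
case: ifPn => H; last first.
  rewrite /plateau bump_out// (_ : (fun n => _) = cst 0); first exact: cvg_cst.
  by apply/funext => n; rewrite mul0r.
have p0 := bump_gt0 H.
rewrite -[X in _ --> X](@divff _ (smooth_bump a b x)) ?gt_eqF//.
rewrite /plateau; apply: cvgM; first exact: cvg_cst.
apply: cvgV; first by rewrite gt_eqF.
rewrite -[X in _ --> X]addr0; apply: cvgD; first exact: cvg_cst.
exact: cvg_harmonic.
Qed.

Lemma testfunD phi psi : testfun phi -> testfun psi ->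
  testfun (fun x => phi x + psi x).
Proof.
move=> /testfunP[s1 [a1 [b1 [a10 b11 H1]]]] /testfunP[s2 [a2 [b2 [a20 b21 H2]]]].
apply/testfunP; split => [n|]; first exact: DnD.
exists (Num.min a1 a2), (Num.max b1 b2); split.
- by rewrite lt_min a10.
- by rewrite gt_max b11.
- move=> x H; rewrite H1 ?H2 ?addr0// => /andP[ax xb]; apply: H;
    by rewrite ge_min le_max ax xb ?orbT.
Qed.

Lemma testfunM f phi : (forall n, Dn n f) -> testfun phi ->
  testfun (fun x => f x * phi x).
Proof.
move=> fs /testfunP[s1 [a1 [b1 [a10 b11 H1]]]]; apply/testfunP.
split => [n|]; first exact: DnM.
by exists a1, b1; split => // x H; rewrite H1 ?mulr0.
Qed.

Lemma testfunZ c phi : testfun phi -> testfun (fun x => c * phi x).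
Proof. by apply: testfunM => n; exact: Dn_cst. Qed.

Lemma testfun_D1 phi : testfun phi -> D1 phi (derive1 phi).
Proof. by move=> [s _]; apply: D1_derive1 => x; exact: (s 0). Qed.

Lemma testfun_derive phi : testfun phi -> testfun (derive1 phi).
Proof.
move=> tp; have := tp; move=> /testfunP[s [a [b [a0 b1 H]]]].
apply/testfunP; split => [n|]; first exact: Dn_derive.
exists a, b; split => // x Hx; rewrite derive1E.
suff -> : 'D_1 phi x = 'D_1 (cst 0) x by rewrite derive_cst.
apply: near_eq_derive.
move/negP : Hx; rewrite negb_and -!ltNge => /orP[xa|bx].
- near=> y; rewrite /= H// => /andP[ay _].
  suff : y < a by rewrite ltNge ay.
  by near: y; exact: lt_nbhsl.
- near=> y; rewrite /= H// => /andP[_ yb].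
  suff : b < y by rewrite ltNge yb.
  by near: y; exact: lt_nbhsr.
Unshelve. all: by end_near. Qed.

Lemma testfun_le0 phi x : testfun phi -> x <= 0 -> phi x = 0.
Proof.
by move=> [_ [a [b [a0 b1 H]]]] x0; apply: H => /andP[ax _]; have := lt_le_trans a0 ax; rewrite ltNge x0.
Qed.

Lemma testfun_ge1 phi x : testfun phi -> 1 <= x -> phi x = 0.
Proof.
by move=> [_ [a [b [a0 b1 H]]]] x0; apply: H => /andP[_ xb]; have := le_lt_trans xb b1; rewrite ltNge x0.
Qed.

Lemma continuous_itg f a b : continuous f -> itg `[a, b] f.
Proof.
move=> cf; apply: continuous_compact_integrable; first exact: segment_compact.
exact: continuous_subspaceT.
Qed.

Lemma D1_ac f g : D1 f g -> continuous g -> ac f g.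
Proof.
move=> fg cg.
have ig y : itg `]0, y[ g.
  by apply: itgS (@continuous_itg g 0 y cg) => //; apply: subset_itv; rewrite bnd_simp.
split; first exact: ig.
move=> x /andP[]; rewrite le_eqVlt => /predU1P[<- _|x0 x1].
  by rewrite prim0 addr0.
have : \int[mu]_(y in `[0, x]) g y = f x - f 0.
  rewrite /Rintegral (@continuous_FTC2 _ _ f)//.
  - exact: continuous_subspaceT.
  - split.
    + by move=> y _; exact: D1_derivable fg.
    + by apply: cvg_at_right_filter; exact: D1_continuous fg _.
    + by apply: cvg_at_left_filter; exact: D1_continuous fg _.
  - by move=> y _; rewrite (D1E fg).
rewrite -Rintegral_itv_bndo_bndc; last first.
  by apply: itgS (@continuous_itg g 0 x cg) => //; apply: subset_itv; rewrite bnd_simp.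
rewrite -Rintegral_itv_obnd_cbnd; last exact: ig.
by rewrite !prim_int => ->; rewrite addrCA subrr addr0.
Qed.

Lemma testfun_continuous phi : testfun phi -> continuous phi.
Proof. by move/testfun_D1/D1_continuous. Qed.

Lemma testfun_ac phi : testfun phi -> ac phi (derive1 phi).
Proof.
by move=> tp; apply: D1_ac; [exact: testfun_D1|apply/testfun_continuous/testfun_derive].
Qed.

Lemma testfun_L2 phi : testfun phi -> L2 phi.
Proof. by move/testfun_ac/ac_L2. Qed.

Lemma testfun_bnd phi : testfun phi -> exists2 C : R, 0 <= C & forall x, `|phi x| <= C.
Proof.
move=> tp; have ap := testfun_ac tp.
exists (`|phi 0| + \int[mu]_(z in I) `|(derive1 phi) z|).
  by rewrite addr_ge0// Rintegral_ge0.
move=> x; have [x0|x0] := leP x 0.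
  by rewrite (testfun_le0 tp x0) normr0 addr_ge0// Rintegral_ge0.
have [x1|x1] := leP 1 x.
  by rewrite (testfun_ge1 tp x1) normr0 addr_ge0// Rintegral_ge0.
by apply: (ac_bnd ap); rewrite /= in_itv/= x0.
Qed.

Lemma testfun_meas phi D : mR D -> testfun phi -> measurable_fun D phi.
Proof.
move=> mD tp; apply: measurable_funTS; apply: continuous_measurable_fun.
exact: testfun_continuous.
Qed.

(** Dominated convergence for real-valued integrands on the unit interval. *)
Lemma dct (u_ : nat -> R -> R) u g : (forall n, measurable_fun I (u_ n)) ->
  measurable_fun I u -> (forall x, I x -> u_ n x @[n --> \oo] --> u x) ->
  itg I g -> (forall n x, I x -> `|u_ n x| <= g x) ->
  \int[mu]_(x in I) u_ n x @[n --> \oo] --> \int[mu]_(x in I) u x.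
Proof.
move=> mu_ mu0 cu ig ug.
have [||||iu _ cvg] := @dominated_convergence _ _ _ mu I measI
  (fun n => EFin \o u_ n) (EFin \o u) (EFin \o g) _ _ _ ig.
- by move=> n; apply/measurable_EFinP; exact: mu_.
- by apply/measurable_EFinP; exact: mu0.
- by apply: aeW => x Ix; apply: cvg_EFin; [exact: nearW|exact: cu].
- by apply: aeW => x n Ix; rewrite lee_fin ug.
apply: fine_cvg; rewrite -/(itg _ _) in iu; rewrite -intE//.
Qed.

Lemma prim_deriv_ae g : itg I g ->
  \forall x \ae mu, I x -> is_derive x 1 (prim g) (g x).
Proof.
move=> ig; have := lebesgue_differentiation (integrable_locally measI ig).
apply: filterS => x lx; rewrite /= in_itv/= => /andP[x0 x1].
have ig' : itg setT (g \_ I).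
  by move/integrable_mkcond : ig; rewrite restrict_EFin; exact.
have [] := @FTC1_lebesgue_pt R (g \_ I) (BRight 0) x 1 x1 _ _ lx.
- exact: integrableS ig'.
- exact: x0.
move=> dF FE.
apply: (@is_derive_near (fun y => \int[mu]_(t in [set` Interval (BRight 0) (BRight y)]) (g \_ I) t)).
  near=> y.
  have y1 : y < 1 by near: y; exact: lt_nbhsl.
  rewrite -Rintegral_itv_bndo_bndc; last exact: integrableS ig'.
  rewrite !prim_int; apply: eq_Rintegral => z; rewrite inE/= in_itv/= => /andP[z0 zy].
  by rewrite patchE mem_set//= in_itv/= z0 (lt_trans zy).
have := derivableP dF; rewrite -derive1E FE patchE mem_set//= in_itv/= x0//.
Unshelve. all: by end_near. Qed.

(** The fundamental lemma of the calculus of variations: the indicators of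
intervals are bounded pointwise limits of test functions, so the indefinite
integral of [u] is constant, and it is differentiable a.e. with derivative
[u]. *)
Lemma fundamental_lemma u : itg I u ->
  (forall phi, testfun phi -> \int[mu]_(x in I) (u x * phi x) = 0) ->
  \forall x \ae mu, I x -> u x = 0.
Proof.
move=> iu H.
have prim_cst a b : 0 < a -> a < b -> b < 1 -> prim u a = prim u b.
  move=> a0 ab b1; apply/eqP; rewrite eq_sym -subr_eq0 primB ?(ltW a0)//; [|exact: ltW..].
  have c1 : \int[mu]_(x in I) (u x * plateau a b n x) @[n --> \oo] -->
      \int[mu]_(x in I) (u x * (if a < x < b then 1 else 0)).
    apply: (@dct _ _ (fun x => `|u x|)).
    - move=> n; apply: measurable_funM; first exact: itg_meas.
      by apply: testfun_meas => //; exact: testfun_plateau.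
    - apply: measurable_funM; first exact: itg_meas.
      rewrite (_ : (fun x => _) = \1_(`]a, b[%classic)); first exact: measurable_indic.
      apply/funext => x; rewrite indicE; case: ifPn => xab.
        by rewrite mem_set//= in_itv.
      by rewrite memNset//= in_itv/=; exact/negP.
    - by move=> x _; apply: cvgM; [exact: cvg_cst|exact: plateau_cvg].
    - exact: itg_abs.
    - move=> n x _; rewrite normrM ler_piMr//.
      by have /andP[? ?] := plateau_bnd a b n x; rewrite ger0_norm.
  have E : \int[mu]_(x in I) (u x * (if a < x < b then 1 else 0)) = 0.
    rewrite -(cvg_lim (@Rhausdorff R) c1) (_ : (fun n => _) = cst 0) ?lim_cst//.
    by apply/funext => n; apply: H; exact: testfun_plateau.
  rewrite -[X in _ == X]E; apply/eqP; apply: eq_Rintegral_ae; exists [set a]; split.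
  - exact: measurable_set1.
  - exact: lebesgue_measure_set1.
  - move=> x /= /not_implyP[_]; case: (ltgtP a x) => //= _.
      by case: ifP => _; rewrite ?mulr1 ?mulr0.
    by rewrite mulr0.
have := prim_deriv_ae iu; apply: filterS => x H1 Ix; move: (H1 Ix) => [_ <-].
move: Ix; rewrite /= in_itv/= => /andP[x0 x1].
suff -> : 'D_1 (prim u) x = 'D_1 (cst (prim u x)) x by rewrite derive_cst.
apply: near_eq_derive.
near=> y; have y0 : 0 < y by near: y; exact: lt_nbhsr.
have y1 : y < 1 by near: y; exact: lt_nbhsl.
by have [yx|xy|->//] := ltgtP y x; [exact: prim_cst|apply/esym; exact: prim_cst].
Unshelve. all: by end_near. Qed.

Lemma testfun_int0 phi : testfun phi -> \int[mu]_(x in I) phi x = 0 ->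
  exists2 psi, testfun psi & (derive1 psi) = phi.
Proof.
move=> tp p0; have [_ [a [b [a0 b1 H]]]] := tp.
have cp := testfun_continuous tp.
have iT : itg setT phi.
  apply: (eq_itg (u := phi \_ I)) => //.
  - move=> x _; rewrite patchE; case: ifPn => // /negP; rewrite inE/= in_itv/= => /negP.
    rewrite negb_and -!leNgt => /orP[]; [move/(testfun_le0 tp)|move/(testfun_ge1 tp)] => -> //.
  - by have /integrable_mkcond := L2_itg (testfun_L2 tp); rewrite restrict_EFin; exact.
pose psi x := \int[mu]_(t in [set` Interval -oo%O (BRight x)]) phi t.
have dpsi : D1 psi phi.
  move=> x; have [|||d e] := @continuous_FTC1 R phi -oo%O x (x + 1) _ _ _ (cp x).
  - by rewrite ltrDl.
  - exact: integrableS iT.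
  - by rewrite ltNyr.
  - by have := derivableP d; rewrite -derive1E e.
exists psi; last exact: D1E.
apply/testfunP; split.
  move=> [//|n]; exists phi; split => //.
  by have /testfunP[+ _] := tp; exact.
exists a, b; split => // x /negP; rewrite negb_and -!ltNge => /orP[xa|bx].
- rewrite /psi -[RHS](@Rintegral_set0 _ _ _ mu phi) Rintegral_mkcond [RHS]Rintegral_mkcond.
  apply: eq_Rintegral => y _; rewrite !patchE [in RHS]memNset//.
  case: ifPn => // /[!inE]/=; rewrite in_itv/= => yx; apply: H => /andP[ay _].
  by have := le_lt_trans (le_trans ay yx) xa; rewrite ltxx.
- rewrite /psi -p0 Rintegral_mkcond [RHS]Rintegral_mkcond.
  apply: eq_Rintegral => y _; rewrite !patchE.
  have [yab|yab] := boolP (a <= y <= b); last first.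
    by rewrite H; [case: ifP; case: ifP|exact/negP].
  move: yab => /andP[ay yb].
  rewrite !mem_set//= in_itv/=; first by rewrite (lt_le_trans a0)//= (le_lt_trans yb).
  by rewrite (le_trans yb)// ltW.
Qed.

Lemma testfun_mean1 : exists2 chi : R -> R, testfun chi & \int[mu]_(x in I) chi x = 1.
Proof.
pose chi0 := smooth_bump (1/4) (3/4) : R -> R.
have tchi0 : testfun chi0 by apply: testfun_bump; lra.
have m0 : 0 < \int[mu]_(x in I) chi0 x.
  rewrite lt_def Rintegral_ge0 ?andbT; last by move=> x _; exact: bump_ge0.
  apply/negP => /eqP E.
  have := int_ae0 measI (L2_itg (testfun_L2 tchi0)) (fun x _ => bump_ge0 _ _ x) E.
  move=> [N [mN N0 HN]].
  suff : (0 < mu N)%E by rewrite N0 ltxx.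
  apply: (@lt_le_trans _ _ (mu `]1/4, 3/4[%classic)).
    have q : (1/4 : R) < 3/4 by lra.
    by rewrite lebesgue_measure_itv/= lte_fin q -EFinD lte_fin; lra.
  apply: le_measure; [by rewrite inE; exact: mR_itv|by rewrite inE|].
  move=> x /=; rewrite in_itv/= => xI; apply: HN => /= H0.
  have : chi0 x = 0 by apply: H0; rewrite in_itv/=; move: xI; lra.
  by apply/eqP; rewrite gt_eqF// bump_gt0.
exists (fun x => (\int[mu]_(x in I) chi0 x)^-1 * chi0 x); first exact: testfunZ.
by rewrite (intZ _ measI (L2_itg (testfun_L2 tchi0))) mulVf// gt_eqF.
Qed.

(** du Bois-Reymond: test functions of mean zero are derivatives of test
functions, so that [u - prim g] is orthogonal to all of them. *)
Lemma du_bois_reymond u g : itg I u -> itg I g ->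
  (forall phi, testfun phi ->
    \int[mu]_(x in I) (u x * (derive1 phi) x) = - \int[mu]_(x in I) (g x * phi x)) ->
  exists c, \forall x \ae mu, I x -> u x = c + prim g x.
Proof.
move=> iu ig H.
pose w x := u x - prim g x.
have iw : itg I w by apply: itgB => //; apply: L2_itg; exact: L2_prim.
have itM f phi : itg I f -> testfun phi -> itg I (fun x => f x * phi x).
  move=> jf tp; have [C _ pC] := testfun_bnd tp.
  apply: eq_itg (itgM_bnd (C := C) _ jf (testfun_meas _ tp) _) => //.
  by move=> x _; rewrite mulrC.
have w0 phi : testfun phi -> \int[mu]_(x in I) (w x * (derive1 phi) x) = 0.
  move=> tp; have tp' := testfun_derive tp.
  have := ac_int (acM (ac_prim ig) (testfun_ac tp)).
  rewrite (testfun_le0 tp (lexx 0)) (testfun_ge1 tp (lexx 1)) !mulr0 subr0.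
  have j1 := itM _ _ ig tp.
  have j2 : itg I (fun x => prim g x * derive1 phi x).
    by apply: itM => //; apply: L2_itg; exact: L2_prim.
  rewrite (intD measI j1 j2) => E.
  have -> : \int[mu]_(x in I) (w x * derive1 phi x) =
      \int[mu]_(x in I) (u x * derive1 phi x) - \int[mu]_(x in I) (prim g x * derive1 phi x).
    rewrite -(intB measI (itM _ _ iu tp') j2).
    by apply: eq_Rintegral => x _; rewrite mulrBl.
  by rewrite H// -opprD E oppr0.
have [chi tchi chi1] := testfun_mean1.
pose c := \int[mu]_(x in I) (w x * chi x).
exists c.
have : \forall x \ae mu, I x -> w x - c = 0.
  apply: fundamental_lemma; first by apply: itgB => //; exact: itg_cstI.
  move=> eta te; pose k := \int[mu]_(x in I) eta x.
  have te' : testfun (fun x => eta x + - k * chi x) by apply: testfunD => //; exact: testfunZ.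
  have ie := L2_itg (testfun_L2 te); have ic := L2_itg (testfun_L2 tchi).
  have [|psi tpsi psiE] := testfun_int0 te'.
    rewrite (intD measI ie (itgZ (- k) measI ic)) (RintegralZl (- k) measI ic).
    by rewrite chi1 mulr1 -/k subrr.
  have := w0 _ tpsi; rewrite psiE.
  have j1 := itM _ _ iw te; have j2 := itM _ _ iw tchi.
  have -> : \int[mu]_(x in I) (w x * (eta x + - k * chi x)) =
      \int[mu]_(x in I) (w x * eta x) - k * c.
    rewrite -(RintegralZl k measI j2) -(intB measI j1 (itgZ k measI j2)).
    by apply: eq_Rintegral => x _; ring.
  move=> w00; rewrite -[RHS]w00 (mulrC k) -(intZ c measI ie) -(intB measI j1 (itgZ c measI ie)).
  by apply: eq_Rintegral => x _; ring.
apply: filterS => x H1 /H1 /eqP; rewrite subr_eq0 => /eqP <-.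
by rewrite /w subrK.
Qed.

End Smooth.

(** * Weak derivatives *)

Section WeakDerivative.
Context {R : realType}.
Implicit Types (f g u v w phi : R -> R) (a b c x y z t : R).
Local Notation mu := (@lebesgue_measure R).
Local Notation I := (`]0, 1[%classic : set R).
Local Notation mR := (@measurable _ (measurableTypeR R)).
Hint Resolve mR_itv : core.

Lemma wderiv_uniq u g g' : is_wderiv u g -> is_wderiv u g' ->
  \forall x \ae mu, I x -> g x = g' x.
Proof.
move=> [g2 gE] [g2' gE'].
have : \forall x \ae mu, I x -> g x - g' x = 0.
  apply: fundamental_lemma; first by apply: L2_itg; exact: L2B.
  move=> phi tp; have p2 := testfun_L2 tp.
  rewrite -(dotE (fun x => g x - g' x) phi) dotBl//; apply/eqP.
  by rewrite subr_eq0 -eqr_opp; apply/eqP; rewrite !dotE -gE// -gE'.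
by apply: filterS => x H /H /eqP; rewrite subr_eq0 => /eqP.
Qed.

Lemma wderivP u : H1 u -> is_wderiv u (wderiv u).
Proof. by move=> [_ [g ug]]; rewrite /wderiv; exact: (xgetPex (fun=> 0) (ex_intro (is_wderiv u) g ug)). Qed.

Lemma L2_wderiv u : H1 u -> L2 (wderiv u).
Proof. by move/wderivP => []. Qed.

Lemma H1_L2 u : H1 u -> L2 u. Proof. by case. Qed.

Lemma wderiv_ae u g : is_wderiv u g -> \forall x \ae mu, I x -> wderiv u x = g x.
Proof.
by move=> ug; apply: (wderiv_uniq _ ug); rewrite /wderiv; exact: (xgetPex (fun=> 0) (ex_intro (is_wderiv u) g ug)).
Qed.

Lemma is_wderiv_aeq u u' g : (\forall x \ae mu, I x -> u x = u' x) ->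
  is_wderiv u g -> is_wderiv u' g.
Proof.
move=> uu [g2 gE]; split => // phi tp; rewrite -gE//; apply: eq_Rintegral_ae.
by move: uu; apply: filterS => x /[apply] ->.
Qed.

Lemma is_wderiv_lin u w g k c : L2 u -> L2 w -> is_wderiv u g -> is_wderiv w k ->
  is_wderiv (fun x => c * u x + w x) (fun x => c * g x + k x).
Proof.
move=> u2 w2 [g2 gE] [k2 kE]; split; first by apply: L2D => //; exact: L2Z.
move=> phi tp; have p2 := testfun_L2 tp; have p2' := testfun_L2 (testfun_derive tp).
rewrite -(dotE (fun x => c * u x + w x)) -(dotE (fun x => c * g x + k x)).
rewrite !dotDl ?dotZl//; [|exact: L2Z..].
by rewrite !dotE gE// kE// opprD mulrN.
Qed.

Lemma ac_is_wderiv u g : L2 g -> ac u g -> is_wderiv u g.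
Proof.
move=> g2 ug; split => // phi tp.
have p2 := testfun_L2 tp; have p2' := testfun_L2 (testfun_derive tp).
have := ac_int (acM ug (testfun_ac tp)).
rewrite (testfun_le0 tp (lexx 0)) (testfun_ge1 tp (lexx 1)) !mulr0 subr0.
rewrite (intD measI (itgM g2 p2) (itgM (ac_L2 ug) p2')) => /eqP.
by rewrite addrC addr_eq0 => /eqP.
Qed.

Lemma is_wderiv_ac u g : L2 u -> is_wderiv u g ->
  exists c, \forall x \ae mu, I x -> u x = c + prim g x.
Proof. by move=> u2 [g2 gE]; apply: du_bois_reymond => //; exact: L2_itg. Qed.

Lemma testfun_wderiv phi : testfun phi -> is_wderiv phi (derive1 phi).
Proof.
move=> tp; apply: ac_is_wderiv; last exact: testfun_ac.
exact: testfun_L2 (testfun_derive tp).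
Qed.

Lemma H1_lin u w c : H1 u -> H1 w -> H1 (fun x => c * u x + w x).
Proof.
move=> hu hw; split; first by apply: L2D; [apply: L2Z|]; exact: H1_L2.
by eexists; apply: is_wderiv_lin; [exact: H1_L2|exact: H1_L2|exact: wderivP..].
Qed.

Lemma wderiv_lin u w c : H1 u -> H1 w -> \forall x \ae mu, I x ->
  wderiv (fun x => c * u x + w x) x = c * wderiv u x + wderiv w x.
Proof.
by move=> hu hw; apply: wderiv_ae; apply: is_wderiv_lin; [exact: H1_L2|exact: H1_L2|exact: wderivP..].
Qed.

Lemma testfun_H1 phi : testfun phi -> H1 phi.
Proof.
move=> tp; split; first exact: testfun_L2.
by exists (derive1 phi); exact: testfun_wderiv.
Qed.

Lemma H1_aeq u u' : measurable_fun I u' -> (\forall x \ae mu, I x -> u x = u' x) ->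
  H1 u -> H1 u'.
Proof.
move=> mu' uu [u2 [g ug]]; split; first exact: L2_ae uu.
by exists g; exact: is_wderiv_aeq uu ug.
Qed.

Lemma wderiv_aeq u u' : (\forall x \ae mu, I x -> u x = u' x) -> H1 u ->
  \forall x \ae mu, I x -> wderiv u' x = wderiv u x.
Proof. by move=> uu hu; apply: wderiv_ae; apply: is_wderiv_aeq uu _; exact: wderivP. Qed.

Lemma sqH1E u : H1 u -> sqH1 u = (nrm u ^+ 2 + nrm (wderiv u) ^+ 2)%:E.
Proof. by move=> hu; rewrite /sqH1 !sqL2E//; [exact: L2_wderiv|exact: H1_L2]. Qed.

Lemma nrm_cst c : nrm (fun=> c) = `|c|.
Proof. by rewrite nrmE dotE int_cstI -expr2 sqrtr_sqr. Qed.

Lemma nrm_cst0 : nrm (fun _ : R => 0 : R) = 0.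
Proof. by rewrite nrm_cst normr0. Qed.

Lemma H1_cst0 : H1 (fun _ : R => 0 : R).
Proof.
split; first exact: L2_cst.
by exists (fun=> 0); apply: ac_is_wderiv; [exact: L2_cst|exact: ac_cst].
Qed.

Lemma wderiv_cst0 : \forall x \ae mu, I x -> wderiv (fun _ : R => 0 : R) x = 0.
Proof. by apply: wderiv_ae; apply: ac_is_wderiv; [exact: L2_cst|exact: ac_cst]. Qed.

Lemma testfun_H10 phi : testfun phi -> H10 phi.
Proof.
move=> tp; split; first exact: testfun_H1.
exists (fun=> phi); split => //.
rewrite (_ : (fun n => _) = cst 0%E); first exact: cvg_cst.
apply/funext => n; rewrite (_ : (fun x => _) = (fun=> 0)); last first.
  by apply/funext => x; rewrite subrr.
rewrite sqH1E; last exact: H1_cst0.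
by rewrite (nrm_ae wderiv_cst0) nrm_cst0 expr0n addr0.
Qed.

Lemma H10_cst0 : H10 (fun _ : R => 0 : R).
Proof.
apply: testfun_H10; apply/testfunP; split => [n|]; first exact: Dn_cst.
by exists (1/4), (3/4); split => //; lra.
Qed.

(** * Mean-zero primitives *)

(** The antiderivative of [g] with mean zero: if [g] is the second derivative of
a function of $H^2 \cap H^1_0$, then [mz g] is its first derivative. *)
Definition mz g x := prim g x - \int[mu]_(y in I) prim g y.

Lemma ac_mz g : itg I g -> ac (mz g) g.
Proof.
move=> ig; split => // x _; rewrite /mz prim0; ring.
Qed.

Lemma int_mz g : itg I g -> \int[mu]_(x in I) mz g x = 0.
Proof.
move=> ig; rewrite /mz (intB measI (L2_itg (L2_prim ig)) (itg_cstI _)).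
by rewrite int_cstI subrr.
Qed.

Lemma mz_ae g g' x : x <= 1 -> (\forall y \ae mu, I y -> g y = g' y) -> mz g x = mz g' x.
Proof.
move=> x1 gg; rewrite /mz (eq_prim_ae x1 gg); congr (_ - _).
apply: eq_Rintegral => y /[!inE]/=; rewrite in_itv/= => /andP[_ /ltW y1].
exact: eq_prim_ae.
Qed.

Lemma mz_bnd g x : L2 g -> 0 <= x <= 1 -> `|mz g x| <= nrm g.
Proof.
move=> g2 x01; have ig := L2_itg g2; apply: le_trans _ (int_abs_le g2).
have -> : mz g x = \int[mu]_(y in I) (prim g x - prim g y).
  by rewrite (intB measI (itg_cstI _) (L2_itg (L2_prim ig))) int_cstI.
rewrite -[leRHS](int_cstI (R := R)); apply: ler_norm_int => //.
- by apply: measurable_funB => //; apply: meas_prim; exact: itg_meas.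
- exact: itg_cstI.
- by move=> y /=; rewrite in_itv/= => /andP[/ltW ? /ltW ?]; apply: ler_primB => //; apply/andP.
Qed.

Lemma mz_uniq u g : L2 u -> is_wderiv u g -> \int[mu]_(x in I) u x = 0 ->
  \forall x \ae mu, I x -> u x = mz g x.
Proof.
move=> u2 ug u0; have ig : itg I g by apply: L2_itg; case: ug.
have [c H] := is_wderiv_ac u2 ug.
suff cE : c = - \int[mu]_(y in I) prim g y.
  rewrite cE in H; by move: H; apply: filterS => x H /H ->; rewrite /mz addrC.
have : \int[mu]_(x in I) (c + prim g x) = 0 by rewrite -(eq_Rintegral_ae H).
rewrite (intD measI (itg_cstI _) (L2_itg (L2_prim ig))) int_cstI => /eqP.
by rewrite addr_eq0 => /eqP.
Qed.

Lemma prim_mz0 g : itg I g -> prim (mz g) 1 = 0.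
Proof. by move=> ig; rewrite prim1 int_mz. Qed.

Lemma prim_bnd_nrm g x : L2 g -> 0 <= x <= 1 -> `|prim g x| <= nrm g.
Proof. by move=> g2 x01; apply: le_trans (ler_prim (L2_itg g2) x01) (int_abs_le g2). Qed.

(** Elements of [H10] vanish at both end points, in the only sense available
for a class of functions. *)
Lemma H10_prim v : H10 v -> \int[mu]_(x in I) wderiv v x = 0 /\
  \forall x \ae mu, I x -> v x = prim (wderiv v) x.
Proof.
move=> [hv [p [tp cp]]]; have v2 := H1_L2 hv; have w2 := L2_wderiv hv.
have [c cE] := is_wderiv_ac v2 (wderivP hv).
have small e : 0 < e -> exists phi, [/\ testfun phi,
    nrm (fun x => v x - phi x) <= e & nrm (fun x => wderiv v x - derive1 phi x) <= e].
  move=> e0; have e20 : 0 < e ^+ 2 by rewrite exprn_gt0.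
  move/fine_cvgP : cp => [_ /cvgrPdist_lt /(_ _ e20) [n _ /(_ n (leqnn n)) /= Hn]].
  exists (p n).
  have hB : H1 (fun x => v x - p n x).
    rewrite (_ : (fun x => _) = (fun x => -1 * p n x + v x)); last first.
      by apply/funext => x; rewrite mulN1r addrC.
    by apply: H1_lin => //; exact: testfun_H1.
  have wB : \forall x \ae mu, I x -> wderiv (fun x => v x - p n x) x = wderiv v x - derive1 (p n) x.
    apply: wderiv_ae; rewrite (_ : (fun x => v x - _) = (fun x => -1 * p n x + v x)); last first.
      by apply/funext => x; rewrite mulN1r addrC.
    rewrite (_ : (fun x => wderiv v x - _) = (fun x => -1 * derive1 (p n) x + wderiv v x)); last first.
      by apply/funext => x; rewrite mulN1r addrC.
    apply: is_wderiv_lin => //; [exact: testfun_L2|exact: testfun_wderiv|exact: wderivP].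
  move: Hn; rewrite sqH1E// (nrm_ae wB) /= sub0r normrN ger0_norm ?addr_ge0 ?sqr_ge0// => Hn.
  split => //; rewrite -(@ler_pXn2r _ 2)// ?nnegrE ?nrm_ge0 ?(ltW e0)//;
    apply: le_trans (ltW Hn); rewrite ?lerDl ?lerDr sqr_ge0//.
have eq0 (r : R) : (forall e, 0 < e -> `|r| <= 2 * e) -> r = 0.
  move=> H; apply/eqP; rewrite -normr_le0; apply/ler_addgt0Pr => e e0.
  by rewrite add0r; have := H (e / 2); rewrite divr_gt0// => /(_ isT); lra.
split.
- apply: eq0 => e e0; have [phi [tphi H1e H2e]] := small e e0.
  have d2 := testfun_L2 (testfun_derive tphi).
  have -> : \int[mu]_(x in I) wderiv v x = dot (fun x => wderiv v x - derive1 phi x) (fun=> 1).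
    rewrite dotBl//; last exact: L2_cst.
    have -> : dot (derive1 phi) (fun=> 1) = 0.
      rewrite dotE; under eq_Rintegral do rewrite mulr1.
      by rewrite (ac_int (testfun_ac tphi)) (testfun_le0 tphi (lexx 0)) (testfun_ge1 tphi (lexx 1)) subrr.
    by rewrite subr0 dotE; apply: eq_Rintegral => x _; rewrite mulr1.
  apply: le_trans (CS (L2B w2 d2) (L2_cst 1)) _.
  rewrite nrm_cst normr1 mulr1; lra.
- suff c0 : c = 0 by move: cE; apply: filterS => x H /H ->; rewrite c0 add0r.
  apply: eq0 => e e0; have [phi [tphi H1e H2e]] := small e e0.
  have d2 := testfun_L2 (testfun_derive tphi).
  have p2 := testfun_L2 tphi.
  have : nrm (fun=> c) <= nrm (fun x => v x - phi x) + nrm (prim (fun x => wderiv v x - derive1 phi x)).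
    rewrite -[X in _ <= X](_ : nrm (fun x => v x - phi x) + nrm (fun x => - prim (fun x => wderiv v x - derive1 phi x) x) = _); last by rewrite nrmN.
    apply: le_trans _ (nrmD (L2B v2 p2) (L2N (L2_prim (L2_itg (L2B w2 d2))))).
    rewrite le_eqVlt; apply/orP; left; apply/eqP; apply: nrm_ae.
    move: cE; apply: filterS => x H Ix; rewrite (H Ix).
    move: Ix; rewrite /= in_itv/= => /andP[/ltW x0 /ltW x1].
    have -> : prim (fun x => wderiv v x - derive1 phi x) x = prim (wderiv v) x - prim (derive1 phi) x.
      by rewrite !prim_int (intB (mR_itv _) (itg_sub x1 (L2_itg w2)) (itg_sub x1 (L2_itg d2))).
    have [_ ->] := testfun_ac tphi; last by rewrite x0.
    by rewrite (testfun_le0 tphi (lexx 0)); ring.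
  rewrite nrm_cst.
  move=> H; apply: (le_trans H); rewrite mulrDl mul1r; apply: lerD => //.
  apply: le_trans H2e; apply: nrm_bnd; first exact: nrm_ge0.
    by apply: meas_prim; apply: L2_meas; exact: L2B.
  move=> x /=; rewrite in_itv/= => /andP[/ltW x0 /ltW x1].
  by apply: prim_bnd_nrm; [exact: L2B|rewrite x0].
Qed.

Lemma H2_H10_prim v (g := wderiv (wderiv v)) : H2 v -> H10 v ->
  [/\ L2 g, \forall x \ae mu, I x -> v x = prim (mz g) x &
      \forall x \ae mu, I x -> wderiv v x = mz g x].
Proof.
move=> [hv hw] h10; have [m0 vE] := H10_prim h10.
have g2 : L2 g by exact: L2_wderiv.
have E := mz_uniq (H1_L2 hw) (wderivP hw) m0.
split => //; move: vE; apply: filterS => x H Ix; rewrite (H Ix).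
move: Ix; rewrite /= in_itv/= => /andP[_ /ltW x1].
exact: eq_prim_ae.
Qed.

End WeakDerivative.

(** * The energy density of the transport equation at a fixed time *)

Section Spatial.
Context {R : realType}.
Implicit Types (f g u v w z rho : R -> R) (a b c x y t C : R).
Local Notation mu := (@lebesgue_measure R).
Local Notation I := (`]0, 1[%classic : set R).
Local Notation mR := (@measurable _ (measurableTypeR R)).
Hint Resolve mR_itv : core.

Definition Linf u := measurable_fun I u /\ exists C, forall x, I x -> `|u x| <= C.

Lemma Linf_meas u : Linf u -> measurable_fun I u. Proof. by case. Qed.

Lemma Linf_L2 u : Linf u -> L2 u.
Proof. by move=> [mu_ [C uC]]; exact: L2_bnd uC. Qed.

Lemma LinfM u w : Linf u -> Linf w -> Linf (fun x => u x * w x).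
Proof.
move=> [m1 [C1 c1]] [m2 [C2 c2]]; split; first exact: measurable_funM.
by exists (C1 * C2) => x Ix; rewrite normrM ler_pM// ?c1 ?c2.
Qed.

Lemma ac_Linf u g : ac u g -> Linf u.
Proof.
move=> ug; split; first exact: ac_meas ug.
by eexists; exact: ac_bnd ug.
Qed.

Lemma L2_LinfM u w : Linf u -> L2 w -> L2 (fun x => u x * w x).
Proof. by move=> [m1 [C c1]] w2; exact: (L2Mb w2 m1 c1). Qed.

Lemma L2M_Linf u w : L2 u -> Linf w -> L2 (fun x => u x * w x).
Proof.
move=> u2 wi; rewrite (_ : (fun x => _) = (fun x => w x * u x)); first exact: L2_LinfM.
by apply/funext => x; rewrite mulrC.
Qed.

Lemma itg_LinfM u w : Linf u -> itg I w -> itg I (fun x => u x * w x).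
Proof. by move=> [m1 [C c1]] w2; exact: (itgM_bnd _ w2 m1 c1). Qed.

Lemma itgM_Linf u w : itg I u -> Linf w -> itg I (fun x => u x * w x).
Proof. by move=> u2 wi; apply: eq_itg (itg_LinfM wi u2) => // x _; rewrite mulrC. Qed.

Lemma nrmM u w C : 0 <= C -> Linf u -> L2 w -> (forall x, I x -> `|u x| <= C) ->
  nrm (fun x => u x * w x) <= C * nrm w.
Proof. by move=> C0 [m1 _] w2 uC; exact: nrm_Mb. Qed.

Definition has_int u c := itg I u /\ \int[mu]_(x in I) u x = c.

Lemma has_intI u : itg I u -> has_int u (\int[mu]_(x in I) u x). Proof. by []. Qed.

Lemma has_intD u w a b : has_int u a -> has_int w b -> has_int (fun x => u x + w x) (a + b).
Proof. by move=> [iu <-] [iw <-]; split; [exact: itgD|exact: intD]. Qed.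

Lemma has_intZ u a c : has_int u a -> has_int (fun x => c * u x) (c * a).
Proof. by move=> [iu <-]; split; [exact: itgZ|exact: intZ]. Qed.

Lemma Isub x : I x -> 0 <= x <= 1.
Proof. by rewrite /= in_itv/= => /andP[/ltW -> /ltW ->]. Qed.

(** By the transport equation, [a] is the time derivative of the mean-zero
primitive [H] of [f - rho].  After writing [f = H' + rho] and introducing a
primitive [K] of [H], every term with a derivative of [H] becomes a total
derivative, so that half the rate of change of the squared norm of [H] is
bounded although [f] is merely square integrable. *)
Lemma energy_density f z g rho (H := mz (fun x => f x - rho x)) (v1 := mz g)
    (v := prim v1) (a0 := fun x => prim (fun y => z y + f y * v1 y) x - f x * v x)
    (a := fun x => a0 x - \int[mu]_(y in I) a0 y) :
  L2 f -> L2 z -> L2 g -> L2 rho ->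
  `|dot a H| <= nrm H * nrm z + 2 * nrm rho * nrm g * nrm H
                + 5 / 2 * nrm g * nrm H ^+ 2.
Proof.
move=> f2 z2 g2 r2.
pose G x := f x - rho x; pose K := prim H; pose p y := z y + f y * v1 y.
have G2 : L2 G by exact: L2B.
have aH : ac H G by apply: ac_mz; exact: L2_itg.
have H2 := ac_L2 aH; have Hi := ac_Linf aH.
have aK : ac K H by apply: ac_prim; exact: L2_itg.
have Ki := ac_Linf aK; have K2 := Linf_L2 Ki.
have av1 : ac v1 g by apply: ac_mz; exact: L2_itg.
have v1i := ac_Linf av1; have v12 := Linf_L2 v1i.
have av : ac v v1 by apply: ac_prim; exact: L2_itg.
have vi := ac_Linf av; have v2 := Linf_L2 vi.
have p2 : L2 p by apply: L2D => //; exact: L2M_Linf.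
have aZ : ac (prim p) p by apply: ac_prim; exact: L2_itg.
have Zi := ac_Linf aZ; have Z2 := Linf_L2 Zi.
have K0 : K 0 = 0 by exact: prim0.
have K1 : K 1 = 0 by apply: prim_mz0; exact: L2_itg.
have v00 : v 0 = 0 by exact: prim0.
have v01 : v 1 = 0 by apply: prim_mz0; exact: L2_itg.
pose c := \int[mu]_(y in I) a0 y.
have aW := acD (acM aZ aK) (acD (acZ (-1) (acM aK (acM aH av1)))
  (acZ (- (1/2)) (acM aH (acM aH av)))).
have iW := ac_int aW.
set dW := (fun x => p x * K x + prim p x * H x + _) in aW iW.
have idW : itg I dW by case: aW.
have intW : \int[mu]_(x in I) dW x = 0.
  by rewrite iW K0 K1 v00 v01 !(mulr0, mul0r) !addr0 subrr.
have iH : itg I H by exact: L2_itg.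
have H0 : \int[mu]_(x in I) H x = 0 by apply: int_mz; exact: L2_itg.
have i1 : itg I (fun x => K x * z x) by exact: itgM.
have i2 : itg I (fun x => rho x * (v1 x * K x)) by apply: itgM => //; exact: L2_LinfM.
have i3 : itg I (fun x => rho x * (v x * H x)) by apply: itgM => //; exact: L2_LinfM.
have i4 : itg I (fun x => H x * (v1 x * H x)) by apply: itgM => //; exact: L2_LinfM.
have i5 : itg I (fun x => (K x * H x) * g x) by apply: itgM => //; exact: L2_LinfM.
pose T x := dW x + ((- c) * H x + ((-1) * (K x * z x) + ((-1) * (rho x * (v1 x * K x))
  + ((-1) * (rho x * (v x * H x)) + (3/2 * (H x * (v1 x * H x)) + (K x * H x) * g x))))).
have -> : dot a H = \int[mu]_(x in I) T x.
  rewrite dotE; apply: eq_Rintegral => x _; rewrite /T /dW /a /a0 -/c -/p.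
  have -> : f x = rho x + G x by rewrite /G; ring.
  by rewrite [p x in RHS]/p; have -> : f x = rho x + G x by [rewrite /G; ring]; field.
have [_ ->] := has_intD (conj idW intW) (has_intD (has_intZ (- c) (conj iH H0))
  (has_intD (has_intZ (-1) (has_intI i1)) (has_intD (has_intZ (-1) (has_intI i2))
  (has_intD (has_intZ (-1) (has_intI i3)) (has_intD (has_intZ (3/2) (has_intI i4))
  (has_intI i5)))))).
rewrite mulr0 !add0r.
have b1 : `|\int[mu]_(x in I) (K x * z x)| <= nrm H * nrm z.
  apply: le_trans (int_CS K2 z2) _; rewrite ler_wpM2r ?nrm_ge0//.
  by apply: nrm_bnd => [||x /Isub]; [exact: nrm_ge0|exact: Linf_meas|exact: prim_bnd_nrm].
have v1b x : I x -> `|v1 x| <= nrm g by move/Isub; exact: mz_bnd.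
have vb x : I x -> `|v x| <= nrm g.
  move=> Ix; apply: le_trans (prim_bnd_nrm v12 (Isub Ix)) _.
  exact: (nrm_bnd (nrm_ge0 g) (Linf_meas v1i) v1b).
have Kb x : I x -> `|K x| <= nrm H by move/Isub; exact: prim_bnd_nrm.
have b2 : `|\int[mu]_(x in I) (rho x * (v1 x * K x))| <= nrm rho * nrm g * nrm H.
  apply: le_trans (int_CS r2 (L2_LinfM v1i K2)) _; rewrite -mulrA ler_wpM2l ?nrm_ge0//.
  apply: le_trans (nrmM (nrm_ge0 g) v1i K2 v1b) _; rewrite ler_wpM2l ?nrm_ge0//.
  exact: (nrm_bnd (nrm_ge0 H) (Linf_meas Ki) Kb).
have b3 : `|\int[mu]_(x in I) (rho x * (v x * H x))| <= nrm rho * nrm g * nrm H.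
  apply: le_trans (int_CS r2 (L2_LinfM vi H2)) _; rewrite -mulrA ler_wpM2l ?nrm_ge0//.
  exact: (nrmM (nrm_ge0 g) vi H2 vb).
have b4 : `|\int[mu]_(x in I) (H x * (v1 x * H x))| <= nrm g * nrm H ^+ 2.
  apply: le_trans (int_CS H2 (L2_LinfM v1i H2)) _.
  apply: le_trans (ler_wpM2l (nrm_ge0 H) (nrmM (nrm_ge0 g) v1i H2 v1b)) _.
  by rewrite mulrCA expr2.
have b5 : `|\int[mu]_(x in I) ((K x * H x) * g x)| <= nrm g * nrm H ^+ 2.
  apply: le_trans (int_CS (L2_LinfM Ki H2) g2) _; rewrite mulrC ler_wpM2l ?nrm_ge0// expr2.
  exact: (nrmM (nrm_ge0 H) Ki H2 Kb).
move: b1 b2 b3 b4 b5; rewrite !ler_norml.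
set e1 := Rintegral _ _ _; set e2 := Rintegral _ _ _; set e3 := Rintegral _ _ _.
set e4 := Rintegral _ _ _; set e5 := Rintegral _ _ _.
set q1 := nrm H * nrm z; set q2 := nrm rho * nrm g * nrm H; set q3 := nrm g * nrm H ^+ 2.
have -> : 2 * nrm rho * nrm g * nrm H = 2 * q2 by rewrite /q2; ring.
have -> : 5 / 2 * nrm g * nrm H ^+ 2 = 5 / 2 * q3 by rewrite /q3; ring.
move: e1 e2 e3 e4 e5 q1 q2 q3 => e1 e2 e3 e4 e5 q1 q2 q3.
move=> /andP[? ?] /andP[? ?] /andP[? ?] /andP[? ?] /andP[? ?]; apply/andP; split; lra.
Qed.

(** * Joint measurability *)

Definition jm (F : R -> R -> R) := measurable_fun (I `*` I) (fun p : R * R => F p.1 p.2).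
Implicit Types F : R -> R -> R.

Lemma mII : measurable (I `*` I). Proof. by apply: measurableX; exact: measurable_itv. Qed.

Lemma mI_default : measurable (I : set R). Proof. exact: measurable_itv. Qed.

Lemma jmM F1 F2 : jm F1 -> jm F2 -> jm (fun t x => F1 t x * F2 t x).
Proof. by move=> m1 m2; exact: measurable_funM. Qed.

Lemma jmD F1 F2 : jm F1 -> jm F2 -> jm (fun t x => F1 t x + F2 t x).
Proof. by move=> m1 m2; exact: measurable_funD. Qed.

Lemma jmB F1 F2 : jm F1 -> jm F2 -> jm (fun t x => F1 t x - F2 t x).
Proof. by move=> m1 m2; exact: measurable_funB. Qed.

Lemma jm_fst u : measurable_fun I u -> jm (fun t _ => u t).
Proof. by move=> mu_; apply: (@meas_fst R _ _ R R) => //; exact: mI_default. Qed.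

Lemma jm_snd u : measurable_fun I u -> jm (fun _ x => u x).
Proof. by move=> mu_; apply: (@meas_snd R _ _ R R) => //; exact: mI_default. Qed.

Lemma jm_swap F : jm F -> jm (fun x t => F t x).
Proof. by move=> mF; apply: (@meas_swap R _ _ R R) => //; exact: mI_default. Qed.

Lemma jm_section F t : jm F -> I t -> measurable_fun I (F t).
Proof. by move=> mF It; apply: (@meas_section R _ _ R R I I) => //; exact: mI_default. Qed.

Lemma jm_int F : jm F -> measurable_fun I (fun t => \int[mu]_(x in I) F t x).
Proof. by move=> mF; apply: (@meas_param R _ R I I) => //; exact: mI_default. Qed.

Lemma jm_prim F : jm F -> jm (fun t x => prim (F t) x).
Proof.
move=> mF.
have : measurable_fun (I `*` I) (fun p : R * R => \int[mu]_(y in I) (if y < p.2 then F p.1 y else 0)).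
  apply: (@meas_param R _ (R * R)%type (I `*` I) I (fun p y => if y < p.2 then F p.1 y else 0)) => //.
    exact: mII.
  have mIII : measurable ((I `*` I) `*` I) by apply: measurableX; [exact: mII|exact: mI_default].
  apply: meas_if_lt => //; [exact: measurable_funTS| |].
    by apply: measurable_funTS; exact: measurableT_comp.
  apply: (measurable_comp (F := I `*` I) (g := fun q : (R * R) * R => (q.1.1, q.2)) _ _ mF).
  - exact: mII.
  - by move=> _ [[[? ?] ?] [[? ?] ?] <-].
  - apply: measurable_funTS; apply: measurable_fun_pair; last exact: measurable_snd.
    exact: (measurableT_comp measurable_fst measurable_fst).
apply: eq_measurable_fun => -[t x] /[!inE]/= -[_] /Isub/andP[_ x1].
by rewrite primE.
Qed.

Lemma jm_mz F : jm F -> jm (fun t x => mz (F t) x).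
Proof.
move=> mF; apply: jmB; first exact: jm_prim.
by apply: (@jm_fst (fun t => \int[mu]_(y in I) prim (F t) y)); apply: jm_int; exact: jm_prim.
Qed.

Lemma jm_dot F1 F2 : jm F1 -> jm F2 -> measurable_fun I (fun t => dot (F1 t) (F2 t)).
Proof.
move=> m1 m2; rewrite (_ : (fun t => _) = fun t => \int[mu]_(x in I) (F1 t x * F2 t x)).
  by apply: (@jm_int (fun t x => F1 t x * F2 t x)); exact: jmM.
by apply/funext => t; rewrite dotE.
Qed.

Lemma jm_nrm F : jm F -> measurable_fun I (fun t => nrm (F t)).
Proof.
move=> mF; rewrite (_ : (fun t => _) = Num.sqrt \o (fun t => dot (F t) (F t))).
  apply: (measurableT_comp _ (jm_dot mF mF)); apply: continuous_measurable_fun.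
  exact: sqrt_continuous.
by apply/funext => t; rewrite nrmE.
Qed.

End Spatial.

(** * Stability of the transport equation in a negative norm *)

Section TransportEstimate.
Context {R : realType}.
Local Notation mu := (@lebesgue_measure R).
Local Notation I := (`]0, 1[%classic : set R).
Local Notation mR := (@measurable _ (measurableTypeR R)).
Hint Resolve mR_itv : core.

Lemma meas_inv (D : set R) (u : R -> R) : measurable_fun D u -> (forall x, 0 < u x) ->
  measurable_fun D (fun x => (u x)^-1).
Proof.
move=> mu_ u0; rewrite (_ : (fun x => _) = (fun x => expR (- ln (u x)))).
  apply: measurableT_comp; first exact: measurable_expR.
  by apply: measurable_funN; apply: measurableT_comp mu_; exact: measurable_ln.
by apply/funext => x; rewrite expRN lnK// posrE.
Qed.

Lemma L2_le_ae (u w : R -> R) : measurable_fun I u -> itg I w ->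
  (\forall x \ae mu, I x -> u x ^+ 2 <= w x) ->
  L2 u /\ dot u u <= \int[mu]_(x in I) w x.
Proof.
move=> mu_ iw uw.
have w0 : \forall x \ae mu, I x -> (u x ^+ 2)%:E = (`|u x ^+ 2|)%:E.
  by apply: aeW => x _; rewrite ger0_norm ?sqr_ge0.
have le : (\int[mu]_(x in I) (u x ^+ 2)%:E <= \int[mu]_(x in I) (`|w x|)%:E)%E.
  apply: ge0_le_integral_ae => [x _|x _|]; rewrite ?lee_fin ?sqr_ge0//.
  by move: uw; apply: filterS => x H /H uw; rewrite lee_fin (le_trans uw)// ler_norm.
have u2 : L2 u by split => //; apply: le_lt_trans le (itg_lty iw).
split => //; rewrite -lee_fin dotE -(intE (itgM u2 u2) measI).
under eq_integral do rewrite -expr2.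
apply: (@le_trans _ _ (\int[mu]_(x in I) (Num.max (w x) 0)%:E)%E).
  apply: ge0_le_integral_ae => [x _|x _|]; rewrite ?lee_fin ?sqr_ge0 ?le_max ?lexx ?orbT//.
  by move: uw; apply: filterS => x H /H uw; rewrite lee_fin le_max uw.
rewrite -(intE iw measI) le_eqVlt; apply/orP; left; apply/eqP.
apply: eq_integral_ae; move: uw; apply: filterS => x H /H uw.
by rewrite max_l// (le_trans (sqr_ge0 _) uw).
Qed.

Variables (f z g : R -> R -> R) (rho r : R -> R).
Hypotheses (jf : jm f) (jz : jm z) (jg : jm g).
Hypothesis f2 : forall t, I t -> L2 (f t).
Hypothesis z2 : forall t, I t -> L2 (z t).
Hypothesis g2 : forall t, I t -> L2 (g t).
Hypothesis nf2 : L2 (fun t => nrm (f t)).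
Hypothesis nz2 : L2 (fun t => nrm (z t)).
Hypothesis ng2 : L2 (fun t => nrm (g t)).
Hypotheses (arho : ac rho r) (r2 : L2 r).

Let v1 t := mz (g t).
Let v t := prim (v1 t).
Let B (psi : R -> R) t :=
  \int[mu]_(x in I) (z t x * psi x + f t x * (derive1 psi x * v t x + psi x * v1 t x)).

Hypothesis evolution : \forall t \ae mu, I t -> forall psi, testfun psi ->
  \int[mu]_(x in I) (f t x * psi x) - \int[mu]_(x in I) (rho x * psi x) = prim (B psi) t.

Let p t x := z t x + f t x * v1 t x.
(** [a] is the time derivative of the mean-zero primitive in [x] of [f - rho],
and [h] recovers that primitive by integrating in time. *)
Let a0 t x := prim (p t) x - f t x * v t x.
Let a t x := a0 t x - \int[mu]_(y in I) a0 t y.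
Let h t x := prim (a^~ x) t.
Let al t := 2 * nrm (z t) + 4 * (nrm (g t) * nrm (f t)) + 1.
Let M0 := \int[mu]_(t in I) al t.

Let rho2 : L2 rho. Proof. exact: ac_L2 arho. Qed.

Let av1 t : I t -> ac (v1 t) (g t).
Proof. by move=> It; apply: ac_mz; apply: L2_itg; exact: g2. Qed.

Let av t : I t -> ac (v t) (v1 t).
Proof. by move=> It; apply: ac_prim; apply: L2_itg; apply: ac_L2 (av1 It). Qed.

Let v1b t x : I t -> I x -> `|v1 t x| <= nrm (g t).
Proof. by move=> It /Isub; apply: mz_bnd; exact: g2. Qed.

Let vb t x : I t -> I x -> `|v t x| <= nrm (g t).
Proof.
move=> It Ix; apply: le_trans (prim_bnd_nrm (ac_L2 (av1 It)) (Isub Ix)) _.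
apply: nrm_bnd (nrm_ge0 _) (ac_meas (av1 It)) _ => y Iy; exact: v1b.
Qed.

Let p2 t : I t -> L2 (p t).
Proof. by move=> It; apply: L2D; [exact: z2|apply: L2M_Linf (f2 It) (ac_Linf (av1 It))]. Qed.

Let aZ t : I t -> ac (prim (p t)) (p t).
Proof. by move=> It; apply: ac_prim; apply: L2_itg; exact: p2. Qed.

Let fv2 t : I t -> L2 (fun x => f t x * v t x).
Proof. by move=> It; apply: L2M_Linf (f2 It) (ac_Linf (av It)). Qed.

Let a02 t : I t -> L2 (a0 t).
Proof. by move=> It; apply: L2B (ac_L2 (aZ It)) (fv2 It). Qed.

Let a2 t : I t -> L2 (a t).
Proof. by move=> It; apply: L2B (a02 It) (L2_cst _). Qed.

Let fMv_le (u w : R -> R) C : 0 <= C -> L2 u -> Linf w -> (forall x, I x -> `|w x| <= C) ->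
  nrm (fun x => u x * w x) <= C * nrm u.
Proof.
move=> C0 u2 wi wC; rewrite (_ : (fun x => _) = (fun x => w x * u x)); first exact: nrmM.
by apply/funext => x; rewrite mulrC.
Qed.

Let a_le t : I t -> nrm (a t) <= al t.
Proof.
move=> It; apply: le_trans (nrmB (a02 It) (L2_cst _)) _.
rewrite nrm_cst.
have c_le : `|\int[mu]_(y in I) a0 t y| <= nrm (a0 t).
  apply: le_trans (le_normr_Rintegral measI (L2_itg (a02 It))) _.
  exact: int_abs_le (a02 It).
have Z_le : nrm (prim (p t)) <= nrm (p t).
  apply: nrm_bnd (nrm_ge0 _) (ac_meas (aZ It)) _ => x /Isub.
  by apply: prim_bnd_nrm; exact: p2.
have p_le : nrm (p t) <= nrm (z t) + nrm (g t) * nrm (f t).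
  apply: le_trans (nrmD (z2 It) (L2M_Linf (f2 It) (ac_Linf (av1 It)))) _.
  rewrite lerD2l; apply: fMv_le (nrm_ge0 _) (f2 It) (ac_Linf (av1 It)) _ => x.
  exact: v1b.
have fv_le : nrm (fun x => f t x * v t x) <= nrm (g t) * nrm (f t).
  by apply: fMv_le (nrm_ge0 _) (f2 It) (ac_Linf (av It)) _ => x; exact: vb.
have a0_le : nrm (a0 t) <= nrm (prim (p t)) + nrm (fun x => f t x * v t x).
  exact: nrmB (ac_L2 (aZ It)) (fv2 It).
rewrite /al; move: c_le Z_le p_le fv_le a0_le.
move: (nrm (a0 t)) (nrm (prim (p t))) (nrm (p t)) (nrm (z t)) (nrm (g t) * nrm (f t)) (nrm _) `|_|.
by move=> *; lra.
Qed.

Let al_itg : itg I al.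
Proof.
apply: itgD => //; last exact: itg_cstI.
apply: itgD => //; apply: itgZ => //; first exact: L2_itg.
exact: itgM.
Qed.

Let al_gt0 t : 0 < al t.
Proof. by rewrite /al ltr_wpDl// addr_ge0// ?mulr_ge0 ?nrm_ge0. Qed.

Let jv1 : jm v1. Proof. exact: jm_mz. Qed.
Let jv : jm v. Proof. exact: jm_prim. Qed.
Let ja0 : jm a0.
Proof.
apply: jmB; last exact: jmM.
by apply: jm_prim; apply: jmD => //; exact: jmM.
Qed.
Let ja : jm a.
Proof. by apply: jmB => //; apply: (@jm_fst _ (fun t => \int[mu]_(y in I) a0 t y)); exact: jm_int. Qed.

Let jh : jm h.
Proof. by apply: (@jm_swap _ (fun x t => prim (a^~ x) t)); apply: jm_prim; exact: jm_swap. Qed.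

Let a_itg_ae : \forall x \ae mu, I x -> itg I (a^~ x).
Proof.
apply: (fubini_ae (b := al)) => //; first by move=> t It; apply: L2_itg; exact: a2.
by move=> t It; apply: le_trans (int_abs_le (a2 It)) (a_le It).
Qed.

Let M0_ge0 : 0 <= M0.
Proof. by apply: Rintegral_ge0 => t _; exact: ltW. Qed.

(** A weighted Cauchy-Schwarz inequality in time gives the crude bound [M0],
whose only role is to be finite. *)
Let h2 t : 0 <= t <= 1 -> L2 (h t) /\ nrm (h t) <= M0.
Proof.
move=> /[dup] t01 /andP[t0 t1].
pose q s x := (al s)^-1 * (a s x ^+ 2).
have jq : jm q.
  apply: (@jmM _ (fun s _ => (al s)^-1)).
    by apply: jm_fst; apply: meas_inv => //; exact: itg_meas al_itg.
  by apply: measurable_funX.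
have iq s : I s -> itg I (q s).
  by move=> Is; apply: itgZ => //; apply: L2_sqr; exact: a2.
have qb s : I s -> \int[mu]_(x in I) `|q s x| <= al s.
  move=> Is; rewrite (_ : \int[mu]_(x in I) _ = (al s)^-1 * nrm (a s) ^+ 2).
    rewrite ler_pdivrMl// -expr2 lerXn2r ?nnegrE ?nrm_ge0 ?(ltW (al_gt0 _))//.
    exact: a_le.
  rewrite nrm_sqr dotE -(intZ _ measI (itgM (a2 Is) (a2 Is))).
  apply: eq_Rintegral => x _; rewrite ger0_norm -?expr2//.
  by rewrite mulr_ge0 ?sqr_ge0// invr_ge0 ltW.
have i2 := fubini_itg2 measI measI jq iq al_itg qb.
have E := fubini_eq measI measI jq iq al_itg qb.
have Qle : \int[mu]_(x in I) \int[mu]_(s in I) q s x <= M0.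
  rewrite -E; apply: (le_int measI (fubini_itg1 measI measI jq iq al_itg qb) al_itg) => s Is; apply: le_trans (qb _ Is).
  by apply: (le_int measI (iq s Is) (itg_abs measI (iq s Is))) => x _; exact: ler_norm.
have mh : measurable_fun I (h t).
  have m : measurable_fun I (fun x => \int[mu]_(s in I) (if s < t then a s x else 0)).
    apply: (@jm_int _ (fun x s => if s < t then a s x else 0)).
    apply: meas_if_lt; [exact: mII|exact: measurable_funTS|exact: measurable_funTS|].
    exact: jm_swap.
  by apply: eq_measurable_fun m => x _; rewrite /h primE.
have key : \forall x \ae mu, I x -> h t x ^+ 2 <= M0 * \int[mu]_(s in I) q s x.
  have qae := fubini_ae measI measI jq iq al_itg qb.
  apply: filterS2 a_itg_ae qae => x ax qx Ix.
  have {}ax := ax Ix; have {}qx := qx Ix.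
  have sal2 : L2 (fun s => Num.sqrt (al s)).
    apply: L2P.
      apply: (measurableT_comp _ (itg_meas al_itg)).
      by apply: continuous_measurable_fun; exact: sqrt_continuous.
    by apply: (eq_itg measI _ al_itg) => s _; rewrite sqr_sqrtr ?(ltW (al_gt0 s)).
  pose w s := a s x / Num.sqrt (al s).
  have mw : measurable_fun I w.
    apply: measurable_funM; first exact: itg_meas ax.
    by apply: meas_inv => [|s]; [exact: L2_meas sal2|rewrite sqrtr_gt0].
  have wE s : w s ^+ 2 = q s x.
    by rewrite /w /q expr_div_n (sqr_sqrtr (ltW (al_gt0 s))) [LHS]mulrC.
  have w2 : L2 w by apply: (L2P mw); apply: (eq_itg measI _ qx) => s _; rewrite wE.
  have H1 : `|h t x| <= nrm (fun s => Num.sqrt (al s)) * nrm w.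
    apply: le_trans (ler_prim ax t01) _; apply: le_trans (dot_abs_le sal2 w2).
    rewrite le_eqVlt; apply/orP; left; apply/eqP; apply: eq_Rintegral => s _.
    have sp : 0 < Num.sqrt (al s) by rewrite sqrtr_gt0; exact: al_gt0.
    have -> : Num.sqrt (al s) * w s = a s x by rewrite /w mulrC (divfK (lt0r_neq0 sp)).
    reflexivity.
  have -> : M0 = nrm (fun s => Num.sqrt (al s)) ^+ 2.
    rewrite nrm_sqr dotE; apply: eq_Rintegral => s _.
    by rewrite -expr2 sqr_sqrtr ?(ltW (al_gt0 s)).
  have -> : \int[mu]_(s in I) q s x = nrm w ^+ 2.
    by rewrite nrm_sqr dotE; apply: eq_Rintegral => s _; rewrite -expr2 wE.
  rewrite -exprMn -(real_normK (num_real (h t x))).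
  by rewrite lerXn2r ?nnegrE ?mulr_ge0 ?nrm_ge0.
have [l2 le] := L2_le_ae mh (itgZ M0 measI i2) key.
split; first exact: l2.
have e : nrm (h t) ^+ 2 <= M0 ^+ 2.
  rewrite nrm_sqr; apply: (le_trans le); rewrite (intZ _ measI i2) expr2.
  exact: ler_wpM2l M0_ge0 _ _ Qle.
rewrite -(@ler_pXn2r _ 2 isT) ?nnegrE; [exact: e|exact: nrm_ge0|exact: M0_ge0].
Qed.

Let J (t : R) := (`]0, t[%classic : set R).

Let fubiniJ (k : R -> R -> R) (b : R -> R) t : 0 <= t <= 1 -> jm k ->
  (forall s, I s -> itg I (k s)) -> itg I b ->
  (forall s, I s -> \int[mu]_(x in I) `|k s x| <= b s) ->
  prim (fun s => \int[mu]_(x in I) k s x) t = \int[mu]_(x in I) prim (k^~ x) t.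
Proof.
move=> /andP[t0 t1] jk ik ib kb.
rewrite prim_int; under [RHS]eq_Rintegral do rewrite prim_int.
apply: (fubini_eq (b := b)) => //.
- apply: measurable_funS jk; first exact: mII.
  by move=> [s x] [/= /(sub0x t1) ? ?].
- by move=> s /(sub0x t1); exact: ik.
- exact: itg_sub.
- by move=> s /(sub0x t1); exact: kb.
Qed.

(** In the weak sense [a t] is a primitive in [x] of the time derivative of [f];
hence [h t] is one of [f t - rho]. *)
Let B_flux psi t : testfun psi -> I t ->
  B psi t = - \int[mu]_(x in I) (a t x * derive1 psi x).
Proof.
move=> tp It; have ap := testfun_ac tp; have pi := ac_Linf ap.
have tp' := testfun_derive tp; have ap' := testfun_ac tp'; have pi' := ac_Linf ap'.
have [iZ eZ] := acM (aZ It) ap.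
have i1 : itg I (fun x => p t x * psi x + prim (p t) x * derive1 psi x) by [].
have i2 : itg I (fun x => a t x * derive1 psi x).
  by apply: itgM (a2 It) (Linf_L2 pi').
have i3 : itg I (derive1 psi) by apply: L2_itg; exact: Linf_L2 pi'.
have E1 : \int[mu]_(x in I) (p t x * psi x + prim (p t) x * derive1 psi x) = 0.
  rewrite (ac_int (acM (aZ It) ap)) (testfun_le0 tp (lexx 0)) (testfun_ge1 tp (lexx 1)).
  by rewrite !mulr0 subrr.
have E3 : \int[mu]_(x in I) derive1 psi x = 0.
  by rewrite (ac_int ap) (testfun_le0 tp (lexx 0)) (testfun_ge1 tp (lexx 1)) subrr.
have [_ E] := has_intD (conj i1 E1) (has_intD (has_intZ (-1) (has_intI i2))
   (has_intZ (- \int[mu]_(y in I) a0 t y) (conj i3 E3))).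
rewrite mulr0 addr0 add0r mulN1r in E; rewrite -E.
apply: eq_Rintegral => x _; rewrite /a /a0 /p; ring.
Qed.

Let h_testfun psi t : testfun psi -> 0 <= t <= 1 ->
  \int[mu]_(x in I) (h t x * derive1 psi x) = - prim (B psi) t.
Proof.
move=> tp /[dup] t01 /andP[t0 t1].
have tp' := testfun_derive tp; have [C C0 pC] := testfun_bnd tp'.
have jk : jm (fun s x => a s x * derive1 psi x).
  by apply: jmM => //; apply: jm_snd; exact: testfun_meas.
have ik s : I s -> itg I (fun x => a s x * derive1 psi x).
  by move=> Is; apply: itgM (a2 Is) (testfun_L2 tp').
have kb s : I s -> \int[mu]_(x in I) `|a s x * derive1 psi x| <= C * al s.
  move=> Is; apply: le_trans (dot_abs_le (a2 Is) (testfun_L2 tp')) _.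
  have pC' : nrm (derive1 psi) <= C.
    by apply: nrm_bnd C0 (testfun_meas measI tp') _ => x _; exact: pC.
  by rewrite mulrC; apply: ler_pM (nrm_ge0 _) (nrm_ge0 _) pC' (a_le Is).
have := fubiniJ t01 jk ik (itgZ C measI al_itg) kb.
have -> : prim (fun s => \int[mu]_(x in I) (a s x * derive1 psi x)) t = - prim (B psi) t.
  rewrite -mulN1r; have iB : itg I (B psi).
    have := fubini_itg1 measI measI jk ik (itgZ C measI al_itg) kb.
    move/(itgZ (-1) measI); apply: eq_itg => // s Is.
    by rewrite mulN1r B_flux.
  rewrite -(primZ _ iB t1) !prim_int; apply: eq_Rintegral => s /[!inE] Js.
  by rewrite B_flux ?mulN1r ?opprK//; exact: (sub0x t1).
move=> ->; apply: eq_Rintegral_ae; move: a_itg_ae; apply: filterS => x ax Ix.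
rewrite /h mulrC -(primZ _ (ax Ix) t1) !prim_int; apply: eq_Rintegral => s _.
by rewrite mulrC.
Qed.

Let h_int t : 0 <= t <= 1 -> \int[mu]_(x in I) h t x = 0.
Proof.
move=> t01; rewrite -(fubiniJ t01 ja (fun s Is => L2_itg (a2 Is)) al_itg).
  transitivity (\int[mu]_(s in `]0, t[) (0 : R)); last by rewrite Rintegral_cst// mul0r.
  rewrite prim_int; apply: eq_Rintegral => s /[!inE] Js.
  have Is : I s by apply: (sub0x _ Js); case/andP : t01.
  rewrite -[LHS]/(\int[mu]_(x in I) (a0 s x - \int[mu]_(y in I) a0 s y)).
  by rewrite (intB measI (L2_itg (a02 Is)) (itg_cstI _)) int_cstI subrr.
by move=> s Is; apply: le_trans (int_abs_le (a2 Is)) (a_le Is).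
Qed.

Let h_mz : \forall t \ae mu, I t ->
  \forall x \ae mu, I x -> h t x = mz (fun x => f t x - rho x) x.
Proof.
move: evolution; apply: filterS => t ev It; have t01 := Isub It.
have [h2t _] := h2 t01.
apply: mz_uniq => //; last exact: h_int.
split; first by apply: L2B => //; exact: f2.
move=> psi tp; rewrite h_testfun// -(ev It)//; congr (- _).
rewrite -(intB measI (itgM (f2 It) (testfun_L2 tp)) (itgM rho2 (testfun_L2 tp))).
by apply: eq_Rintegral => x _; rewrite mulrBl.
Qed.

Let energy t : 0 <= t <= 1 ->
  nrm (h t) ^+ 2 = 2 * prim (fun s => dot (a s) (h s)) t.
Proof.
move=> /[dup] t01 /andP[t0 t1].
have jk : jm (fun s x => a s x * h s x) by exact: jmM.
have h2' s : I s -> L2 (h s) by move/Isub/h2 => [].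
have ik s : I s -> itg I (fun x => a s x * h s x).
  by move=> Is; apply: itgM (a2 Is) (h2' _ Is).
have kb s : I s -> \int[mu]_(x in I) `|a s x * h s x| <= M0 * al s.
  move=> Is; apply: le_trans (dot_abs_le (a2 Is) (h2' _ Is)) _.
  have [_ hM0] := h2 (Isub Is).
  by rewrite mulrC; apply: ler_pM (nrm_ge0 _) (nrm_ge0 _) hM0 (a_le Is).
have ib := itgZ M0 measI al_itg.
rewrite (_ : (fun s => dot (a s) (h s)) = (fun s => \int[mu]_(x in I) (a s x * h s x))); last first.
  by apply/funext => s; rewrite dotE.
rewrite (fubiniJ t01 jk ik ib kb) nrm_sqr dotE.
have i2 : itg I (fun x => prim (fun s => a s x * h s x) t).
  have -> : (fun x => prim (fun s => a s x * h s x) t) =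
      (fun x => \int[mu]_(s in `]0, t[) (a s x * h s x)).
    by apply/funext => x; rewrite prim_int.
  apply: (@fubini_itg2 _ (`]0, t[%classic : set R) I (fun s x => a s x * h s x) (fun s => M0 * al s)) => //.
  - apply: measurable_funS jk; first exact: mII.
    by move=> [s x] [/= /(sub0x t1) ? ?].
  - by move=> s /(sub0x t1); exact: ik.
  - exact: itg_sub.
  - by move=> s /(sub0x t1); exact: kb.
rewrite -(intZ _ measI i2); apply: eq_Rintegral_ae.
have kae := fubini_ae measI measI jk ik ib kb.
apply: filterS2 a_itg_ae kae => x ax kx Ix.
have {}ax := ax Ix; have {}kx := kx Ix.
rewrite {1 2}/h primM// -(primZ _ kx t1) !prim_int; apply: eq_Rintegral => s _.
by rewrite -/(h s x); ring.
Qed.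

Let sg := \int[mu]_(t in I) nrm (z t).
Let be := \int[mu]_(t in I) nrm (g t).

Let inz : itg I (fun t => nrm (z t)). Proof. exact: L2_itg. Qed.
Let ing : itg I (fun t => nrm (g t)). Proof. exact: L2_itg. Qed.

(** Let [M] be the supremum of [nrm (h t)].  The energy identity and
[energy_density] give [M^2 <= 2 M (sg + 2 nrm rho be) + 5 be M^2]; the last term
is absorbed by the left-hand side, which is legitimate since [M] is finite. *)
Lemma transport_stability : 10 * be <= 1 -> forall t, 0 <= t <= 1 ->
  nrm (h t) <= 4 * (sg + 2 * nrm rho * be).
Proof.
move=> be1.
pose S := [set nrm (h t) | t in `[0, 1]%classic].
have S0 : S !=set0 by exists (nrm (h 0)), 0 => //=; rewrite in_itv/= lexx ler01.
have Sub : has_ubound S.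
  exists M0; move=> y [t /=]; rewrite in_itv/= => t01 <-.
  by have [] := h2 t01.
pose M := sup S.
have hM t : 0 <= t <= 1 -> nrm (h t) <= M.
  by move=> t01; apply: ub_le_sup => //; exists t => //=; rewrite in_itv.
have M_ge0 : 0 <= M by apply: le_trans (nrm_ge0 _) (hM 0 _); rewrite lexx ler01.
have be0 : 0 <= be by apply: Rintegral_ge0 => t _; exact: nrm_ge0.
have sg0 : 0 <= sg by apply: Rintegral_ge0 => t _; exact: nrm_ge0.
pose Q t := M * nrm (z t) + (2 * nrm rho * M + 5 / 2 * M ^+ 2) * nrm (g t).
have iQ : itg I Q by apply: itgD => //; exact: itgZ.
have Q0 t : 0 <= Q t.
  by rewrite /Q addr_ge0 ?mulr_ge0 ?addr_ge0 ?mulr_ge0 ?nrm_ge0 ?sqr_ge0 ?divr_ge0.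
have dens : \forall t \ae mu, I t -> `|dot (a t) (h t)| <= Q t.
  move: h_mz; apply: filterS => t H It.
  have e : \forall x \ae mu, I x -> a t x = a t x by apply: aeW.
  rewrite (dot_ae e (H It)).
  apply: le_trans (energy_density (f2 It) (z2 It) (g2 It) rho2) _.
  rewrite -(nrm_ae (H It)) /Q.
  have hMt := hM t (Isub It).
  have n1 := nrm_ge0 (z t); have n2 := nrm_ge0 (g t); have n3 := nrm_ge0 rho.
  have n4 := nrm_ge0 (h t).
  have e1 : nrm (h t) * nrm (z t) <= M * nrm (z t) by rewrite ler_wpM2r.
  have e2 : 2 * nrm rho * nrm (g t) * nrm (h t) <= 2 * nrm rho * nrm (g t) * M.
    by rewrite ler_wpM2l// !mulr_ge0.
  have e3 : 5 / 2 * nrm (g t) * nrm (h t) ^+ 2 <= 5 / 2 * nrm (g t) * M ^+ 2.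
    by rewrite ler_wpM2l ?mulr_ge0 ?divr_ge0// lerXn2r ?nnegrE.
  apply: le_trans (lerD (lerD e1 e2) e3) _; rewrite le_eqVlt; apply/orP; left; apply/eqP; ring.
have md : measurable_fun I (fun t => dot (a t) (h t)) by exact: jm_dot.
have id : itg I (fun t => dot (a t) (h t)).
  apply: itgP => //; apply: le_lt_trans (itg_lty iQ).
  apply: ge0_le_integral_ae => //; move: dens; apply: filterS => t H /H Ht.
  by rewrite lee_fin (le_trans Ht)// ler_norm.
have intQ : \int[mu]_(t in I) Q t = M * sg + (2 * nrm rho * M + 5 / 2 * M ^+ 2) * be.
  by have [_ ->] := has_intD (has_intZ M (has_intI inz))
       (has_intZ (2 * nrm rho * M + 5 / 2 * M ^+ 2) (has_intI ing)).
have bound t : 0 <= t <= 1 -> nrm (h t) ^+ 2 <= 2 * \int[mu]_(t in I) Q t.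
  move=> t01; rewrite energy// ler_pM2l//.
  apply: le_trans (ler_norm _) _; apply: le_trans (ler_prim id t01) _.
  have -> : \int[mu]_(t in I) Q t = \int[mu]_(t in I) Num.max (Q t) `|dot (a t) (h t)|.
    by apply: eq_Rintegral_ae; move: dens; apply: filterS => s H /H Hs; rewrite max_l.
  apply: le_int => //; first exact: itg_abs.
    apply: (itg_ae measI iQ).
      apply: measurable_maxr; first exact: itg_meas.
      exact: measurableT_comp.
    by move: dens; apply: filterS => s H /H Hs; rewrite max_l.
  by move=> s _; rewrite le_max lexx orbT.
have M2 : M ^+ 2 <= 2 * \int[mu]_(t in I) Q t.
  have QQ : 0 <= 2 * \int[mu]_(t in I) Q t by rewrite mulr_ge0// Rintegral_ge0.
  rewrite -(sqr_sqrtr QQ) lerXn2r ?nnegrE ?sqrtr_ge0//.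
  apply: (ge_sup S0) => y [t /=]; rewrite in_itv/= => t01 <-.
  by rewrite -(ger0_norm (nrm_ge0 (h t))) -sqrtr_sqr ler_wsqrtr// bound.
move=> t t01; apply: le_trans (hM t t01) _.
rewrite intQ in M2.
have [M0'|Mn0] := eqVneq M 0.
  rewrite M0'; exact: mulr_ge0 (ler0n _ 4) (addr_ge0 sg0
    (mulr_ge0 (mulr_ge0 (ler0n _ 2) (nrm_ge0 rho)) be0)).
have Mp : 0 < M by rewrite lt_def Mn0.
have H5 : 5 * be * M ^+ 2 <= 1 / 2 * M ^+ 2 by rewrite ler_wpM2r ?sqr_ge0//; lra.
have : M * M <= M * (4 * (sg + 2 * nrm rho * be)).
  rewrite expr2 in M2 H5.
  have -> : M * (4 * (sg + 2 * nrm rho * be)) = 4 * (M * sg) + 8 * (nrm rho * M * be) by ring.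
  have e : 2 * (M * sg + (2 * nrm rho * M + 5 / 2 * (M * M)) * be) =
    2 * (M * sg) + 4 * (nrm rho * M * be) + 5 * be * (M * M) by field.
  rewrite e in M2; move: M2 H5.
  by move: (M * sg) (nrm rho * M * be) (5 * be * (M * M)) (M * M) => x1 x2 x3 x4; lra.
by rewrite ler_pM2l.
Qed.

(** Replacing [f] by [rho] in the transport term costs the pairing of
[f t - rho] with [(v psi)_x], which is minus that of [h t] with [(v psi)_xx] and
hence quadratic in the size of [(v, z)]. *)
Lemma transport_linearization psi C : 10 * be <= 1 -> testfun psi -> 0 <= C ->
  (forall x, `|psi x| <= C) -> (forall x, `|derive1 psi x| <= C) ->
  (forall x, `|derive1 (derive1 psi) x| <= C) ->
  `|prim (B psi) 1 - \int[mu]_(t in I) dot (fun x => z t x - r x * v t x) psi|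
    <= 16 * C * (sg + 2 * nrm rho * be) * be.
Proof.
move=> be1 tp C0 b0 b1 b2.
have tp' := testfun_derive tp; have tp'' := testfun_derive tp'.
have ap := testfun_ac tp; have ap' := testfun_ac tp'.
have pi := ac_Linf ap; have pi' := ac_Linf ap'; have pi'' := ac_Linf (testfun_ac tp'').
set N := 4 * (sg + 2 * nrm rho * be).
have N_ge0 : 0 <= N.
  have be0 : 0 <= be by apply: Rintegral_ge0 => t _; exact: nrm_ge0.
  have sg0 : 0 <= sg by apply: Rintegral_ge0 => t _; exact: nrm_ge0.
  by rewrite mulr_ge0// addr_ge0// !mulr_ge0 ?nrm_ge0.
pose k t x := g t x * psi x + (2 * (v1 t x * derive1 psi x) + v t x * derive1 (derive1 psi) x).
have dens : \forall t \ae mu, I t ->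
    `|B psi t - dot (fun x => z t x - r x * v t x) psi| <= N * (4 * C) * nrm (g t).
  move: h_mz; apply: filterS => t H It.
  have {}H := H It; have ht := transport_stability be1 (Isub It).
  set G := fun x => f t x - rho x in H.
  have G2 : L2 G by apply: L2B => //; exact: f2.
  have aH : ac (mz G) G by apply: ac_mz; exact: L2_itg.
  have v1i := ac_Linf (av1 It); have vi := ac_Linf (av It).
  have v00 : v t 0 = 0 by exact: prim0.
  have v01 : v t 1 = 0 by apply: prim_mz0; apply: L2_itg; exact: g2.
  have akk := acD (acM (av1 It) ap) (acM (av It) ap').
  have aW := acM aH akk.
  have aV := acM arho (acM (av It) ap).
  have [iW _] := aW; have [iV _] := aV.
  have EW := ac_int aW; have EV := ac_int aV.
  have W0 : mz G 1 * (v1 t 1 * psi 1 + v t 1 * derive1 psi 1) -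
      mz G 0 * (v1 t 0 * psi 0 + v t 0 * derive1 psi 0) = 0.
    by rewrite v00 v01 (testfun_le0 tp (lexx 0)) (testfun_ge1 tp (lexx 1)); ring.
  have V0 : rho 1 * (v t 1 * psi 1) - rho 0 * (v t 0 * psi 0) = 0.
    by rewrite v00 v01; ring.
  rewrite W0 in EW; rewrite V0 in EV.
  have z2t := z2 It; have g2t := g2 It; have f2t := f2 It.
  have kL2 : L2 (k t).
    apply: L2D; first exact: L2M_Linf.
    apply: L2D; last by apply: Linf_L2; exact: LinfM.
    by apply: L2Z; apply: Linf_L2; exact: LinfM.
  have H2 := ac_L2 aH.
  have i1 : itg I (fun x => mz G x * k t x) by exact: itgM.
  have i2 : itg I (fun x => (z t x - r x * v t x) * psi x).
    apply: itgM; last exact: Linf_L2.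
    by apply: L2B => //; apply: L2M_Linf.
  have [_ E] := has_intD (conj iW EW) (has_intD (conj iV EV)
    (has_intD (has_intZ (-1) (has_intI i1)) (has_intI i2))).
  have -> : B psi t = - dot (mz G) (k t) + dot (fun x => z t x - r x * v t x) psi.
    rewrite !add0r mulN1r in E; rewrite !dotE -E; apply: eq_Rintegral => x _.
    by rewrite /k /G; ring.
  rewrite addrK normrN; apply: le_trans (CS H2 kL2) _; rewrite -mulrA.
  apply: ler_pM; rewrite ?nrm_ge0//; first by rewrite -(nrm_ae H).
  have k1 : nrm (fun x => g t x * psi x) <= C * nrm (g t).
    by apply: fMv_le => // x _; exact: b0.
  have k2 : nrm (fun x => v1 t x * derive1 psi x) <= C * nrm (g t).
    apply: nrm_bnd; first by rewrite mulr_ge0 ?nrm_ge0.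
      by apply: measurable_funM; exact: Linf_meas.
    by move=> x Ix; rewrite normrM mulrC ler_pM// v1b.
  have k3 : nrm (fun x => v t x * derive1 (derive1 psi) x) <= C * nrm (g t).
    apply: nrm_bnd; first by rewrite mulr_ge0 ?nrm_ge0.
      by apply: measurable_funM; exact: Linf_meas.
    by move=> x Ix; rewrite normrM mulrC ler_pM// vb.
  have l1 : L2 (fun x => g t x * psi x) by exact: L2M_Linf.
  have l2 : L2 (fun x => v1 t x * derive1 psi x) by apply: Linf_L2; exact: LinfM.
  have l3 : L2 (fun x => v t x * derive1 (derive1 psi) x) by apply: Linf_L2; exact: LinfM.
  apply: le_trans (nrmD l1 (L2D (L2Z 2 l2) l3)) _.
  apply: le_trans (lerD (lexx _) (nrmD (L2Z 2 l2) l3)) _.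
  rewrite nrmZ// (ger0_norm (ler0n _ 2)) -mulrA.
  have -> : 4 * (C * nrm (g t)) = C * nrm (g t) + (2 * (C * nrm (g t)) + C * nrm (g t)) by ring.
  exact: lerD k1 (lerD (ler_wpM2l (ler0n _ 2) k2) k3).
have mB : measurable_fun I (B psi).
  apply: (@jm_int _ (fun t x => z t x * psi x + f t x * (derive1 psi x * v t x + psi x * v1 t x))).
  have jp : jm (fun _ : R => psi) by apply: jm_snd; exact: testfun_meas.
  have jp' : jm (fun _ : R => derive1 psi) by apply: jm_snd; exact: testfun_meas.
  by apply: jmD; [exact: jmM|apply: jmM => //; apply: jmD; exact: jmM].
have md : measurable_fun I (fun t => dot (fun x => z t x - r x * v t x) psi).
  apply: (@jm_dot _ (fun t x => z t x - r x * v t x) (fun _ => psi)).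
    by apply: jmB => //; apply: jmM => //; apply: jm_snd; exact: L2_meas.
  by apply: jm_snd; exact: testfun_meas.
have id : itg I (fun t => dot (fun x => z t x - r x * v t x) psi).
  apply: (@le_itg _ _ _ (fun t => nrm psi * nrm (z t) + nrm psi * nrm r * nrm (g t))) => //.
    move=> t It; have vi := ac_Linf (av It).
    have rv2 : L2 (fun x => r x * v t x) by exact: L2M_Linf.
    apply: le_trans (CS (L2B (z2 It) rv2) (testfun_L2 tp)) _.
    rewrite mulrC -mulrA -mulrDr ler_wpM2l ?nrm_ge0//.
    apply: le_trans (nrmB (z2 It) rv2) _; rewrite lerD2l mulrC.
    by apply: fMv_le => //; [exact: nrm_ge0|move=> x; exact: vb].
  by apply: itgD => //; exact: itgZ.
have ie : itg I (fun t => N * (4 * C) * nrm (g t)) by exact: itgZ.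
have idif : itg I (fun t => B psi t - dot (fun x => z t x - r x * v t x) psi).
  apply: itgP; first exact: measurable_funB.
  apply: le_lt_trans (itg_lty ie).
  apply: ge0_le_integral_ae => //; move: dens; apply: filterS => t H /H Ht.
  by rewrite lee_fin (le_trans Ht)// ler_norm.
have iB : itg I (B psi).
  by apply: eq_itg (itgD measI idif id) => // t _; rewrite subrK.
rewrite prim1 -(intB measI iB id).
apply: le_trans (le_normr_Rintegral measI idif) _.
have -> : 16 * C * (sg + 2 * nrm rho * be) * be = \int[mu]_(t in I) (N * (4 * C) * nrm (g t)).
  by rewrite (intZ _ measI ing) -/be /N; ring.
have -> : \int[mu]_(t in I) (N * (4 * C) * nrm (g t)) =
    \int[mu]_(t in I) Num.max (N * (4 * C) * nrm (g t)) `|B psi t - dot (fun x => z t x - r x * v t x) psi|.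
  by apply: eq_Rintegral_ae; move: dens; apply: filterS => s H /H Hs; rewrite max_l.
apply: le_int => //; first exact: itg_abs.
  apply: (itg_ae measI ie).
    apply: measurable_maxr; first exact: itg_meas ie.
    by apply: measurableT_comp => //; exact: measurable_funB.
  by move: dens; apply: filterS => s H /H Hs; rewrite max_l.
by move=> s _; rewrite le_max lexx orbT.
Qed.

End TransportEstimate.

(** * From admissible triples to jointly measurable ones *)

Section Continuity.
Context {R : realType}.
Implicit Types (f g u v w phi : R -> R) (a b c x y t : R).
Local Notation mu := (@lebesgue_measure R).
Local Notation I := (`]0, 1[%classic : set R).
Local Notation mR := (@measurable _ (measurableTypeR R)).
Hint Resolve mR_itv : core.

Lemma itg_patch g D : mR D -> itg I g -> itg D (g \_ I).
Proof.
move=> mD ig; have : itg setT (g \_ I).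
  by move/integrable_mkcond : ig; rewrite restrict_EFin; exact.
exact: itgS.
Qed.

Lemma prim_patch g y : itg I g -> y <= 1 -> prim g y = \int[mu]_(t in `]0, y]) (g \_ I) t.
Proof.
move=> ig y1.
rewrite -Rintegral_itv_bndo_bndc; last exact: itg_patch.
rewrite !prim_int; apply: eq_Rintegral => z; rewrite inE/= in_itv/= => /andP[z0 zy].
by rewrite patchE mem_set//= in_itv/= z0 (lt_le_trans zy).
Qed.

Lemma prim_derive_pt g x : itg I g -> I x -> lebesgue_pt (g \_ I) x ->
  is_derive x 1 (prim g) (g x).
Proof.
move=> ig /= + lx; rewrite in_itv/= => /andP[x0 x1].
have [] := @FTC1_lebesgue_pt R (g \_ I) (BRight 0) x 1 x1 _ _ lx.
- exact: itg_patch.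
- exact: x0.
move=> dF FE.
apply: (@is_derive_near _ (fun y => \int[mu]_(t in [set` Interval (BRight 0) (BRight y)]) (g \_ I) t)).
  near=> y.
  have y1 : y <= 1 by apply: ltW; near: y; exact: lt_nbhsl.
  by rewrite prim_patch.
have := derivableP dF; rewrite -derive1E FE patchE mem_set//= in_itv/= x0//.
Unshelve. all: by end_near. Qed.

Lemma prim_within_continuous g : itg I g -> {within `[0, 1], continuous (prim g)}.
Proof.
move=> ig; have := parameterized_integral_continuous ler01 (itg_patch (mR_itv `[0, 1]) ig).
apply: subspace_eq_continuous => x; rewrite inE/= in_itv/= => /andP[x0 x1].
rewrite -[RHS]/(prim g x) -[LHS]/(\int[mu]_(t in `[0, x]) (g \_ I) t).
by rewrite prim_patch// -Rintegral_itv_obnd_cbnd//; exact: itg_patch.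
Qed.

Lemma ac_continuous u g x : ac u g -> I x -> {for x, continuous u}.
Proof.
move=> [ig ug] Ix.
have : {within `[0, 1], continuous u}.
  apply: (@subspace_eq_continuous _ _ _ (fun x => u 0 + prim g x)).
    by move=> y; rewrite inE/= in_itv/= => y01; rewrite [RHS]ug.
  move=> y; apply: cvgD; first exact: cvg_cst.
  exact: (prim_within_continuous ig).
move/continuous_within_itvP => /(_ ltr01) [+ _ _]; apply.
by rewrite inE in Ix *.
Qed.

Lemma ac_derive_prim u g x : ac u g -> I x -> is_derive x 1 (prim u) (u x).
Proof.
move=> ug Ix; apply: prim_derive_pt => //; first by apply: L2_itg; exact: ac_L2 ug.
have [e /= e0 eI] : exists2 e : R, 0 < e & ball x e `<=` I.
  have oI : open I by exact: interval_open.
  by have := open_nbhs_nbhs (conj oI Ix); move=> /nbhs_ballP[e e0 H]; exists e.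
apply: (@continuous_lebesgue_pt _ _ _ (ball x e)) => //.
- exact: ball_open_nbhs.
- exact: measurable_ball.
- apply: (@measurable_funS _ _ _ _ I) => //.
  apply: eq_measurable_fun (ac_meas ug) => y yI.
  by rewrite patchE yI.
- have cu := ac_continuous ug Ix.
  have H : \near x, u x = (u \_ I) x.
    have oI : open I by exact: interval_open.
    have := open_nbhs_nbhs (conj oI Ix); apply: filterS => y Iy.
    by rewrite patchE mem_set.
  rewrite /prop_for /continuous_at patchE mem_set//.
  exact: cvg_trans (near_eq_cvg H) cu.
Qed.

(** The upper limit of the difference quotients equals the derivative where it
exists, and it is measurable in any further parameters. *)
Definition dquot (F : R -> R) x :=
  fine (limn_esup (fun n => (n.+1%:R * (F (x + n.+1%:R^-1) - F x))%:E)).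

Lemma dquotE (F : R -> R) x (d : R) : is_derive x 1 F d -> dquot F x = d.
Proof.
move=> [dF <-]; rewrite /dquot.
suff H : (fun n => (n.+1%:R * (F (x + n.+1%:R^-1) - F x))%:E) @ \oo --> ('D_1 F x)%:E.
  by rewrite (cvg_limn_einf_sup H).2.
apply: cvg_EFin; first exact: nearW.
have c0 : (n.+1%:R^-1 : R) @[n --> \oo] --> 0^'.
  move=> A /= HA; have := @cvg_harmonic R _ HA.
  rewrite !nbhs_simpl /=; apply: filterS => n /= H; apply: H.
  by rewrite invr_eq0 pnatr_eq0.
have := @cvg_comp _ _ _ (fun n => n.+1%:R^-1 : R)
  (fun h : R => h^-1 *: ((F \o shift x) (h *: 1) - F x)) _ _ _ c0 dF.
apply: cvg_trans; apply: near_eq_cvg; apply: nearW => n /=.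
by rewrite invrK [_ *: 1]mulr1 [x + _]addrC.
Qed.

Lemma jm_dquot (F : R -> R -> R) : jm F ->
  jm (fun t x => dquot (F t \_ I) x).
Proof.
move=> jF; apply: measurableT_comp => //.
apply: measurable_fun_limn_esup => n.
pose G := (fun p : R * R => F p.1 p.2) \_ (I `*` I).
have mG : measurable_fun [set: R * R] G.
  by apply/(measurable_restrictT _ _).1 => //; exact: mII.
apply/measurable_EFinP.
have m c : measurable_fun (I `*` I) (fun p : R * R => G (p.1, p.2 + c)).
  apply: (measurable_comp (F := setT) (g := fun p : R * R => (p.1, p.2 + c)) _ _ mG) => //.
  apply: measurable_funTS; apply: measurable_fun_pair; first exact: measurable_fst.
  by apply: measurable_funD => //; exact: measurable_snd.
have : measurable_fun (I `*` I) (fun p : R * R => n.+1%:R * (G (p.1, p.2 + n.+1%:R^-1) - G (p.1, p.2 + 0))).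
  by apply: measurable_funM => //; apply: measurable_funB; exact: m.
apply: eq_measurable_fun => -[t x] /[!inE]/= -[It Ix].
have GE y : G (t, y) = (F t \_ I) y.
  rewrite /G !patchE; congr (if _ then _ else _).
  by apply/idP/idP; rewrite !inE => //= -[].
by rewrite !GE addr0.
Qed.

Lemma is_derive_patch (F : R -> R) x (d : R) : I x -> is_derive x 1 F d -> is_derive x 1 (F \_ I) d.
Proof.
move=> Ix; apply: is_derive_near.
have oI : open I by exact: interval_open.
have := open_nbhs_nbhs (conj oI Ix); apply: filterS => y Iy.
by rewrite patchE mem_set.
Qed.

(** The defining choice of [wderiv] is made separately for each [t]; a jointly
measurable version is obtained by differentiating twice the primitive, which
does not depend on the representative. *)
Lemma jm_wderiv (u : R -> R -> R) : jm u -> exists2 D, jm D &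
  forall t, I t -> H1 (u t) -> \forall x \ae mu, I x -> D t x = wderiv (u t) x.
Proof.
move=> ju.
pose V t x := dquot (prim (u t) \_ I) x.
have jV : jm V by apply: jm_dquot; exact: jm_prim.
exists (fun t x => dquot (V t \_ I) x); first exact: jm_dquot.
move=> t It hu; have g2 := L2_wderiv hu.
have [c cE] := is_wderiv_ac (H1_L2 hu) (wderivP hu).
pose U x := c + prim (wderiv (u t)) x.
have aU : ac U (wderiv (u t)).
  by split; [exact: L2_itg|move=> x _; rewrite /U prim0 addr0].
have VE x : I x -> V t x = U x.
  move=> Ix; apply: dquotE; apply: is_derive_patch => //.
  have := ac_derive_prim aU Ix; apply: is_derive_near.
  have oI : open I by exact: interval_open.
  have := open_nbhs_nbhs (conj oI Ix); apply: filterS => y /Isub/andP[_ y1].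
  by apply/esym; exact: eq_prim_ae.
have := prim_deriv_ae (L2_itg g2); apply: filterS => x dx Ix.
apply: dquotE.
have d1 : is_derive x 1 U (wderiv (u t) x).
  rewrite -[X in is_derive _ _ _ X]add0r; apply: is_deriveD; last exact: dx.
apply: is_derive_near (is_derive_patch Ix d1).
have H y : (U \_ I) y = (V t \_ I) y; last exact: (filterE _ H).
rewrite !patchE; case: ifPn => // /[!inE] Iy.
by rewrite VE.
Qed.

Lemma ae_eq_within_continuous u w : {within `[0, 1], continuous u} ->
  {within `[0, 1], continuous w} -> (\forall t \ae mu, I t -> u t = w t) ->
  forall t, 0 <= t <= 1 -> u t = w t.
Proof.
move=> cu cw [N [mN N0 HN]] t /[dup] t01 /andP[t0 t1]; apply/eqP; rewrite -subr_eq0.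
apply/negPn/negP => d0.
have cd : {within `[0, 1], continuous (fun t => u t - w t)}.
  by move=> y; apply: cvgB; [exact: cu|exact: cw].
have : (u y - w y) @[y --> within `[0, 1]%classic (nbhs t)] --> u t - w t.
  by move/subspace_continuousP : cd => /(_ t); apply; rewrite /= in_itv.
move/cvgrPdist_lt => /(_ _ (_ : 0 < `|u t - w t|)).
rewrite normr_gt0 => /(_ d0) /nbhs_ballP[e /= e0 He].
pose a := Num.max 0 (t - e); pose b := Num.min 1 (t + e).
have ab : a < b.
  by rewrite /a /b lt_min !gt_max ltr01/= (le_lt_trans t0) ?ltrDl//= ltrBlDr (le_lt_trans t1) ?ltrDl//=; lra.
suff : (0 < mu N)%E by rewrite N0 ltxx.
apply: (@lt_le_trans _ _ (mu `]a, b[%classic)).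
  by rewrite lebesgue_measure_itv/= lte_fin ab -EFinD lte_fin subr_gt0.
apply: le_measure; [by rewrite inE; exact: mR_itv|by rewrite inE|].
move=> y /=; rewrite in_itv/= gt_max lt_min => /andP[/andP[y0 yt] /andP[y1 ty]].
apply: HN => /= /(_ _) H.
have uw : u y = w y by apply: H; rewrite in_itv/= y0.
have := He y; rewrite /ball/= uw subrr subr0 ltxx => F; apply: (notF (F _ _)).
  by rewrite ltr_norml; apply/andP; split; lra.
by rewrite in_itv/= !ltW.
Qed.

Lemma testfun2_tensor (eta psi : R -> R) : testfun eta -> testfun psi ->
  testfun2 (fun t x => eta t * psi x).
Proof.
move=> te tp; split.
- move=> l psi2.
  have [e [p [te' tp' E]]] : exists e p, [/\ testfun e, testfun p &
      psi2 = fun t x => e t * p x].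
    rewrite /psi2 {psi2}; elim: l => [|b l [e [p [te' tp' E]]]]; first by exists eta, psi.
    rewrite /= E; case: b.
      exists e, (derive1 p); split => //; first exact: testfun_derive.
      apply/funext => t; apply/funext => x; rewrite /dx.
      have /D1E -> := D1M (D1_cst (e t)) (testfun_D1 tp').
      by rewrite mul0r add0r.
    exists (derive1 e), p; split => //; first exact: testfun_derive.
    apply/funext => t; apply/funext => x; rewrite /dt.
    have /D1E -> := D1M (testfun_D1 te') (D1_cst (p x)).
    by rewrite mulr0 addr0.
  rewrite E; split.
    move=> t x; split.
      exact: D1_derivable (D1M (testfun_D1 te') (D1_cst (p x))).
    exact: D1_derivable (D1M (D1_cst (e t)) (testfun_D1 tp')).
  move=> q; apply: continuousM.
      apply: (@continuous_comp _ _ _ fst e q); first exact: cvg_fst.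
    exact: (testfun_continuous te').
  apply: (@continuous_comp _ _ _ snd p q); first exact: cvg_snd.
  exact: (testfun_continuous tp').
- have [_ [a1 [b1 [a10 b11 H1]]]] := te; have [_ [a2 [b2 [a20 b21 H2]]]] := tp.
  exists (Num.min a1 a2), (Num.max b1 b2); split.
  + by rewrite lt_min a10.
  + by rewrite gt_max b11.
  + move=> t x H; apply/eqP; rewrite mulf_eq0; apply/norP => -[e0 p0]; apply: H.
    have /andP[? ?] : a1 <= t <= b1 by apply/negPn/negP => /negP /H1 H; rewrite H eqxx in e0.
    have /andP[? ?] : a2 <= x <= b2 by apply/negPn/negP => /negP /H2 H; rewrite H eqxx in p0.
    by split; rewrite ge_min le_max; apply/andP; split; apply/orP; [left|left|right|right].
Qed.

Lemma Hm1_lin (F : (R -> R) -> R) c phi : Hm1 F -> H10 phi -> F (fun x => c * phi x) = c * F phi.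
Proof.
move=> [lin _] hp.
have F0 : F (fun=> 0) = 0.
  have := lin 1 _ _ H10_cst0 H10_cst0; rewrite (_ : (fun x => _) = (fun=> 0)).
    by rewrite mul1r => /eqP; rewrite -subr_eq0 opprD addrA subrr sub0r oppr_eq0 => /eqP.
  by apply/funext => x; rewrite mul1r addr0.
have := lin c _ _ hp H10_cst0; rewrite F0 addr0 => <-.
by congr F; apply/funext => x; rewrite addr0.
Qed.

Lemma continuous_Hm1_eval (F : R -> (R -> R) -> R) psi : continuous_Hm1 F ->
  testfun psi -> {within `[0, 1], continuous (fun t => F t psi)}.
Proof.
move=> [hF cF] tp; have h10 := testfun_H10 tp; have h1 := testfun_H1 tp.
pose k := nrm psi + nrm (wderiv psi) + 1.
have k0 : 0 < k by rewrite /k ltr_wpDl// addr_ge0 ?nrm_ge0.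
pose phi x := k^-1 * psi x.
have tphi : testfun phi by exact: testfunZ.
have phi1 : (sqH1 phi <= 1)%E.
  have e : wderiv phi = (fun x => k^-1 * wderiv psi x) %[ae mu in I].
    have := wderiv_lin k^-1 h1 H1_cst0; rewrite (_ : (fun x => _) = phi); last first.
      by apply/funext => x; rewrite addr0.
    move=> H; apply: filterS2 H wderiv_cst0 => x H H0 Ix.
    by rewrite H// H0// addr0.
  rewrite sqH1E; last exact: testfun_H1.
  rewrite (nrm_ae e) !nrmZ; [|exact: L2_wderiv|exact: H1_L2].
  rewrite gtr0_norm ?invr_gt0// !exprMn -mulrDr lee_fin exprVn ler_pdivrMl ?exprn_gt0// mulr1.
  rewrite /k; have := nrm_ge0 psi; have := nrm_ge0 (wderiv psi).
  by move: (nrm psi) (nrm (wderiv psi)) => x y x0 y0; nra.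
have Fpsi t : 0 <= t <= 1 -> F t psi = k * F t phi.
  move=> t01; rewrite /phi Hm1_lin ?mulrA ?divff ?mul1r ?gt_eqF//.
  by apply: hF; rewrite /= in_itv.
have cphi : {within `[0, 1], continuous (fun t => F t phi)}.
  apply/subspace_continuousP => t /= tI; apply/cvgrPdist_lt => e e0.
  have := cF t tI => /fine_cvgP[fin /cvgrPdist_lt /(_ _ e0)].
  move: fin; apply: filterS2 => t' fin.
  rewrite /= sub0r normrN; apply: le_lt_trans.
  rewrite -lee_fin; apply: (@le_trans _ _ (normHm1 (fun phi => F t' phi - F t phi))); last first.
    by rewrite -[leLHS](fineK fin) lee_fin ler_norm.
  apply: ereal_sup_ubound; exists phi; last by rewrite distrC.
  by split; [exact: testfun_H10|exact: phi1].
apply: (@subspace_eq_continuous _ _ _ (fun t => k * F t phi)).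
  by move=> t; rewrite inE/= in_itv/= => t01; rewrite [RHS]Fpsi.
by move=> t; apply: cvgM; [exact: cvg_cst|exact: cphi].
Qed.

End Continuity.

Section Representation.
Context {R : realType}.
Implicit Types (u w psi : R -> R) (f v z g : R -> R -> R) (t x : R).
Local Notation mu := (@lebesgue_measure R).
Local Notation I := (`]0, 1[%classic : set R).
Local Notation mR := (@measurable _ (measurableTypeR R)).
Hint Resolve mR_itv : core.

(** The time derivative of the pairing of [f t] with [psi], the velocity being
given by its second derivative [g]. *)
Definition flux f z g psi t := \int[mu]_(x in I)
  (z t x * psi x + f t x * (derive1 psi x * prim (mz (g t)) x + psi x * mz (g t) x)).

(** The velocity is represented by its second derivative [g]; the fields are
square integrable at every time, after a modification on a null set of times. *)
Record transported (rho0 rho1 : R -> R) f z g : Prop := Transported {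
  tr_jf : jm f; tr_jz : jm z; tr_jg : jm g;
  tr_f : forall t, I t -> L2 (f t);
  tr_z : forall t, I t -> L2 (z t);
  tr_g : forall t, I t -> L2 (g t);
  tr_nf : L2 (fun t => nrm (f t));
  tr_nz : L2 (fun t => nrm (z t));
  tr_ng : L2 (fun t => nrm (g t));
  tr_ev : \forall t \ae mu, I t -> forall psi, testfun psi ->
    \int[mu]_(x in I) (f t x * psi x) - \int[mu]_(x in I) (rho0 x * psi x) =
    prim (flux f z g psi) t;
  tr_end : forall psi, testfun psi ->
    \int[mu]_(x in I) (rho1 x * psi x) - \int[mu]_(x in I) (rho0 x * psi x) =
    prim (flux f z g psi) 1 }.

Lemma flux_meas f z g psi : jm f -> jm z -> jm g -> testfun psi ->
  measurable_fun I (flux f z g psi).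
Proof.
move=> jf jz jg tp; have mp := testfun_meas (mR_itv `]0, 1[) tp.
have mp' := testfun_meas (mR_itv `]0, 1[) (testfun_derive tp).
have jv1 := jm_mz jg; have jv := jm_prim jv1.
apply: (@jm_int _ (fun t x => z t x * psi x + f t x *
  (derive1 psi x * prim (mz (g t)) x + psi x * mz (g t) x))).
apply: jmD; apply: jmM => //; first exact: (jm_snd mp).
by apply: jmD; apply: jmM => //; [exact: (jm_snd mp')|exact: (jm_snd mp)].
Qed.

Lemma flux_bnd f z g psi C t : L2 (f t) -> L2 (z t) -> L2 (g t) -> testfun psi ->
  0 <= C -> (forall x, `|psi x| <= C) -> (forall x, `|derive1 psi x| <= C) ->
  `|flux f z g psi t| <= C * nrm (z t) + 2 * C * (nrm (f t) * nrm (g t)).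
Proof.
move=> f2 z2 g2 tp C0 b0 b1; have tp' := testfun_derive tp.
have a1 := ac_mz (L2_itg g2); have a0 := ac_prim (L2_itg (ac_L2 a1)).
pose w x := derive1 psi x * prim (mz (g t)) x + psi x * mz (g t) x.
have w2 : L2 w.
  apply: L2D; apply: L2_LinfM; try exact: ac_Linf (testfun_ac _).
    exact: ac_L2 a0.
  exact: ac_L2 a1.
have m1 x : I x -> `|mz (g t) x| <= nrm (g t) by move/Isub; exact: mz_bnd.
have m0 x : I x -> `|prim (mz (g t)) x| <= nrm (g t).
  move/Isub => Ix; apply: le_trans (prim_bnd_nrm (ac_L2 a1) Ix) _.
  exact: nrm_bnd (nrm_ge0 _) (ac_meas a1) m1.
have nw : nrm w <= 2 * C * nrm (g t).
  apply: nrm_bnd (L2_meas w2) _; first by rewrite !mulr_ge0 ?nrm_ge0.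
  move=> x Ix; apply: le_trans (ler_normD _ _) _; rewrite !normrM.
  have -> : 2 * C * nrm (g t) = C * nrm (g t) + C * nrm (g t) by ring.
  by apply: lerD; apply: ler_pM; rewrite ?normr_ge0 ?m0 ?m1 ?b0 ?b1.
have np : nrm psi <= C by apply: nrm_bnd C0 (L2_meas (testfun_L2 tp)) _ => x _.
have -> : flux f z g psi t = dot (z t) psi + dot (f t) w.
  by rewrite /flux !dotE (intD measI (itgM z2 (testfun_L2 tp)) (itgM f2 w2)).
apply: le_trans (ler_normD _ _) _; apply: lerD.
  apply: le_trans (CS z2 (testfun_L2 tp)) _; rewrite mulrC.
  exact: ler_wpM2r (nrm_ge0 _) _ _ np.
apply: le_trans (CS f2 w2) _.
have -> : 2 * C * (nrm (f t) * nrm (g t)) = nrm (f t) * (2 * C * nrm (g t)) by ring.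
exact: ler_wpM2l (nrm_ge0 _) _ _ nw.
Qed.

Lemma testfun_bnd1 psi : testfun psi -> exists C, [/\ 0 <= C, forall x, `|psi x| <= C,
  forall x, `|derive1 psi x| <= C & forall x, `|derive1 (derive1 psi) x| <= C].
Proof.
move=> tp; have [C0 p0 H0] := testfun_bnd tp.
have [C1 p1 H1] := testfun_bnd (testfun_derive tp).
have [C2 p2 H2] := testfun_bnd (testfun_derive (testfun_derive tp)).
exists (C0 + C1 + C2); split; first by rewrite !addr_ge0.
- by move=> x; apply: le_trans (H0 x) _; rewrite -addrA lerDl addr_ge0.
- by move=> x; apply: le_trans (H1 x) _; rewrite addrAC lerDr addr_ge0.
- by move=> x; apply: le_trans (H2 x) _; rewrite lerDr addr_ge0.
Qed.

Lemma sqL2_ge0 u : (0 <= sqL2 u)%E.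
Proof. by apply: integral_ge0 => x _; rewrite lee_fin sqr_ge0. Qed.

Lemma L2_nrm f : jm f -> (forall t, I t -> L2 (f t)) ->
  (\int[mu]_(t in I) sqL2 (f t) < +oo)%E -> L2 (fun t => nrm (f t)).
Proof.
move=> jf f2 fy; apply: L2P; first exact: jm_nrm.
apply: itgP; first by apply: measurable_funX; exact: jm_nrm.
apply: le_lt_trans fy; rewrite le_eqVlt; apply/orP; left; apply/eqP.
apply: eq_integral => t /[!inE] It; rewrite (sqL2E (f2 t It)).
by rewrite ger0_norm// sqr_ge0.
Qed.

Lemma sqH2_ge u : H2 u -> (sqL2 (wderiv (wderiv u)) <= sqH2 u)%E.
Proof.
move=> [h1 h2]; rewrite /sqH2 sqL2E ?(sqL2E (H1_L2 h1)) ?(sqL2E (H1_L2 h2)); last first.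
  exact: L2_wderiv.
by rewrite lee_fin lerDr addr_ge0// sqr_ge0.
Qed.

(** Testing with products [eta t * psi x] turns the weak equation into an
ordinary weak derivative in time for each fixed [psi]; the continuity in
$H^{-1}$ then identifies the constant of integration and makes the exceptional
set of times independent of [psi]. *)
Lemma admissible_transported rho0 rho1 f v z : admissible rho0 rho1 f v z ->
  exists f' z' g, transported rho0 rho1 f' z' g /\
    \forall t \ae mu, I t -> [/\ z' t = z t, H2 (v t), H10 (v t) &
      \forall x \ae mu, I x -> g t x = wderiv (wderiv (v t)) x].
Proof.
move=> [[jf [sf [_ fX]] fy] [jv [sv [_ vX]] vy] [jz [sz [_ zX]] zy] wt [F [cF rF r0 r1]]].
have [D jD DE] := jm_wderiv jv; have [D2 jD2 D2E] := jm_wderiv jD.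
have [N [mN N0 HN]] : \forall t \ae mu, I t ->
    [/\ L2 (f t), L2 (z t), H2 (v t) /\ H10 (v t) & represents (f t) (F t)].
  have H1 : \forall t \ae mu, I t -> L2 (f t) /\ (H2 (v t) /\ H10 (v t)).
    by apply: filterS2 fX vX => t Hf Hv It; split; [exact: (Hf It).1|exact: (Hv It).1].
  have H2 : \forall t \ae mu, I t -> L2 (z t) /\ represents (f t) (F t).
    by apply: filterS2 zX rF => t Hz HF It; split; [exact: (Hz It).1|exact: HF].
  apply: filterS2 H1 H2 => t K1 K2 It.
  by have [? ?] := K1 It; have [? ?] := K2 It; split.
have good t : ~ N t -> I t ->
    [/\ L2 (f t), L2 (z t), H2 (v t) /\ H10 (v t) & represents (f t) (F t)].
  by move=> Nt; apply: contrapT => H; apply: Nt; exact: HN.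
have aeN : \forall t \ae mu, ~ N t.
  by exists N; split => // t /= /contrapT.
(* [k] switches the fields off at the exceptional times. *)
pose k (t : R) : R := \1_(~` N) t.
have mk : measurable_fun I k.
  by apply: measurable_indic; exact: measurableC.
have k1 t : ~ N t -> k t = 1 by move=> Nt; rewrite /k indicE mem_set.
have k0 t : N t -> k t = 0 by move=> Nt; rewrite /k indicE memNset.
pose f' t x := k t * f t x; pose z' t x := k t * z t x; pose g t x := k t * D2 t x.
have jk : jm (fun t _ => k t) by exact: jm_fst.
have jf' : jm f' by exact: jmM.
have jz' : jm z' by exact: jmM.
have jg : jm g by exact: jmM.
have fE t : ~ N t -> f' t = f t by move=> Nt; apply/funext => x; rewrite /f' k1// mul1r.
have zE t : ~ N t -> z' t = z t by move=> Nt; apply/funext => x; rewrite /z' k1// mul1r.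
have gE t : ~ N t -> g t = D2 t by move=> Nt; apply/funext => x; rewrite /g k1// mul1r.
have gW t : ~ N t -> I t -> \forall x \ae mu, I x -> g t x = wderiv (wderiv (v t)) x.
  move=> Nt It; have [_ _ [[h1 h2] _] _] := good t Nt It; rewrite gE//.
  have e : \forall x \ae mu, I x -> wderiv (v t) x = D t x.
    by apply: filterS (DE t It h1) => x H Ix; rewrite H.
  have hD : H1 (D t) by apply: H1_aeq e h2; exact: jm_section.
  apply: filterS2 (D2E t It hD) (wderiv_aeq e h2) => x E1 E2 Ix.
  by rewrite E1// E2.
have zero (w : R -> R -> R) t : N t -> (fun x => k t * w t x) = (fun=> 0).
  by move=> Nt; apply/funext => x; rewrite k0// mul0r.
have f'2 t : I t -> L2 (f' t).
  move=> It; have [Nt|Nt] := pselect (N t); first by rewrite /f' (zero f)//; exact: L2_cst.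
  by rewrite fE//; have [] := good t Nt It.
have z'2 t : I t -> L2 (z' t).
  move=> It; have [Nt|Nt] := pselect (N t); first by rewrite /z' (zero z)//; exact: L2_cst.
  by rewrite zE//; have [] := good t Nt It.
have g2 t : I t -> L2 (g t).
  move=> It; have [Nt|Nt] := pselect (N t); first by rewrite /g (zero D2)//; exact: L2_cst.
  have [_ _ [[h1 h2] _] _] := good t Nt It.
  apply: L2_ae (L2_wderiv h2) (jm_section jg It) _.
  by apply: filterS (gW t Nt It) => x E Ix; rewrite E.
have nf : L2 (fun t => nrm (f' t)).
  apply: (L2_nrm jf' f'2 (le_lt_trans _ fy)).
  apply: ge0_le_integral_ae => [t _|t _|]; try exact: sqL2_ge0.
  by apply: filterS aeN => t Nt It; rewrite fE.
have nz : L2 (fun t => nrm (z' t)).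
  apply: (L2_nrm jz' z'2 (le_lt_trans _ zy)).
  apply: ge0_le_integral_ae => [t _|t _|]; try exact: sqL2_ge0.
  by apply: filterS aeN => t Nt It; rewrite zE.
have ng : L2 (fun t => nrm (g t)).
  apply: (L2_nrm jg g2 (le_lt_trans _ vy)).
  apply: ge0_le_integral_ae => [t _|t _|]; try exact: sqL2_ge0.
    by apply: adde_ge0; [apply: adde_ge0|]; exact: sqL2_ge0.
  apply: filterS aeN => t Nt It; rewrite (sqL2_ae (gW t Nt It)).
  by have [_ _ [h _] _] := good t Nt It; exact: sqH2_ge.
have bI psi : testfun psi -> itg I (flux f' z' g psi).
  move=> tp; have [C [C0 b0 b1 _]] := testfun_bnd1 tp.
  apply: (le_itg measI (flux_meas jf' jz' jg tp) (w := fun t =>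
    C * nrm (z' t) + 2 * C * (nrm (f' t) * nrm (g t)))).
    by move=> t It; apply: flux_bnd => //; [exact: f'2|exact: z'2|exact: g2].
  apply: (itgD measI); apply: (itgZ _ measI); first exact: L2_itg.
  exact: itgM.
have aI psi : testfun psi -> itg I (fun t => dot (f' t) psi).
  move=> tp; have p2 := testfun_L2 tp.
  apply: (le_itg measI (jm_dot jf' (jm_snd (L2_meas p2))) (w := fun t => nrm psi * nrm (f' t))).
    by move=> t It; rewrite [leRHS]mulrC; apply: CS => //; exact: f'2.
  by apply: (itgZ _ measI); exact: L2_itg.
have inner eta psi t : testfun eta -> testfun psi -> ~ N t -> I t ->
    \int[mu]_(x in I) (f t x * (derive1 eta t * psi x)
      + f t x * (eta t * derive1 psi x * v t x + eta t * psi x * wderiv (v t) x)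
      + z t x * (eta t * psi x)) =
    dot (f' t) psi * derive1 eta t + flux f' z' g psi t * eta t.
  move=> te tp Nt It; have [ft zt [h2 h10] _] := good t Nt It.
  have [_ e0 e1] := H2_H10_prim h2 h10.
  have p2 := testfun_L2 tp; have Lp := ac_Linf (testfun_ac tp).
  have Lp' := ac_Linf (testfun_ac (testfun_derive tp)).
  have a1 := ac_mz (L2_itg (g2 t It)); have a0 := ac_prim (L2_itg (ac_L2 a1)).
  have i1 : itg I (fun x => f' t x * psi x) by exact: itgM (f'2 t It) p2.
  have i2 : itg I (fun x => z' t x * psi x +
      f' t x * (derive1 psi x * prim (mz (g t)) x + psi x * mz (g t) x)).
    apply: (itgD measI); first exact: itgM (z'2 t It) p2.
    apply: itgM (f'2 t It) _; apply: L2D; apply: L2_LinfM => //.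
      exact: ac_L2 a0.
    exact: ac_L2 a1.
  have [_ E] := has_intD (has_intZ (derive1 eta t) (has_intI i1))
    (has_intZ (eta t) (has_intI i2)).
  rewrite [dot _ _ * _]mulrC [flux _ _ _ _ _ * _]mulrC.
  rewrite dotE -[RHS]E; apply: eq_Rintegral_ae; apply: filterS2 e0 e1 => x e0 e1 Ix.
  have gWt : \forall x \ae mu, I x -> wderiv (wderiv (v t)) x = g t x.
    by apply: filterS (gW t Nt It) => y Ey Iy; rewrite Ey.
  have [x0 x1] := andP (Isub Ix).
  have M y : y <= 1 -> mz (wderiv (wderiv (v t))) y = mz (g t) y by move=> y1; exact: mz_ae.
  have P : prim (mz (wderiv (wderiv (v t)))) x = prim (mz (g t)) x.
    rewrite !prim_int; apply: eq_Rintegral => y /[!inE] Jy; apply: M.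
    by have /Isub/andP[] := sub0x x1 Jy.
  rewrite (e0 Ix) (e1 Ix) (M x x1) P (fE t Nt) (zE t Nt).
  move: (f t x) (z t x) (mz _ x) (prim _ x) (psi x) (derive1 psi x) (eta t) (derive1 eta t).
  by move=> *; ring.
have evo psi : testfun psi -> forall t, 0 <= t <= 1 ->
    F t psi = \int[mu]_(x in I) (rho0 x * psi x) + prim (flux f' z' g psi) t.
  move=> tp; have [c cE] : exists c, \forall t \ae mu, I t ->
      dot (f' t) psi = c + prim (flux f' z' g psi) t.
    apply: du_bois_reymond; [exact: aI|exact: bI|move=> eta te].
    have te' := testfun_derive te.
    have i1 : itg I (fun t => dot (f' t) psi * derive1 eta t).
      by apply: itgM_Linf (aI psi tp) (ac_Linf (testfun_ac te')).
    have i2 : itg I (fun t => flux f' z' g psi t * eta t).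
      by apply: itgM_Linf (bI psi tp) (ac_Linf (testfun_ac te)).
    apply/eqP; rewrite -subr_eq0 opprK -(intD measI i1 i2); apply/eqP.
    rewrite -[RHS](wt _ (testfun2_tensor te tp)).
    apply: eq_Rintegral_ae; apply: filterS aeN => t Nt It; rewrite -inner//.
    apply: eq_Rintegral => x _; rewrite /dt /dx.
    have /D1E -> := D1M (testfun_D1 te) (D1_cst (psi x)).
    have /D1E -> := D1M (D1_cst (eta t)) (testfun_D1 tp).
    by rewrite mulr0 addr0 mul0r add0r.
  have FE : forall t, 0 <= t <= 1 -> F t psi = c + prim (flux f' z' g psi) t.
    apply: ae_eq_within_continuous; first exact: continuous_Hm1_eval.
      move=> y; apply: cvgD; first exact: cvg_cst.
      exact: (prim_within_continuous (bI psi tp)).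
    apply: filterS2 aeN cE => t Nt ct It; rewrite -ct//.
    by have [_ _ _ ->] := good t Nt It; [rewrite dotE fE|exact: testfun_H10].
  move=> t t01; rewrite FE//; congr (_ + _).
  have := FE 0; rewrite lexx ler01 prim0 addr0 => <- //.
  by apply: r0; exact: testfun_H10.
exists f', z', g; split; last first.
  apply: filterS aeN => t Nt It; have [_ _ [h2 h10] _] := good t Nt It.
  by split; [exact: zE|exact: h2|exact: h10|exact: gW].
split => //.
- apply: filterS aeN => t Nt It psi tp; have [_ _ _ rep] := good t Nt It.
  by rewrite fE// -rep ?evo ?Isub//; [rewrite addrC addKr|exact: testfun_H10].
- move=> psi tp; rewrite -r1; last exact: testfun_H10.
  by rewrite evo ?lexx ?ler01// addrC addKr.
Qed.

End Representation.

(** * Density of test functions *)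

Section Density.
Context {R : realType}.
Implicit Types (u w h : R -> R) (a b c x y : R).
Local Notation mu := (@lebesgue_measure R).
Local Notation I := (`]0, 1[%classic : set R).
Local Notation mR := (@measurable _ (measurableTypeR R)).
Hint Resolve mR_itv : core.

(** The closure of the test functions in $L^2$. *)
Definition apx u := L2 u /\ forall e, 0 < e ->
  exists2 psi, testfun psi & nrm (fun x => u x - psi x) <= e.

Lemma apx_lin u w c : apx u -> apx w -> apx (fun x => c * u x + w x).
Proof.
move=> [u2 ue] [w2 we]; split; first by apply: L2D => //; exact: L2Z.
move=> e e0; have k0 : 0 < 2 * (`|c| + 1) by rewrite mulr_gt0// ltr_wpDl.
have [p tp pe] := ue _ (divr_gt0 e0 k0); have [q tq qe] := we _ (divr_gt0 e0 (ltr0Sn _ 1)).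
exists (fun x => c * p x + q x); first by apply: testfunD => //; exact: testfunZ.
have p2 := testfun_L2 tp; have q2 := testfun_L2 tq.
rewrite (_ : (fun x => _) = (fun x => c * (u x - p x) + (w x - q x))); last first.
  by apply/funext => x; ring.
apply: le_trans (nrmD (L2Z c (L2B u2 p2)) (L2B w2 q2)) _.
rewrite (nrmZ _ (L2B u2 p2)).
have -> : e = (`|c| + 1) * (e / (2 * (`|c| + 1))) + e / 2.
  by rewrite invfM mulrA mulrCA; field; rewrite gt_eqF// ltr_wpDl.
apply: lerD qe; apply: ler_pM; rewrite ?nrm_ge0//.
by rewrite lerDl.
Qed.

Lemma apx_lim (u_ : nat -> R -> R) u : L2 u -> (forall n, apx (u_ n)) ->
  nrm (fun x => u x - u_ n x) @[n --> \oo] --> 0 -> apx u.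
Proof.
move=> u2 au /cvgrPdist_lt cu; split => // e e0.
have e20 : 0 < e / 2 by rewrite divr_gt0.
have [n _ /(_ n (leqnn n)) /=] := cu _ e20; rewrite sub0r normrN ger0_norm ?nrm_ge0// => Hn.
have [un2 /(_ _ e20)[psi tp He]] := au n; exists psi => //.
rewrite (_ : (fun x => _) = (fun x => (u x - u_ n x) + (u_ n x - psi x))); last first.
  by apply/funext => x; ring.
apply: le_trans (nrmD (L2B u2 un2) (L2B un2 (testfun_L2 tp))) _.
by rewrite [leRHS]splitr lerD// ltW.
Qed.

Lemma apx_dct (u_ : nat -> R -> R) u h : L2 h -> measurable_fun I u ->
  (forall x, I x -> `|u x| <= h x) ->
  (forall n, apx (u_ n)) -> (forall x, I x -> u_ n x @[n --> \oo] --> u x) ->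
  (forall n x, I x -> `|u_ n x| <= h x) -> apx u.
Proof.
move=> h2 mu_ u_h au cu uh.
have mu2 n : measurable_fun I (u_ n) by apply: L2_meas; have [] := au n.
have u2 : L2 u.
  by apply: (L2_le mu_ h2) => x Ix; apply: le_trans (u_h x Ix) (ler_norm _).
apply: (apx_lim u2 au).
have : dot (fun x => u x - u_ n x) (fun x => u x - u_ n x) @[n --> \oo] -->
    \int[mu]_(x in I) (fun _ : R => 0 : R) x.
  have -> : (fun n => dot (fun x => u x - u_ n x) (fun x => u x - u_ n x)) =
      (fun n => \int[mu]_(x in I) ((u x - u_ n x) * (u x - u_ n x))).
    by apply/funext => n; rewrite dotE.
  apply: (@dct _ (fun n x => (u x - u_ n x) * (u x - u_ n x)) _ (fun x => 4 * h x ^+ 2)).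
  - by move=> n; apply: measurable_funM; apply: measurable_funB.
  - exact: measurable_cst.
  - move=> x Ix.
    have d : u x - u_ n x @[n --> \oo] --> 0.
      by rewrite -[X in _ --> X](subrr (u x)); apply: cvgB; [exact: cvg_cst|exact: cu].
    by rewrite -[X in _ --> X](mulr0 (0 : R)); exact: (cvgM d d).
  - by apply: (itgZ _ measI); exact: L2_sqr.
  - move=> n x Ix; rewrite normrM -expr2.
    have d : `|u x - u_ n x| <= 2 * h x.
      apply: le_trans (ler_normB _ _) _; rewrite mulr2n mulrDl !mul1r.
      by apply: lerD; [exact: u_h|exact: uh].
    have -> : 4 * h x ^+ 2 = (2 * h x) ^+ 2 by ring.
    by apply: lerXn2r => //; rewrite nnegrE ?normr_ge0// (le_trans _ d).
rewrite int_cstI => H; rewrite -[X in _ --> X]sqrtr0.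
have -> : (fun n => nrm (fun x => u x - u_ n x)) =
    (fun n => Num.sqrt (dot (fun x => u x - u_ n x) (fun x => u x - u_ n x))).
  by apply/funext => n; rewrite nrmE.
exact: (@cvg_comp _ _ _ _ Num.sqrt _ _ _ H (@sqrt_continuous R 0)).
Qed.

Lemma apx_testfun psi : testfun psi -> apx psi.
Proof.
move=> tp; split; first exact: testfun_L2.
move=> e e0; exists psi => //; rewrite (_ : (fun x => _) = (fun=> 0)).
  by rewrite nrm_cst0 ltW.
by apply/funext => x; rewrite subrr.
Qed.

Lemma indic_bnd (A : set R) x : `|(\1_A x : R)| <= 1.
Proof. by rewrite indicE; case: (_ \in _); rewrite ?normr1// normr0. Qed.

Lemma apx_itv a b : 0 < a -> b < 1 -> apx \1_(`]a, b[%classic : set R).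
Proof.
move=> a0 b1; apply: (@apx_dct (plateau a b) _ (fun=> 1) (L2_cst 1)).
- by apply: measurable_indic; exact: mR_itv.
- by move=> x _; exact: indic_bnd.
- by move=> n; apply: apx_testfun; exact: testfun_plateau.
- move=> x _; rewrite indicE.
  have := @plateau_cvg R a b x; case: ifPn => H.
    by rewrite mem_set//= in_itv.
  by rewrite memNset//= in_itv; exact/negP.
- by move=> n x _; have /andP[? ?] := plateau_bnd a b n x; rewrite ger0_norm.
Qed.

Lemma cvg_indic_bigcup (F : nat -> set R) x : nondecreasing_seq F ->
  (\1_(F n) x : R) @[n --> \oo] --> (\1_(\bigcup_n F n) x : R).
Proof.
move=> ndF; apply: cvg_near_cst; have [[k _ Fkx]|H] := pselect ((\bigcup_n F n) x).
  exists k => // n /= kn; rewrite !indicE (mem_set (A := \bigcup_n F n)); last by exists k.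
  by rewrite mem_set//; move: (ndF _ _ kn) => /subsetPset; exact.
by apply: nearW => n; rewrite !indicE !memNset// => Fnx; apply: H; exists n.
Qed.

(** The sets whose indicator lies in the closure form a lambda-system, and it
contains the rays. *)
Lemma apx_indic (A : set R) : mR A -> apx \1_A.
Proof.
suff H : mR `<=` [set A | mR A /\ apx \1_A] by move=> /H[].
move: A => _.
have nd_apx (F : nat -> set R) : nondecreasing_seq F ->
    (forall n, mR (F n) /\ apx \1_(F n)) -> mR (\bigcup_n F n) /\ apx \1_(\bigcup_n F n).
  move=> ndF HF; have mF : mR (\bigcup_n F n).
    by apply: bigcup_measurable => n _; have [] := HF n.
  split => //; apply: (@apx_dct (fun n => \1_(F n)) _ (fun=> 1) (L2_cst 1)).
  - exact: measurable_indic.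
  - by move=> x _; exact: indic_bnd.
  - by move=> n; have [] := HF n.
  - by move=> x _; exact: cvg_indic_bigcup.
  - by move=> n x _; exact: indic_bnd.
have eq_apx (A B : set R) : A `&` I = B `&` I -> apx \1_A -> mR B -> apx \1_B.
  move=> AB aA mB; have AB' x : I x -> \1_A x = \1_B x :> R.
    move=> Ix; rewrite !indicE; congr (nat_of_bool _)%:R; apply: asbool_equiv_eq; split => H.
      by have [] : (B `&` I) x by rewrite -AB; split.
    by have [] : (A `&` I) x by rewrite AB; split.
  have [a2 _] := aA; apply: (@apx_dct (fun=> \1_A) _ (fun=> 1) (L2_cst 1)) => //.
  - by move=> x _; exact: indic_bnd.
  - by move=> x Ix; rewrite AB'//; exact: cvg_cst.
  - by move=> n x _; exact: indic_bnd.
have ray x : apx \1_(`]x, +oo[%classic : set R).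
  pose a n := Num.max x n.+2%:R^-1; pose b n : R := 1 - n.+2%:R^-1.
  have inv_le m n : (m <= n)%N -> n.+2%:R^-1 <= m.+2%:R^-1 :> R.
    by move=> mn; rewrite lef_pV2 ?posrE// ler_nat.
  have ndab : nondecreasing_seq (fun n => `]a n, b n[%classic : set R).
    move=> m n mn; apply/subsetPset => y /=; rewrite !in_itv/= !gt_max.
    move=> /andP[/andP[-> my] yb]; have := inv_le m n mn => mn'.
    by rewrite (le_lt_trans mn' my) (lt_le_trans yb)// /b lerB.
  have [|_ H] := nd_apx _ ndab.
    move=> n; split; first exact: mR_itv.
    apply: apx_itv; first by rewrite lt_max invr_gt0 ltr0Sn orbT.
    by rewrite ltrBlDr ltrDl invr_gt0.
  apply: eq_apx H _; last exact: mR_itv.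
  apply/seteqP; split => y /=.
    by move=> [[n _] /=]; rewrite !in_itv/= gt_max => /andP[/andP[-> _] _].
  rewrite !in_itv/= andbT => -[xy /andP[y0 y1]]; split; last by rewrite y0.
  have inv_cvg : (n.+2%:R^-1 : R) @[n --> \oo] --> 0.
    by have := @cvg_harmonic R; rewrite -(cvg_shiftS (@harmonic R)).
  have N1 : \forall n \near \oo, n.+2%:R^-1 < y.
    by have /cvgrPdist_lt/(_ _ y0) := inv_cvg; apply: filterS => n; rewrite sub0r normrN; apply: le_lt_trans; exact: ler_norm.
  have y10 : 0 < 1 - y by rewrite subr_gt0.
  have N2 : \forall n \near \oo, n.+2%:R^-1 < 1 - y.
    by have /cvgrPdist_lt/(_ _ y10) := inv_cvg; apply: filterS => n; rewrite sub0r normrN; apply: le_lt_trans; exact: ler_norm.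
  have [n _ /(_ n (leqnn n))[h1 h2]] := filterI N1 N2.
  by exists n => //=; rewrite in_itv/= gt_max xy h1 /b/= ltrBrDl -ltrBrDr.
have E : (mR : set (set R)) = <<s @RGenOInfty.G R >> by exact: RGenOInfty.measurableE.
apply: (@subset_trans _ <<s @RGenOInfty.G R >>); first by rewrite E.
apply: lambda_system_subset => //.
- move=> _ _ [x ->] [y ->]; exists (Num.max x y); apply/seteqP; split => t /=.
    by rewrite !in_itv/= !andbT gt_max => -[-> ->].
  by rewrite !in_itv/= !andbT gt_max => /andP[].
- split => //.
  + split; first exact: measurableT.
    apply: (@eq_apx `]0, +oo[%classic) (ray 0) _; last exact: measurableT.
    apply/seteqP; split => y /=; first by move=> [_ ?]; split.
    by rewrite !in_itv/= andbT => -[_ /andP[y0 y1]]; split => //; apply/andP.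
  + move=> A B BA [mA aA] [mB aB]; split; first exact: measurableD.
    rewrite (_ : \1_(A `\` B) = (fun x => -1 * \1_B x + \1_A x)); first exact: apx_lin.
    apply/funext => x; rewrite !indicE in_setD.
    have [xB|xB] := boolP (x \in B); last by rewrite andbT mulr0 add0r.
    by rewrite (_ : x \in A) ?andbF ?mulr1 ?addNr//; apply/mem_set/BA/set_mem.
- by move=> _ [x ->]; split; [exact: mR_itv|exact: ray].
Qed.

Lemma apx_sum n (c : 'I_n -> R) (A : 'I_n -> set R) : (forall i, mR (A i)) ->
  apx (fun x => \sum_(i < n) c i * \1_(A i) x).
Proof.
elim: n c A => [|n IH] c A mA.
  rewrite (_ : (fun x => _) = (fun x => -1 * \1_(set0 : set R) x + \1_(set0 : set R) x)).
    by apply: apx_lin; apply: apx_indic; exact: measurable0.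
  by apply/funext => x; rewrite big_ord0 mulN1r addNr.
rewrite (_ : (fun x => _) = (fun x => c ord_max * \1_(A ord_max) x +
    \sum_(i < n) c (widen_ord (leqnSn n) i) * \1_(A (widen_ord (leqnSn n) i)) x)).
  by apply: apx_lin; [exact: apx_indic|exact: IH].
by apply/funext => x; rewrite big_ord_recr addrC.
Qed.

Import HBNNSimple.

Lemma apx_ge0 u : L2 u -> (forall x, I x -> 0 <= u x) -> apx u.
Proof.
move=> u2 u0; have mu_ := L2_meas u2.
have mf : measurable_fun I (EFin \o u) by exact/measurable_EFinP.
pose g n (x : R) : R := nnsfun_approx measI mf n x.
have f0 x : I x -> (0 <= (EFin \o u) x)%E by move=> Ix; rewrite lee_fin u0.
have gcvg x : I x -> g n x @[n --> \oo] --> u x.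
  by move=> Ix; have /fine_cvg := cvg_nnsfun_approx measI mf f0 Ix.
have g_le n x : I x -> g n x <= u x.
  move=> Ix; have nd : nondecreasing_seq (fun n => g n x).
    by move=> m k mk; have /lefP := nd_nnsfun_approx measI mf mk; exact.
  have <- : lim (g n x @[n --> \oo]) = u x by apply/cvg_lim => //; exact: gcvg.
  by apply: nondecreasing_cvgn_le nd _ n; apply/cvg_ex; exists (u x); exact: gcvg.
apply: (@apx_dct g _ u) => //.
- by move=> x Ix; rewrite ger0_norm ?u0.
- move=> n; have -> : g n = _ := funext (fimfunEord (nnsfun_approx measI mf n)).
  apply: apx_sum => i.
  by apply: measurable_sfunP; exact: measurable_set1.
- by move=> n x Ix; rewrite ger0_norm ?g_le.
Qed.

Lemma apx_L2 u : L2 u -> apx u.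
Proof.
move=> u2; have mu_ := L2_meas u2.
pose p x := Num.max (u x) 0; pose q x := Num.max (- u x) 0.
rewrite (_ : u = (fun x => -1 * q x + p x)); last first.
  by apply/funext => x; rewrite /q /p; case: (ltrP (u x) 0) => ?; case: ltrP => ?; lra.
have m0 : measurable_fun I (fun _ : R => 0 : R) by exact: measurable_cst.
apply: apx_lin; apply: apx_ge0.
- apply: (L2_le _ u2); first by apply: measurable_maxr => //; exact: measurableT_comp.
  by move=> x _; rewrite /q; case: (ltrP (- u x) 0) => ?; rewrite ?normr0// ?normrN.
- by move=> x _; rewrite le_max lexx orbT.
- apply: (L2_le _ u2); first exact: measurable_maxr.
  by move=> x _; rewrite /p; case: (ltrP (u x) 0) => ?; rewrite ?normr0.
- by move=> x _; rewrite le_max lexx orbT.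
Qed.

End Density.

(** * The quadratic functional of the linearised problem *)

Section Quadratic.
Context {R : realType}.
Implicit Types (g h u w : R -> R) (c q t x : R).
Local Notation mu := (@lebesgue_measure R).
Local Notation I := (`]0, 1[%classic : set R).
Local Notation mR := (@measurable _ (measurableTypeR R)).
Hint Resolve mR_itv : core.

(** The function of $H^2 \cap H^1_0$ whose second derivative is [g]. *)
Definition P g := prim (mz g).

Lemma ac_P g : L2 g -> ac (P g) (mz g).
Proof. by move=> g2; apply: ac_prim; apply: L2_itg; apply: ac_L2 (ac_mz (L2_itg g2)). Qed.

Lemma L2_mz g : L2 g -> L2 (mz g).
Proof. by move=> g2; apply: ac_L2 (ac_mz (L2_itg g2)). Qed.

Lemma L2_P g : L2 g -> L2 (P g).
Proof. by move=> g2; apply: ac_L2 (ac_P g2). Qed.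

Lemma P_bnd g x : L2 g -> I x -> `|P g x| <= nrm (mz g).
Proof. by move=> g2 /Isub; apply: prim_bnd_nrm; exact: L2_mz. Qed.

Lemma nrm_mz g : L2 g -> nrm (mz g) <= nrm g.
Proof.
move=> g2; apply: nrm_bnd (nrm_ge0 _) (L2_meas (L2_mz g2)) _ => x /Isub.
exact: mz_bnd.
Qed.

Lemma nrm_P g : L2 g -> nrm (P g) <= nrm g.
Proof.
move=> g2; apply: le_trans _ (nrm_mz g2).
by apply: nrm_bnd (nrm_ge0 _) (L2_meas (L2_P g2)) _ => x; exact: P_bnd.
Qed.

Lemma L2_MP u g : L2 u -> L2 g -> L2 (fun x => u x * P g x).
Proof. by move=> u2 g2; apply: L2M_Linf u2 (ac_Linf (ac_P g2)). Qed.

Lemma nrm_MP u g : L2 u -> L2 g -> nrm (fun x => u x * P g x) <= nrm u * nrm (mz g).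
Proof.
move=> u2 g2; rewrite (_ : (fun x => _) = (fun x => P g x * u x)).
  rewrite mulrC; apply: nrm_Mb (nrm_ge0 _) u2 (L2_meas (L2_P g2)) _ => x.
  exact: P_bnd.
by apply/funext => x; rewrite mulrC.
Qed.

Lemma mz_lin g h c x : L2 g -> L2 h -> x <= 1 ->
  mz (fun y => c * g y + h y) x = c * mz g x + mz h x.
Proof.
move=> g2 h2 x1; have ig := L2_itg g2; have ih := L2_itg h2.
have icg : itg I (fun y => c * g y) by exact: itgZ.
have pE y : y <= 1 -> prim (fun y => c * g y + h y) y = c * prim g y + prim h y.
  by move=> y1; rewrite primD// primZ.
have [_ E] := has_intD (has_intZ c (has_intI (L2_itg (L2_prim ig)))) (has_intI (L2_itg (L2_prim ih))).
rewrite /mz pE// (_ : \int[mu]_(y in I) prim (fun y => c * g y + h y) y =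
  \int[mu]_(y in I) (c * prim g y + prim h y)); last first.
  by apply: eq_Rintegral => y /[!inE] /Isub/andP[_ y1]; exact: pE.
rewrite E; move: (prim g x) (prim h x) (\int[mu]_(y in I) prim g y) (\int[mu]_(y in I) prim h y).
by move=> *; ring.
Qed.

Lemma P_lin g h c x : L2 g -> L2 h -> x <= 1 ->
  P (fun y => c * g y + h y) x = c * P g x + P h x.
Proof.
move=> g2 h2 x1; rewrite /P -(primZ _ (L2_itg (L2_mz g2)) x1).
rewrite -(primD (itgZ _ measI (L2_itg (L2_mz g2))) (L2_itg (L2_mz h2)) x1).
apply: eq_prim_ae => //; apply: aeW => y /Isub/andP[_ y1]; exact: mz_lin.
Qed.

Lemma dot_quad u1 u w c : L2 u -> L2 w -> (forall x, I x -> u1 x = c * u x + w x) ->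
  dot u1 u1 = c ^+ 2 * dot u u + 2 * c * dot u w + dot w w.
Proof.
move=> u2 w2 uE; have cu2 := L2Z c u2; have s2 := L2D cu2 w2.
have -> : dot u1 u1 = dot (fun x => c * u x + w x) (fun x => c * u x + w x).
  by rewrite !dotE; apply: eq_Rintegral => x /[!inE] Ix; rewrite uE.
rewrite (dotDl cu2 w2 s2) (dotDr cu2 w2 cu2) (dotDr cu2 w2 w2).
rewrite (dotZl c u2 cu2) (dotZr c u2 u2) (dotZl c u2 w2) (dotZr c u2 w2) (dotC w u).
move: (dot u u) (dot u w) (dot w w) => a b d; ring.
Qed.

Variables (kappa lambda eps : R).
Hypotheses (k0 : 0 < kappa) (l0 : 0 <= lambda) (e0 : 0 < eps).

(** The velocity part of the cost, as a bilinear form in the second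
derivatives. *)
Definition velform g h := kappa * dot (P g) (P h) + lambda * dot (mz g) (mz h) + eps * dot g h.

Lemma velform_ge0 g : 0 <= velform g g.
Proof. by rewrite /velform !addr_ge0// mulr_ge0// ?dot_ge0// ltW. Qed.

Let lin3 (a b d a1 a2 a3 b1 b2 b3 d1 d2 d3 c : R) :
  a = c ^+ 2 * a1 + 2 * c * a2 + a3 -> b = c ^+ 2 * b1 + 2 * c * b2 + b3 ->
  d = c ^+ 2 * d1 + 2 * c * d2 + d3 ->
  kappa * a + lambda * b + eps * d =
  c ^+ 2 * (kappa * a1 + lambda * b1 + eps * d1) +
  2 * c * (kappa * a2 + lambda * b2 + eps * d2) + (kappa * a3 + lambda * b3 + eps * d3).
Proof. move=> -> -> ->; ring. Qed.

Lemma velform_quad g h c : L2 g -> L2 h ->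
  velform (fun x => c * g x + h x) (fun x => c * g x + h x) =
  c ^+ 2 * velform g g + 2 * c * velform g h + velform h h.
Proof.
move=> g2 h2; apply: lin3.
- by apply: (dot_quad (L2_P g2) (L2_P h2)) => x /Isub/andP[_ x1]; exact: P_lin.
- by apply: (dot_quad (L2_mz g2) (L2_mz h2)) => x /Isub/andP[_ x1]; exact: mz_lin.
- exact: (dot_quad g2 h2).
Qed.

Lemma velformC g h : velform g h = velform h g.
Proof. by rewrite /velform (dotC g) (dotC (P g)) (dotC (mz g)). Qed.

Lemma velform_le g : L2 g -> velform g g <= (kappa + lambda + eps) * nrm g ^+ 2.
Proof.
move=> g2; rewrite /velform -!nrm_sqr !mulrDl.
have sq u : nrm u <= nrm g -> nrm u ^+ 2 <= nrm g ^+ 2.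
  by move=> ug; apply: lerXn2r => //; rewrite nnegrE nrm_ge0.
apply: lerD; last exact: lexx.
by apply: lerD; apply: ler_wpM2l; rewrite ?(ltW k0)//; apply: sq;
  [exact: nrm_P|exact: nrm_mz].
Qed.

Lemma velform_ge g : eps * nrm g ^+ 2 <= velform g g.
Proof. by rewrite /velform -!nrm_sqr lerDr addr_ge0// mulr_ge0// ?sqr_ge0// ltW. Qed.

Variables (theta r : R -> R).
Hypotheses (t2 : L2 theta) (r2 : L2 r).

(** The source which the transport equation forces, to first order in [s] and
after division by [s], when [rho] moves to [rho + s theta] with velocity
[s * P g]. *)
Definition linsource g x := theta x + r x * P g x.

Lemma L2_linsource g : L2 g -> L2 (linsource g).
Proof. by move=> g2; apply: L2D => //; exact: L2_MP. Qed.

Definition lincost g := 2^-1 * (velform g g + dot (linsource g) (linsource g)).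

Lemma lincost_ge0 g : 0 <= lincost g.
Proof. by rewrite /lincost mulr_ge0// addr_ge0// ?dot_ge0// velform_ge0. Qed.

Definition lincost_inf := inf [set lincost g | g in [set g | L2 g]].

Lemma lincost_inf_lb g : L2 g -> lincost_inf <= lincost g.
Proof.
move=> g2; apply: inf_lbound; last by exists g.
by exists 0 => _ [h _ <-]; exact: lincost_ge0.
Qed.

Lemma lincost_inf_glb b : (forall g, L2 g -> b <= lincost g) -> b <= lincost_inf.
Proof.
move=> H; apply: lb_le_inf; last by move=> _ [g g2 <-]; exact: H.
by exists (lincost (fun=> 0)), (fun=> 0) => //; exact: L2_cst.
Qed.

Lemma lincost_inf_ge0 : 0 <= lincost_inf. Proof. by apply: lincost_inf_glb => g _; exact: lincost_ge0. Qed.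

Lemma lincost_inf_approx d : 0 < d -> exists2 g, L2 g & lincost g <= lincost_inf + d.
Proof.
move=> d0; have hi : has_inf [set lincost g | g in [set g | L2 g]].
  split; first by exists (lincost (fun=> 0)), (fun=> 0) => //; exact: L2_cst.
  by exists 0 => _ [h _ <-]; exact: lincost_ge0.
have [_ [g g2 <-] H] := inf_adherent d0 hi.
by exists g => //; exact: ltW.
Qed.

Let D h := velform h h + dot (fun x => r x * P h x) (fun x => r x * P h x).

Lemma lincost_quad g h q : L2 g -> L2 h -> lincost (fun x => q * h x + g x) =
  lincost g + q * (velform g h + dot (linsource g) (fun x => r x * P h x)) + q ^+ 2 * (2^-1 * D h).
Proof.
move=> g2 h2.
have E1 := velform_quad q h2 g2; rewrite [velform h g]velformC in E1.
have E2 : dot (linsource (fun x => q * h x + g x)) (linsource (fun x => q * h x + g x)) =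
    q ^+ 2 * dot (fun x => r x * P h x) (fun x => r x * P h x) +
    2 * q * dot (linsource g) (fun x => r x * P h x) + dot (linsource g) (linsource g).
  rewrite [dot (linsource g) (fun x => _)]dotC.
  apply: (dot_quad (L2_MP r2 h2) (L2_linsource g2)) => x /Isub/andP[_ x1].
  rewrite /linsource (P_lin q h2 g2 x1).
  by move: (P h x) (P g x) (r x) (theta x) => *; ring.
rewrite /lincost /D E1 E2.
move: (velform h h) (velform g h) (velform g g) (dot (linsource g) (linsource g)) (dot (linsource g) _) (dot _ _) => *.
by field.
Qed.

Lemma D_le h : L2 h -> Num.sqrt (2 * D h) <=
  Num.sqrt (2 * (kappa + lambda + eps + nrm r ^+ 2)) * nrm h.
Proof.
move=> h2; set K := 2 * (_ + nrm r ^+ 2).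
have K0 : 0 <= K by rewrite mulr_ge0// !addr_ge0// ?sqr_ge0// ltW.
have -> : Num.sqrt K * nrm h = Num.sqrt (K * nrm h ^+ 2).
  by rewrite (sqrtrM _ K0) sqrtr_sqr (ger0_norm (nrm_ge0 _)).
apply: ler_wsqrtr; rewrite /K -mulrA; apply: ler_wpM2l => //.
rewrite mulrDl; apply: lerD (velform_le h2) _.
rewrite -nrm_sqr -exprMn; apply: lerXn2r; rewrite ?nnegrE ?mulr_ge0 ?nrm_ge0//.
apply: le_trans (nrm_MP r2 h2) _.
exact: ler_wpM2l (nrm_ge0 _) _ _ (nrm_mz h2).
Qed.

(** Perturbing [g] by multiples of [h] cannot lower the cost by more than
[d ^ 2], so the discriminant of the resulting quadratic polynomial bounds the
first variation: an approximate Euler-Lagrange equation. *)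
Lemma near_minimiser g h d : 0 <= d -> L2 g -> L2 h -> lincost g <= lincost_inf + d ^+ 2 ->
  `|velform g h + dot (linsource g) (fun x => r x * P h x)| <= d * Num.sqrt (2 * D h).
Proof.
move=> d0 g2 h2 Jg; have rh2 := L2_MP r2 h2; have Z2 := L2_linsource g2.
set C := velform g h + _.
have D0 : 0 <= D h by rewrite /D addr_ge0// ?velform_ge0// dot_ge0.
have H q : 0 <= d ^+ 2 - 2 * q * (2^-1 * C) + q ^+ 2 * (2^-1 * D h).
  have := lincost_inf_lb (L2D (L2Z (- q) h2) g2); rewrite (lincost_quad _ g2 h2) sqrrN.
  have -> : 2 * q * (2^-1 * C) = q * C by field.
  move: Jg; move: (lincost g) lincost_inf (d ^+ 2) (q ^+ 2 * _) => a b e p.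
  by rewrite mulNr; move: (q * C) => c; lra.
have i20 : 0 <= 2^-1 :> R by [].
have := quad_discr (sqr_ge0 d) (mulr_ge0 i20 D0) H.
rewrite sqrtr_sqr (ger0_norm d0) normrM (ger0_norm i20) -(ler_pM2l (ltr0Sn R 1)) mulrA.
rewrite divff ?pnatr_eq0// mul1r => /le_trans; apply.
have -> : 2 * (d * Num.sqrt (2^-1 * D h)) = d * (2 * Num.sqrt (2^-1 * D h)) by ring.
apply: ler_wpM2l => //.
have -> : Num.sqrt (2 * D h) = Num.sqrt (2 ^+ 2 * (2^-1 * D h)) by congr Num.sqrt; field.
by rewrite (sqrtrM _ (sqr_ge0 _)) sqrtr_sqr (ger0_norm (ler0n _ 2)).
Qed.

End Quadratic.

(** * Lower bound *)

Section LowerBound.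
Context {R : realType}.
Implicit Types (g h u w z psi : R -> R) (c q t x s d : R).
Local Notation mu := (@lebesgue_measure R).
Local Notation I := (`]0, 1[%classic : set R).
Local Notation mR := (@measurable _ (measurableTypeR R)).
Hint Resolve mR_itv : core.

Variables (kappa lambda eps : R).
Hypotheses (k0 : 0 < kappa) (l0 : 0 <= lambda) (e0 : 0 < eps).
Variables (theta rho r : R -> R).
Hypotheses (t2 : L2 theta) (r2 : L2 r) (arho : ac rho r).

Local Notation velform := (velform kappa lambda eps).
Local Notation linsource := (linsource theta r).
Local Notation lincost := (lincost kappa lambda eps theta r).
Local Notation L := (lincost_inf kappa lambda eps theta r).
Let K2 := Num.sqrt (2 * (kappa + lambda + eps + nrm r ^+ 2)).

Let K2_ge0 : 0 <= K2. Proof. exact: sqrtr_ge0. Qed.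

(** [action] is the time integral of this quantity. *)
Definition energy g z := 2^-1 * (velform g g + dot z z).

(** A convex quadratic function lies above its tangent, here taken at [s] times
the reference pair [(g0, linsource g0)]. *)
Lemma energy_tangent g0 g z s : L2 g0 -> L2 g -> L2 z ->
  s * (velform g0 g + dot (linsource g0) z) - s ^+ 2 * lincost g0 <= energy g z.
Proof.
move=> g02 g2 z2; have Z2 := L2_linsource t2 r2 g02.
have B0 := velform_ge0 k0 l0 e0 (fun x => - s * g0 x + g x).
have D0 := dot_ge0 (fun x => - s * linsource g0 x + z x).
rewrite (velform_quad _ _ _ (- s) g02 g2) in B0.
rewrite (dot_quad Z2 z2 (fun x _ => erefl)) in D0.
rewrite /energy /lincost; move: B0 D0.
move: (velform g0 g0) (velform g0 g) (velform g g) (dot (linsource g0) (linsource g0)) (dot (linsource g0) z) (dot z z).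
by move=> a b c a' b' c'; rewrite sqrrN; nra.
Qed.

(** The approximate Euler-Lagrange equation trades the velocity terms of the
tangent for a pairing with [z - r P g], the quantity whose time integral the
transport equation determines to first order. *)
Lemma energy_lower g0 g z psi s d d' : L2 g0 -> L2 g -> L2 z -> L2 psi -> 0 <= d ->
  lincost g0 <= L + d ^+ 2 -> nrm (fun x => linsource g0 x - psi x) <= d' ->
  s * dot (fun x => z x - r x * P g x) psi
    - `|s| * (d' * (nrm z + nrm r * nrm g) + d * (K2 * nrm g)) - s ^+ 2 * lincost g0
  <= energy g z.
Proof.
move=> g02 g2 z2 p2 d0 Jg0 Zp; have Z2 := L2_linsource t2 r2 g02.
have Pg2 := L2_MP r2 g2; have w2 := L2B z2 Pg2.
apply: le_trans (energy_tangent s g02 g2 z2); rewrite lerB//.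
have N := near_minimiser k0 l0 e0 t2 r2 d0 g02 g2 Jg0.
have {}N : `|velform g0 g + dot (linsource g0) (fun x => r x * P g x)| <= d * (K2 * nrm g).
  apply: le_trans N _; apply: ler_wpM2l => //; exact: D_le.
have M : `|dot (fun x => linsource g0 x - psi x) (fun x => z x - r x * P g x)| <=
    d' * (nrm z + nrm r * nrm g).
  apply: le_trans (CS (L2B Z2 p2) w2) _; apply: ler_pM => //; rewrite ?nrm_ge0//.
  apply: le_trans (nrmB z2 Pg2) _; rewrite lerD2l.
  apply: le_trans (nrm_MP r2 g2) _; apply: ler_wpM2l (nrm_ge0 _) _ _ _.
  exact: nrm_mz.
move: M; rewrite (dotBl Z2 p2 w2) (dotBr z2 Pg2 Z2) (dotC psi) => M.
move: N M; move: (velform g0 g) (dot (linsource g0) z) (dot (linsource g0) _) (dot _ psi) (d' * _) (d * _).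
move=> a b c e p q.
rewrite !ler_norml => /andP[N1 N2] /andP[M1 M2].
have lo : 0 <= a + b - e + (p + q) by lra.
have hi : 0 <= e + (p + q) - (a + b) by lra.
rewrite -subr_ge0; have [s0|s0] := leP 0 s.
  by rewrite (ger0_norm s0) (_ : _ - _ = s * (a + b - e + (p + q))) ?mulr_ge0//; ring.
have s1 : 0 <= - s by rewrite oppr_ge0 ltW.
have := mulr_ge0 s1 hi; rewrite (ltr0_norm s0); congr (_ <= _); ring.
Qed.

Section Transported.
Variables (rho1 : R -> R) (f z g : R -> R -> R).
Hypothesis tr : transported rho rho1 f z g.

Let en t := energy (g t) (z t).

Let g2 t : I t -> L2 (g t). Proof. exact: (tr_g tr). Qed.
Let z2 t : I t -> L2 (z t). Proof. exact: (tr_z tr). Qed.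

Lemma energy_itg : itg I en.
Proof.
have jg := tr_jg tr; have jz := tr_jz tr; have j1 := jm_mz jg; have j0 := jm_prim j1.
pose K := kappa + lambda + eps.
apply: (le_itg measI (w := fun t => K * nrm (g t) ^+ 2 + nrm (z t) ^+ 2)).
- apply: measurable_funM => //; apply: measurable_funD; last exact: jm_dot.
  apply: measurable_funD; [apply: measurable_funD|];
    apply: measurable_funM => //; exact: jm_dot.
- move=> t It; rewrite ger0_norm; last first.
    by rewrite /en /energy mulr_ge0// addr_ge0 ?dot_ge0// velform_ge0.
  have := velform_le eps k0 l0 (g2 It); have := velform_ge0 k0 l0 e0 (g t); have := dot_ge0 (z t).
  rewrite /en /energy -nrm_sqr -/K.
  by move: (velform (g t) (g t)) (nrm (z t) ^+ 2) (K * _) => a b c *; lra.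
- apply: (itgD measI); last exact: (L2_sqr (tr_nz tr)).
  by apply: (itgZ _ measI); exact: (L2_sqr (tr_ng tr)).
Qed.

Let E := \int[mu]_(t in I) en t.

Lemma int_nrm_g : \int[mu]_(t in I) nrm (g t) <= Num.sqrt (2 * E / eps).
Proof.
have ng := tr_ng tr.
apply: le_trans (_ : _ <= nrm (fun t => nrm (g t))) _.
  apply: le_trans _ (int_abs_le ng).
  apply: (le_int measI (L2_itg ng) (itg_abs measI (L2_itg ng))) => t _.
  exact: ler_norm.
rewrite nrmE; apply: ler_wsqrtr; rewrite dotE ler_pdivlMr// mulrC.
rewrite -(intZ _ measI (itgM ng ng)) -(intZ _ measI energy_itg).
apply: (le_int measI (itgZ _ measI (itgM ng ng)) (itgZ _ measI energy_itg)) => t It.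
have := velform_ge eps k0 l0 (g t); have := dot_ge0 (z t).
rewrite -expr2 /en /energy.
by move: (velform _ _) (dot _ _) (eps * _) => a b c *; lra.
Qed.

Lemma int_nrm_z : \int[mu]_(t in I) nrm (z t) <= Num.sqrt (2 * E).
Proof.
have nz := tr_nz tr.
apply: le_trans (_ : _ <= nrm (fun t => nrm (z t))) _.
  apply: le_trans _ (int_abs_le nz).
  apply: (le_int measI (L2_itg nz) (itg_abs measI (L2_itg nz))) => t _.
  exact: ler_norm.
rewrite nrmE; apply: ler_wsqrtr; rewrite dotE.
rewrite -(intZ _ measI energy_itg).
apply: (le_int measI (itgM nz nz) (itgZ _ measI energy_itg)) => t It.
have := velform_ge0 k0 l0 e0 (g t).
rewrite -expr2 nrm_sqr /en /energy.
by move: (velform _ _) (dot _ _) => a b *; lra.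
Qed.

Let sg := \int[mu]_(t in I) nrm (z t).
Let be := \int[mu]_(t in I) nrm (g t).

Lemma int_energy_lower g0 psi s d d' : L2 g0 -> testfun psi -> 0 <= d ->
  lincost g0 <= L + d ^+ 2 -> nrm (fun x => linsource g0 x - psi x) <= d' ->
  s * \int[mu]_(t in I) dot (fun x => z t x - r x * P (g t) x) psi
    - `|s| * (d' * (sg + nrm r * be) + d * (K2 * be)) - s ^+ 2 * lincost g0 <= E.
Proof.
move=> g02 tp d0 Jg0 Zp; have p2 := testfun_L2 tp.
have inz := L2_itg (tr_nz tr); have ing := L2_itg (tr_ng tr).
have iR : itg I (fun t => dot (fun x => z t x - r x * P (g t) x) psi).
  apply: (le_itg measI (w := fun t => (nrm (z t) + nrm r * nrm (g t)) * nrm psi)).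
  - apply: jm_dot (jm_snd (L2_meas p2)); apply: jmB; first exact: (tr_jz tr).
    apply: jmM (jm_snd (L2_meas r2)) _; apply: jm_prim; apply: jm_mz; exact: (tr_jg tr).
  - move=> t It; have Pg2 := L2_MP r2 (g2 It).
    apply: le_trans (CS (L2B (z2 It) Pg2) p2) _; apply: ler_wpM2r (nrm_ge0 _) _ _ _.
    apply: le_trans (nrmB (z2 It) Pg2) _; rewrite lerD2l.
    apply: le_trans (nrm_MP r2 (g2 It)) _; apply: ler_wpM2l (nrm_ge0 _) _ _ _.
    exact: nrm_mz (g2 It).
  - rewrite (_ : (fun t => _) = (fun t => nrm psi * (nrm (z t) + nrm r * nrm (g t)))).
      by apply: (itgZ _ measI); apply: (itgD measI inz); apply: (itgZ _ measI).
    by apply/funext => t; rewrite mulrC.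
have H := has_intD (has_intZ s (has_intI iR)) (has_intD
  (has_intZ (- (`|s| * d')) (has_intI inz)) (has_intD
  (has_intZ (- (`|s| * (d' * nrm r + d * K2))) (has_intI ing))
  (has_intI (itg_cstI (- (s ^+ 2 * lincost g0)))))).
have [iH EH] := H; rewrite int_cstI in EH.
rewrite (_ : _ - _ - _ = \int[mu]_(x in I) (s * dot (fun x0 => z x x0 - r x0 * P (g x) x0) psi +
   (- (`|s| * d') * nrm (z x) + (- (`|s| * (d' * nrm r + d * K2)) * nrm (g x) +
   - (s ^+ 2 * lincost g0))))); last first.
  by rewrite EH -/sg -/be; ring.
apply: (le_int measI iH energy_itg) => t It.
apply: le_trans (energy_lower s g02 (g2 It) (z2 It) p2 d0 Jg0 Zp).
by rewrite le_eqVlt; apply/orP; left; apply/eqP; rewrite -/K2; ring.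
Qed.

End Transported.

(** If the energy exceeds [s ^ 2 * L] there is nothing to prove; otherwise the
integrals of [nrm z] and [nrm g] are of order [s], and
[transport_linearization] evaluates the tangent up to a multiple of [|s| ^ 3]. *)
Lemma int_energy_quotient eta : 0 < eta -> exists2 s0, 0 < s0 & forall s (f z g : R -> R -> R), `|s| < s0 ->
  transported rho (fun x => rho x + s * theta x) f z g ->
  s ^+ 2 * (L - eta) <= \int[mu]_(t in I) energy (g t) (z t).
Proof.
move=> eta0; have L0 : 0 <= L by exact: lincost_inf_ge0.
have e3 : 0 < eta / 3 by rewrite divr_gt0.
(* [K |s|] bounds the time integrals of [nrm z] and [nrm g] when the energy is
at most [s ^ 2 * L], and [K3] bounds [nrm g0]. *)
pose K := Num.sqrt (2 * L) + Num.sqrt (2 * L / eps).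
have K0 : 0 <= K by rewrite addr_ge0// sqrtr_ge0.
pose K3 := Num.sqrt (2 * (L + 1) / eps).
have K30 : 0 <= K3 by exact: sqrtr_ge0.
pose a1 := K2 * (K3 + K) + 1; pose a2 := nrm theta + (K + nrm r * K) + 1.
have a10 : 0 < a1 by rewrite ltr_wpDl// mulr_ge0// addr_ge0.
have a20 : 0 < a2 by rewrite ltr_wpDl// !addr_ge0 ?nrm_ge0// mulr_ge0 ?nrm_ge0.
pose d := Num.min 1 (eta / 3 / a1); pose d' := eta / 3 / a2.
have d0 : 0 < d by rewrite lt_min ltr01 divr_gt0.
have d1 : d <= 1 by rewrite ge_min lexx.
have d'0 : 0 < d' by rewrite divr_gt0.
have da1 : d * (K2 * (K3 + K)) <= eta / 3.
  apply: le_trans (_ : d * a1 <= _); first by apply: ler_wpM2l; rewrite ?(ltW d0)// lerDl.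
  by rewrite -ler_pdivlMr// ge_min lexx orbT.
have da2 : d' * (nrm theta + (K + nrm r * K)) <= eta / 3.
  apply: le_trans (_ : d' * a2 <= _); first by apply: ler_wpM2l; rewrite ?(ltW d'0)// lerDl.
  by rewrite /d' divfK// gt_eqF.
have [g0 g02 Jg0] : exists2 g, L2 g & lincost g <= L + d ^+ 2.
  by apply: lincost_inf_approx => //; exact: exprn_gt0.
have Z2 := L2_linsource t2 r2 g02.
have [_ /(_ d' d'0)[psi tp Zp]] := apx_L2 Z2.
have p2 := testfun_L2 tp.
have ng0 : nrm g0 <= K3.
  rewrite -(ger0_norm (nrm_ge0 g0)) -sqrtr_sqr; apply: ler_wsqrtr.
  rewrite ler_pdivlMr// mulrC.
  have := velform_ge eps k0 l0 g0; have := dot_ge0 (linsource g0).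
  have d2 : d ^+ 2 <= 1 by rewrite expr_le1// ltW.
  move: Jg0 d2; rewrite /lincost; move: L (d ^+ 2) (velform _ _) (dot _ _) (eps * _) => a b c e h.
  by move=> *; lra.
have tZ : 2 * lincost g0 - d * (K2 * K3) - d' * nrm theta <= dot theta psi.
  have Pg2 := L2_MP r2 g02.
  have N := near_minimiser k0 l0 e0 t2 r2 (ltW d0) g02 g02 Jg0.
  have {}N : `|velform g0 g0 + dot (linsource g0) (fun x => r x * P g0 x)| <= d * (K2 * K3).
    apply: le_trans N _; apply: ler_wpM2l (ltW d0) _ _ _.
    apply: le_trans (D_le k0 l0 e0 r2 g02) _.
    exact: ler_wpM2l K2_ge0 _ _ ng0.
  have M : `|dot (fun x => linsource g0 x - psi x) theta| <= d' * nrm theta.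
    apply: le_trans (CS (L2B Z2 p2) t2) _; exact: ler_wpM2r (nrm_ge0 _) _ _ Zp.
  have E : dot (linsource g0) (linsource g0) = dot (linsource g0) theta + dot (linsource g0) (fun x => r x * P g0 x).
    by rewrite -(dotDr t2 Pg2 Z2).
  rewrite (dotBl Z2 p2 t2) in M; rewrite (dotC theta) /lincost.
  move: N M E; rewrite !ler_norml => /andP[N1 N2] /andP[M1 M2].
  move: (dot (linsource g0) (linsource g0)) (velform _ _) (dot (linsource g0) theta) (dot (linsource g0) _) (dot psi theta) N1 N2 M1 M2.
  by move=> a b c e h *; lra.
have [C [C0 b0 b1 b2]] := testfun_bnd1 tp.
pose C1 := 16 * C * (K + 2 * nrm rho * K) * K.
have C10 : 0 <= C1.
  by rewrite /C1 !mulr_ge0// addr_ge0// !mulr_ge0 ?nrm_ge0.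
exists (Num.min (eta / 3 / (C1 + 1)) (10 * (K + 1))^-1).
  by rewrite lt_min divr_gt0 ?invr_gt0 ?mulr_gt0// ltr_wpDl.
move=> s f z g; rewrite lt_min => /andP[s1 s2] tr.
set E := \int[mu]_(t in I) _.
have [EL|EL] := leP (s ^+ 2 * L) E.
  apply: le_trans EL; apply: ler_wpM2l (sqr_ge0 _) _ _ _.
  by rewrite gerBl ltW.
have Ele : E <= s ^+ 2 * L by exact: ltW.
have sqs c : 0 <= c -> Num.sqrt (s ^+ 2 * c) = `|s| * Num.sqrt c.
  by move=> c0; rewrite (sqrtrM _ (sqr_ge0 _)) sqrtr_sqr.
set sg := \int[mu]_(t in I) nrm (z t); set be := \int[mu]_(t in I) nrm (g t).
have sgK : sg <= K * `|s|.
  apply: le_trans (int_nrm_z tr) _.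
  apply: (@le_trans _ _ (Num.sqrt (s ^+ 2 * (2 * L)))).
    by apply: ler_wsqrtr; rewrite -/E mulrCA ler_wpM2l.
  rewrite sqs ?mulr_ge0// mulrC; apply: ler_wpM2r => //.
  by rewrite lerDl sqrtr_ge0.
have beK : be <= K * `|s|.
  apply: le_trans (int_nrm_g tr) _.
  apply: (@le_trans _ _ (Num.sqrt (s ^+ 2 * (2 * L / eps)))).
    apply: ler_wsqrtr; rewrite -/E mulrA ler_wpM2r ?invr_ge0 ?(ltW e0)//.
    by rewrite mulrCA ler_wpM2l.
  rewrite sqs; last by rewrite !mulr_ge0// invr_ge0 ltW.
  rewrite mulrC; apply: ler_wpM2r => //.
  by rewrite lerDr sqrtr_ge0.
have sg0 : 0 <= sg by apply: Rintegral_ge0 => t _; exact: nrm_ge0.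
have be0 : 0 <= be by apply: Rintegral_ge0 => t _; exact: nrm_ge0.
have be1 : 10 * be <= 1.
  apply: le_trans (_ : 10 * ((K + 1) * `|s|) <= 1).
    apply: ler_wpM2l => //; apply: le_trans beK _; apply: ler_wpM2r => //.
    by rewrite lerDl.
  have K10 : 0 < 10 * (K + 1) by rewrite mulr_gt0// ltr_wpDl.
  by rewrite mulrA -(ler_pdivlMl _ _ K10) mulr1 ltW.
pose R1 := \int[mu]_(t in I) dot (fun x => z t x - r x * P (g t) x) psi.
have lin : `|s * dot theta psi - R1| <= C1 * s ^+ 2.
  have := transport_linearization (tr_jf tr) (tr_jz tr) (tr_jg tr) (tr_f tr) (tr_z tr)
    (tr_g tr) (tr_nf tr) (tr_nz tr) (tr_ng tr) arho r2 (tr_ev tr) be1 tp C0 b0 b1 b2.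
  rewrite -/(flux f z g psi) -(tr_end tr tp) -/R1 -/sg -/be.
  have rp2 := ac_L2 arho.
  have -> : \int[mu]_(x in I) ((rho x + s * theta x) * psi x) - \int[mu]_(x in I) (rho x * psi x)
      = s * dot theta psi.
    rewrite -!dotE (dotDl rp2 (L2Z s t2) p2) (dotZl s t2 p2); ring.
  move/le_trans; apply.
  have -> : C1 * s ^+ 2 = 16 * C * (K * `|s| + 2 * nrm rho * (K * `|s|)) * (K * `|s|).
    by rewrite -(real_normK (num_real s)) /C1; ring.
  apply: ler_pM (beK) => //.
    by rewrite !mulr_ge0// addr_ge0// !mulr_ge0 ?nrm_ge0.
  apply: ler_wpM2l; first by rewrite mulr_ge0.
  by apply: lerD (sgK) _; apply: ler_wpM2l; rewrite ?mulr_ge0 ?nrm_ge0.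
have main := int_energy_lower tr s g02 tp (ltW d0) Jg0 Zp.
rewrite -/R1 -/sg -/be -/E in main.
have a0 : 0 <= `|s| by [].
have sa : s ^+ 2 = `|s| * `|s| by rewrite -expr2 real_normK// num_real.
have sR : s ^+ 2 * dot theta psi - s ^+ 2 * (C1 * `|s|) <= s * R1.
  have : s * (s * dot theta psi - R1) <= `|s| * (C1 * s ^+ 2).
    by apply: le_trans (ler_norm _) _; rewrite normrM; exact: ler_wpM2l.
  by rewrite mulrBr mulrA -expr2 [`|s| * _]mulrCA [`|s| * _]mulrC mulrCA; lra.
have err : `|s| * (d' * (sg + nrm r * be) + d * (K2 * be)) <=
    s ^+ 2 * (d' * (K + nrm r * K) + d * (K2 * K)).
  have -> : s ^+ 2 * (d' * (K + nrm r * K) + d * (K2 * K)) =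
      `|s| * (d' * (K * `|s| + nrm r * (K * `|s|)) + d * (K2 * (K * `|s|))).
    by rewrite sa; ring.
  apply: ler_wpM2l => //; apply: lerD; apply: ler_wpM2l; rewrite ?(ltW d0) ?(ltW d'0)//.
    by apply: lerD (sgK) _; apply: ler_wpM2l (nrm_ge0 _) _ _ _.
  exact: ler_wpM2l.
have Ca : C1 * `|s| <= eta / 3.
  apply: le_trans (_ : (C1 + 1) * `|s| <= _); first by apply: ler_wpM2r => //; rewrite lerDl.
  by rewrite mulrC -ler_pdivlMr ?ltW// ltr_wpDl.
have JL : L <= lincost g0 by exact: lincost_inf_lb.
apply: le_trans main.
apply: (@le_trans _ _ (s ^+ 2 * dot theta psi - s ^+ 2 * (C1 * `|s|)
    - s ^+ 2 * (d' * (K + nrm r * K) + d * (K2 * K)) - s ^+ 2 * lincost g0)).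
  rewrite -!mulrBr; apply: ler_wpM2l (sqr_ge0 _) _ _ _.
  move: tZ da1 da2 Ca JL; rewrite !mulrDr.
  move: (dot theta psi) (d * (K2 * K3)) (d * (K2 * K)) (d' * nrm theta) (d' * K).
  move: (d' * (nrm r * K)) (C1 * `|s|) L (lincost g0) => *; lra.
by apply: lerB; [apply: lerB|].
Qed.

End LowerBound.

(** * The action as a time integral *)

Section Action.
Context {R : realType}.
Implicit Types (g h u w psi : R -> R) (f v z : R -> R -> R) (c q t x s d : R).
Local Notation mu := (@lebesgue_measure R).
Local Notation I := (`]0, 1[%classic : set R).
Local Notation mR := (@measurable _ (measurableTypeR R)).
Hint Resolve mR_itv : core.

Lemma P_mz_ae g h x : x <= 1 -> (\forall y \ae mu, I y -> g y = h y) -> P g x = P h x.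
Proof.
move=> x1 gh; apply: eq_prim_ae => //; apply: aeW => y /Isub/andP[_ y1].
exact: mz_ae.
Qed.

Lemma action_energy kappa lambda eps v z (z' g : R -> R -> R) :
  (forall t, I t -> L2 (g t)) -> (forall t, I t -> L2 (z' t)) ->
  itg I (fun t => energy kappa lambda eps (g t) (z' t)) ->
  (\forall t \ae mu, I t -> [/\ z' t = z t, H2 (v t), H10 (v t) &
      \forall x \ae mu, I x -> g t x = wderiv (wderiv (v t)) x]) ->
  action kappa lambda eps v z =
    (\int[mu]_(t in I) energy kappa lambda eps (g t) (z' t))%:E.
Proof.
move=> g2 z2 ien H; rewrite /action.
have -> : (\int[mu]_(t in I) \int[mu]_(x in I)
     (kappa * v t x ^+ 2 + lambda * wderiv (v t) x ^+ 2
      + eps * wderiv (wderiv (v t)) x ^+ 2 + z t x ^+ 2)%:E =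
    \int[mu]_(t in I) (2 * energy kappa lambda eps (g t) (z' t))%:E)%E.
  apply: eq_integral_ae; apply: filterS H => t Ht It.
  have [zE h2 h10 gE] := Ht It; have [_ e0 e1] := H2_H10_prim h2 h10.
  have gt := g2 t It; have zt := z2 t It.
  have gE' : \forall x \ae mu, I x -> wderiv (wderiv (v t)) x = g t x.
    by apply: filterS gE => x E Ix; rewrite E.
  have i1 := itgM (L2_P gt) (L2_P gt); have i2 := itgM (L2_mz gt) (L2_mz gt).
  have i3 := itgM gt gt; have i4 := itgM zt zt.
  have [iH EH] := has_intD (has_intZ kappa (has_intI i1)) (has_intD (has_intZ lambda (has_intI i2))
    (has_intD (has_intZ eps (has_intI i3)) (has_intI i4))).
  rewrite (_ : 2 * energy kappa lambda eps (g t) (z' t) =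
    \int[mu]_(x in I) (kappa * (P (g t) x * P (g t) x) +
   (lambda * (mz (g t) x * mz (g t) x) +
    (eps * (g t x * g t x) + z' t x * z' t x)))); last first.
    rewrite EH /energy /velform !dotE; move: (\int[mu]_(x in I) _) (\int[mu]_(x in I) _).
    move: (\int[mu]_(x in I) _) (\int[mu]_(x in I) _) => a b c d.
    by rewrite mulrA divff ?pnatr_eq0// mul1r !addrA.
  rewrite -(intE iH measI); apply: eq_integral_ae.
  have m1 x : I x -> mz (wderiv (wderiv (v t))) x = mz (g t) x.
    by move=> /Isub/andP[_ x1]; exact: mz_ae.
  have m0 x : I x -> prim (mz (wderiv (wderiv (v t)))) x = P (g t) x.
    by move=> /Isub/andP[_ x1]; exact: P_mz_ae.
  have E01 : \forall x \ae mu, I x -> v t x = P (g t) x /\ wderiv (v t) x = mz (g t) x.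
    by apply: filterS2 e0 e1 => x E0 E1 Ix; rewrite E0// E1// m0// m1.
  apply: filterS2 E01 gE' => x E E2 Ix; have [-> ->] := E Ix.
  by rewrite (E2 Ix) zE !addrA !expr2.
rewrite (intE (itgZ 2 measI ien) measI) (intZ 2 measI ien) -EFinM mulrA.
by rewrite mulVf ?pnatr_eq0// mul1r.
Qed.

Lemma transported_aeq rho0 rho0' rho1 rho1' f z (g : R -> R -> R) :
  (\forall x \ae mu, I x -> rho0 x = rho0' x) ->
  (\forall x \ae mu, I x -> rho1 x = rho1' x) ->
  transported rho0 rho1 f z g -> transported rho0' rho1' f z g.
Proof.
move=> e0 e1 [jf jz jg f2 z2 g2 nf nz ng ev en].
have E0 psi : \int[mu]_(x in I) (rho0' x * psi x) = \int[mu]_(x in I) (rho0 x * psi x).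
  by apply: eq_Rintegral_ae; apply: filterS e0 => x E Ix; rewrite E.
have E1 psi : \int[mu]_(x in I) (rho1' x * psi x) = \int[mu]_(x in I) (rho1 x * psi x).
  by apply: eq_Rintegral_ae; apply: filterS e1 => x E Ix; rewrite E.
split => //.
- by apply: filterS ev => t H It psi tp; rewrite E0; exact: H.
- by move=> psi tp; rewrite E0 E1; exact: en.
Qed.

Lemma H1_ac u : H1 u -> exists2 u', ac u' (wderiv u) &
  \forall x \ae mu, I x -> u x = u' x.
Proof.
move=> hu; have [c cE] := is_wderiv_ac (H1_L2 hu) (wderivP hu).
exists (fun x => c + prim (wderiv u) x) => //.
by split; [exact: L2_itg (L2_wderiv hu)|move=> x _; rewrite prim0 addr0].
Qed.

Variables (kappa lambda eps : R).
Hypotheses (k0 : 0 < kappa) (l0 : 0 <= lambda) (e0 : 0 < eps).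
Variables (theta rho : R -> R).
Hypotheses (ht : H1 theta) (hr : H1 rho).
Local Notation L := (lincost_inf kappa lambda eps theta (wderiv rho)).

Lemma sqdHV_ge eta : 0 < eta -> exists2 s0, 0 < s0 & forall s, `|s| < s0 ->
  ((s ^+ 2 * (L - eta))%:E <= sqdHV kappa lambda eps rho (fun x => rho x + s * theta x)%R)%E.
Proof.
move=> eta0; have [rho' arho rE] := H1_ac hr.
have [s0 s00 H] := int_energy_quotient k0 l0 e0 (H1_L2 ht) (L2_wderiv hr) arho eta0.
exists s0 => // s ss0; apply: le_ereal_inf_tmp => _ [f [v [z [adm ->]]]].
have [f' [z' [g [tr ae]]]] := admissible_transported adm.
have tr' : transported rho' (fun x => rho' x + s * theta x) f' z' g.
  apply: transported_aeq tr => //; apply: filterS rE => x E Ix; by rewrite E.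
rewrite (action_energy (tr_g tr) (tr_z tr) (energy_itg k0 l0 e0 tr') ae) lee_fin.
exact: H tr'.
Qed.

End Action.

(** * Affine paths are admissible *)

Section Competitor.
Context {R : realType}.
Implicit Types (g h u w p q psi phi : R -> R) (c t x s d e : R).
Local Notation mu := (@lebesgue_measure R).
Local Notation I := (`]0, 1[%classic : set R).
Local Notation mR := (@measurable _ (measurableTypeR R)).
Hint Resolve mR_itv : core.

(** The derivative [mz h] is approximated by test functions; once their means
are removed, these are derivatives of test functions. *)
Lemma P_approx h e : L2 h -> 0 < e -> exists psi, [/\ testfun psi,
  nrm (fun x => P h x - psi x) <= e & nrm (fun x => mz h x - derive1 psi x) <= e].
Proof.
move=> h2 e0; have m2 := L2_mz h2; have [b tb b1] := @testfun_mean1 R.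
have b2 := testfun_L2 tb.
have k0 : 0 < 1 + nrm b by rewrite ltr_pwDl// nrm_ge0.
have [_ /(_ _ (divr_gt0 e0 k0))[chi tchi Hchi]] := apx_L2 m2.
have c2 := testfun_L2 tchi.
pose c := \int[mu]_(x in I) chi x.
have cd : `|c| <= e / (1 + nrm b).
  have : `|dot (fun x => mz h x - chi x) (fun=> 1)| <= nrm (fun x => mz h x - chi x) * nrm (fun _ : R => 1 : R).
    exact: CS (L2B m2 c2) (L2_cst 1).
  rewrite (dotBl m2 c2 (L2_cst 1)) !dotE.
  under eq_Rintegral do rewrite mulr1.
  under [X in `|_ - X|]eq_Rintegral do rewrite mulr1.
  rewrite (int_mz (L2_itg h2)) sub0r normrN nrm_cst normr1 mulr1.
  by move/le_trans; apply.
pose chi' x := - c * b x + chi x.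
have tchi' : testfun chi' by apply: testfunD => //; exact: testfunZ.
have c'2 := testfun_L2 tchi'.
have chi'0 : \int[mu]_(x in I) chi' x = 0.
  rewrite (intD measI (itgZ _ measI (L2_itg b2)) (L2_itg c2)) (intZ _ measI (L2_itg b2)) b1 -/c.
  by rewrite mulr1 addNr.
have [psi tpsi psiE] := testfun_int0 tchi' chi'0.
have H1 : nrm (fun x => mz h x - derive1 psi x) <= e.
  rewrite psiE (_ : (fun x => _) = (fun x => (mz h x - chi x) + c * b x)); last first.
    by apply/funext => x; rewrite /chi'; ring.
  apply: le_trans (nrmD (L2B m2 c2) (L2Z c b2)) _; rewrite (nrmZ c b2).
  have -> : e = e / (1 + nrm b) + e / (1 + nrm b) * nrm b.
    by rewrite -[X in X + _]mulr1 -mulrDr divfK// gt_eqF.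
  by apply: lerD Hchi _; apply: ler_wpM2r (nrm_ge0 _) _ _ _.
exists psi; split => //; apply: le_trans H1.
have d2 : L2 (fun x => mz h x - derive1 psi x) by rewrite psiE; exact: L2B.
have PE x : I x -> P h x - psi x = prim (fun x => mz h x - derive1 psi x) x.
  move=> /Isub/andP[x0 x1]; have [ip pE] := testfun_ac tpsi.
  rewrite pE ?x0// (testfun_le0 tpsi (lexx 0)) add0r.
  have := primD (L2_itg m2) (itgZ (-1) measI ip) x1.
  rewrite (primZ _ ip x1) mulN1r => <-; congr prim.
  by apply/funext => y; rewrite mulN1r.
apply: nrm_bnd (nrm_ge0 _) _ _.
  by apply: measurable_funB; [exact: L2_meas (L2_P h2)|exact: L2_meas (testfun_L2 tpsi)].
by move=> x Ix; rewrite PE//; apply: prim_bnd_nrm d2 (Isub Ix).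
Qed.

Lemma P_wderiv h : L2 h -> is_wderiv (P h) (mz h) /\ is_wderiv (mz h) h.
Proof.
move=> h2; split; first exact: ac_is_wderiv (L2_mz h2) (ac_P h2).
exact: ac_is_wderiv h2 (ac_mz (L2_itg h2)).
Qed.

Lemma P_H2 h : L2 h -> H2 (P h) /\ \forall x \ae mu, I x -> wderiv (wderiv (P h)) x = h x.
Proof.
move=> h2; have [w1 w2] := P_wderiv h2.
have h1 : H1 (P h) by split; [exact: L2_P|exists (mz h)].
have e : \forall x \ae mu, I x -> mz h x = wderiv (P h) x.
  by apply: filterS (wderiv_ae w1) => x E Ix; rewrite E.
have w2' : is_wderiv (wderiv (P h)) h by exact: is_wderiv_aeq e w2.
split; last exact: wderiv_ae.
by split => //; split; [exact: L2_wderiv h1|exists h].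
Qed.

Lemma P_H10 h : L2 h -> H10 (P h).
Proof.
move=> h2; have [[h1 _] _] := P_H2 h2; split => //.
have H n := P_approx h2 (divr_gt0 ltr01 (ltr0Sn R n)).
have [p Hp] := choice H; exists p; split; first by move=> n; have [] := Hp n.
have sqE n : sqH1 (fun x => P h x - p n x) =
    (nrm (fun x => P h x - p n x) ^+ 2 + nrm (fun x => mz h x - derive1 (p n) x) ^+ 2)%:E.
  have [tp _ _] := Hp n.
  have w : is_wderiv (fun x => P h x - p n x) (fun x => mz h x - derive1 (p n) x).
    have := is_wderiv_lin (-1) (testfun_L2 tp) (L2_P h2) (testfun_wderiv tp) (P_wderiv h2).1.
    rewrite (_ : (fun x => -1 * p n x + _) = (fun x => P h x - p n x)); last first.
      by apply/funext => x; rewrite mulN1r addrC.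
    rewrite (_ : (fun x => -1 * _ x + _) = (fun x => mz h x - derive1 (p n) x))//.
    by apply/funext => x; rewrite mulN1r addrC.
  rewrite sqH1E; last by split; [exact: L2B (L2_P h2) (testfun_L2 tp)|eexists; exact: w].
  by rewrite (nrm_ae (wderiv_ae w)).
rewrite (_ : (fun n => _) = (fun n => (nrm (fun x => P h x - p n x) ^+ 2 + nrm (fun x => mz h x - derive1 (p n) x) ^+ 2)%:E)); last first.
  by apply/funext => n; exact: sqE.
apply: cvg_EFin; first exact: nearW.
have harm : (1 / n.+1%:R : R) @[n --> \oo] --> 0.
  by under eq_fun do rewrite mul1r; exact: cvg_harmonic.
have sq : (1 / n.+1%:R : R) ^+ 2 + (1 / n.+1%:R) ^+ 2 @[n --> \oo] --> 0.
  rewrite -[X in _ --> X](_ : 0 * 0 + 0 * 0 = 0); last by rewrite mulr0 addr0.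
  by apply: cvgD; under eq_fun do rewrite expr2; exact: cvgM.
apply: squeeze_cvgr (cvg_cst 0) sq.
apply: nearW => n; have [_ n1 n2] := Hp n; rewrite addr_ge0 ?sqr_ge0//=.
by apply: lerD; apply: lerXn2r; rewrite ?nnegrE ?nrm_ge0.
Qed.

(** Step functions in time with step [N^-1]. *)
Let cell (N k : nat) : set R := `[k%:R / N%:R, k.+1%:R / N%:R[%classic.

Lemma cellE (N k : nat) t : (0 < N)%N -> 0 <= t -> cell N k t <-> Num.truncn (t * N%:R) = k.
Proof.
move=> N0 t0; have N0' : 0 < N%:R :> R by rewrite ltr0n.
rewrite /cell /= in_itv/= ler_pdivrMr// ltr_pdivlMr//; split.
  exact: truncn_def.
by move=> <-; apply: truncn_itv; rewrite mulr_ge0// ltW.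
Qed.

Lemma step_sum (a : nat -> R) (N : nat) t : I t ->
  \sum_(i < N.+1) \1_(cell N.+1 i) t * a i = a (Num.truncn (t * N.+1%:R)).
Proof.
move=> /= It; have /andP[t0 t1] := It.
have N0 : 0 < N.+1%:R :> R by rewrite ltr0n.
have kN : (Num.truncn (t * N.+1%:R) < N.+1)%N.
  have /andP[kt _] := truncn_itv (mulr_ge0 (ltW t0) (ltW N0)).
  rewrite -(ltr_nat R); apply: le_lt_trans kt _.
  by rewrite -[X in _ < X]mul1r ltr_pM2r.
have E (i : 'I_N.+1) : \1_(cell N.+1 i) t = (val i == Num.truncn (t * N.+1%:R))%:R :> R.
  rewrite indicE; congr (nat_of_bool _)%:R; apply/idP/eqP.
    by move=> /set_mem H; apply/esym; apply: (cellE _ _ (ltW t0)).1 H.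
  by move=> ik; apply/mem_set; exact: (@cellE N.+1 i t isT (ltW t0)).2 (esym ik).
rewrite (bigD1 (Ordinal kN))// E/= eqxx mul1r big1 ?addr0// => i ik.
rewrite E (_ : (val i == _) = false) ?mul0r//.
by apply/negbTE; apply: contra ik => /eqP H; apply/eqP/val_inj.
Qed.

Lemma step_near (N : nat) t : I t ->
  0 <= t - (Num.truncn (t * N.+1%:R))%:R / N.+1%:R <= N.+1%:R^-1.
Proof.
move=> /= It; have /andP[t0 t1] := It.
have N0 : 0 < N.+1%:R :> R by rewrite ltr0n.
have /andP[kt tk] := truncn_itv (mulr_ge0 (ltW t0) (ltW N0)).
rewrite subr_ge0 ler_pdivrMr// kt/= lerBlDl.
by rewrite -[X in _ + X]mul1r -mulrDl natr1 ler_pdivlMr// ltW.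
Qed.

Let mcell N k : measurable (cell N k). Proof. exact: measurable_itv. Qed.

(** Strong measurability in time: replace [t] by a step function. *)
Lemma affine_L2_in_time p q : L2 p -> L2 q ->
  L2_in_time L2 sqL2 (fun t x => p x + t * q x).
Proof.
move=> p2 q2; split.
- apply: (jmD (F1 := fun _ x => p x) (F2 := fun t x => t * q x)).
    exact: (jm_snd (L2_meas p2)).
  apply: (jmM (F1 := fun t _ => t) (F2 := fun _ x => q x)).
    by apply: (@jm_fst _ id).
  exact: (jm_snd (L2_meas q2)).
- exists (fun n t x => \sum_(i < n.+1) \1_(cell n.+1 i) t * (p x + i%:R / n.+1%:R * q x)).
  split.
    move=> n; exists n.+1, (fun i => cell n.+1 i), (fun i x => p x + i%:R / n.+1%:R * q x).
    by split => // i; split; [exact: mcell|apply: L2D p2 (L2Z _ q2)].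
  apply: aeW => t It; split; first by apply: L2D p2 (L2Z _ q2).
  have E n : (fun x => p x + t * q x - \sum_(i < n.+1) \1_(cell n.+1 i) t * (p x + i%:R / n.+1%:R * q x))
      = (fun x => (t - (Num.truncn (t * n.+1%:R))%:R / n.+1%:R) * q x).
    apply/funext => x.
    by rewrite (step_sum (fun i => p x + i%:R / n.+1%:R * q x) n It); ring.
  apply: (@squeeze_cvge _ _ _ _ (fun=> 0%E) _ (fun n => (n.+1%:R^-1 * (n.+1%:R^-1 * nrm q ^+ 2))%:E)).
  + apply: nearW => n; rewrite E sqL2_ge0/= (sqL2E (L2Z _ q2)) lee_fin (nrmZ _ q2).
    have /andP[d0 d1] := step_near n It.
    rewrite (ger0_norm d0) exprMn mulrA -expr2; apply: ler_wpM2r (sqr_ge0 _) _ _ _.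
    by apply: lerXn2r; rewrite ?nnegrE// invr_ge0.
  + exact: cvg_cst.
  + apply: cvg_EFin; first exact: nearW.
    rewrite -[X in _ --> X](_ : 0 * (0 * nrm q ^+ 2) = 0); last by rewrite mul0r.
    by apply: cvgM; [exact: cvg_harmonic|apply: cvgM; [exact: cvg_harmonic|exact: cvg_cst]].
- apply: (@le_lt_trans _ _ (\int[mu]_(t in I) ((nrm p + nrm q) ^+ 2)%:E)%E).
    apply: ge0_le_integral_ae => [t _|t _|]; first exact: sqL2_ge0.
      by rewrite lee_fin sqr_ge0.
    apply: aeW => t It; rewrite sqL2E; last exact: L2D p2 (L2Z _ q2).
    have [t0 t1] := andP (Isub It).
    rewrite lee_fin; apply: lerXn2r; rewrite ?nnegrE ?addr_ge0 ?nrm_ge0//.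
    apply: le_trans (nrmD p2 (L2Z t q2)) _; rewrite lerD2l (nrmZ t q2) (ger0_norm t0).
    by rewrite -[leRHS]mul1r; apply: ler_wpM2r (nrm_ge0 _) _ _ _.
  by rewrite (intE (itg_cstI _) measI) ltry.
Qed.

Lemma sqH2_cst0 : sqH2 (fun _ : R => 0 : R) = 0%E.
Proof.
have z0 : sqL2 (fun _ : R => 0 : R) = 0%E.
  by rewrite (sqL2E (L2_cst 0)) nrm_cst0 expr0n.
have h0 : H1 (wderiv (fun _ : R => 0 : R)).
  apply: H1_aeq (@H1_cst0 R); first exact: L2_meas (L2_wderiv (@H1_cst0 R)).
  by apply: filterS (@wderiv_cst0 R) => x E Ix; rewrite E.
have w0 : \forall x \ae mu, I x -> wderiv (wderiv (fun _ : R => 0 : R)) x = 0.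
  have H := wderiv_aeq (@wderiv_cst0 R) h0.
  by apply: filterS2 H (@wderiv_cst0 R) => x E E0 Ix; rewrite -E// E0.
by rewrite /sqH2 (sqL2_ae (@wderiv_cst0 R)) (sqL2_ae w0) z0 !adde0.
Qed.

Lemma cst_L2_in_time w : H2 w -> H10 w -> L2_in_time (H2 `&` H10) sqH2 (fun _ : R => w).
Proof.
move=> h2 h10; have [h1 h1'] := h2; split.
- exact: (jm_snd (L2_meas (H1_L2 h1))).
- exists (fun _ t x => \sum_(i < 1) \1_(setT : set R) t * w x); split.
    by move=> n; exists 1%N, (fun=> setT), (fun=> w); split => // i; split.
  apply: aeW => t It; split; first by split.
  rewrite (_ : (fun n => _) = (fun=> 0%E)); first exact: cvg_cst.
  apply/funext => n; rewrite (_ : (fun x => _) = (fun=> 0)) ?sqH2_cst0//.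
  by apply/funext => x; rewrite big_ord1 indicE in_setT mul1r subrr.
- rewrite /sqH2 (sqL2E (H1_L2 h1)) (sqL2E (H1_L2 h1')) (sqL2E (L2_wderiv h1')) -!EFinD.
  by rewrite (intE (itg_cstI _) measI) ltry.
Qed.

(** The path [p + t q] acts on $H^1_0$ by integration, hence is Lipschitz in
$H^{-1}$. *)
Lemma affine_continuous_path p q rho0 rho1 : L2 p -> L2 q ->
  (\forall x \ae mu, I x -> rho0 x = p x) ->
  (\forall x \ae mu, I x -> rho1 x = p x + q x) ->
  continuous_path rho0 rho1 (fun t x => p x + t * q x).
Proof.
move=> p2 q2 r0 r1.
have bnd u (G : (R -> R) -> R) : L2 u -> (forall phi, H10 phi -> G phi = dot u phi) ->
    (normHm1 G <= (nrm u)%:E)%E.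
  move=> u2 GE; apply: ge_ereal_sup => _ [phi [h10 s1] <-]; rewrite lee_fin (GE _ h10).
  have [h1 _] := h10.
  apply: le_trans (CS u2 (H1_L2 h1)) _; rewrite -[leRHS]mulr1.
  apply: ler_wpM2l (nrm_ge0 _) _ _ _.
  move: s1; rewrite (sqH1E h1) lee_fin => s1.
  rewrite -(@ler_pXn2r _ 2) ?nnegrE ?nrm_ge0// expr1n; apply: le_trans s1.
  by rewrite lerDl sqr_ge0.
exists (fun t phi => dot (fun x => p x + t * q x) phi); split.
- have u2 t : L2 (fun x => p x + t * q x) by exact: L2D p2 (L2Z _ q2).
  split.
    move=> t _; split.
      move=> a phi psi [[f2 _] _] [[g2 _] _].
      by rewrite (dotDr (L2Z a f2) g2 (u2 t)) (dotZr a f2 (u2 t)).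
    exact: le_lt_trans (bnd _ _ (u2 t) (fun _ _ => erefl)) (ltry _).
  move=> t _.
  apply: (@squeeze_cvge _ _ _ _ (fun=> 0%E) _ (fun t' => (`|t' - t| * nrm q)%:E)).
  + apply: nearW => t'; apply/andP; split.
      apply: le_trans (_ : `|0|%:E <= _)%E; first by rewrite normr0.
      apply: ereal_sup_ubound; exists (fun=> 0); first split.
      * exact: H10_cst0.
      * rewrite (sqH1E (@H1_cst0 R)) (nrm_ae (@wderiv_cst0 R)) nrm_cst0 expr0n addr0.
        by rewrite lee_fin.
      * by rewrite !dotE; congr (`|_|%:E); rewrite -[RHS](subrr (0 : R)); congr (_ - _);
          under eq_Rintegral do rewrite mulr0; rewrite int_cstI.
    rewrite -(nrmZ (t' - t) q2); apply: bnd (L2Z _ q2) _ => phi [[f2 _] _].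
    rewrite -(dotBl (u2 t') (u2 t) f2); congr dot; apply/funext => x; ring.
  + exact: cvg_cst.
  + apply: cvg_EFin; first exact: nearW.
    rewrite -[X in _ --> X](_ : `|t - t| * nrm q = 0); last by rewrite subrr normr0 mul0r.
    apply: cvgM; last exact: cvg_cst.
    apply: cvg_norm; apply: cvgB; last exact: cvg_cst.
    by apply: cvg_within_filter; exact: cvg_id.
- by apply: aeW => t It phi _; rewrite dotE.
- move=> phi _; rewrite dotE; apply: eq_Rintegral_ae; apply: filterS r0 => x E Ix.
  by rewrite E// mul0r addr0.
- move=> phi _; rewrite dotE; apply: eq_Rintegral_ae; apply: filterS r1 => x E Ix.
  by rewrite E// mul1r.
Qed.

End Competitor.

(** * The competitor satisfies the transport equation *)

Section WeakTransport.
Context {R : realType}.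
Implicit Types (g h u w p q psi : R -> R) (G phi : R -> R -> R) (c t x s d e : R).
Local Notation mu := (@lebesgue_measure R).
Local Notation I := (`]0, 1[%classic : set R).
Local Notation mR := (@measurable _ (measurableTypeR R)).
Hint Resolve mR_itv : core.

Lemma continuous_section G t : continuous (fun y : R * R => G y.1 y.2) -> continuous (G t).
Proof.
move=> cG x; apply: (@continuous_comp _ _ _ (fun y => (t, y)) (fun y => G y.1 y.2)).
  exact: (cvg_pair (cvg_cst t) cvg_id).
exact: cG.
Qed.

Lemma continuous_swap G : continuous (fun y : R * R => G y.1 y.2) ->
  continuous (fun y : R * R => G y.2 y.1).
Proof.
move=> cG y; apply: (@continuous_comp _ _ _ (fun y => (y.2, y.1)) (fun y => G y.1 y.2)).
  exact: (cvg_pair cvg_snd cvg_fst).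
exact: cG.
Qed.

(** A continuous function is the pointwise limit of functions that are step
functions in time. *)
Lemma jm_continuous G : continuous (fun y : R * R => G y.1 y.2) -> jm G.
Proof.
move=> cG.
pose N n t : R := (Num.truncn (t * n.+1%:R))%:R / n.+1%:R.
pose Gn n (y : R * R) := \sum_(i < n.+1) \1_(`[i%:R / n.+1%:R, i.+1%:R / n.+1%:R[%classic : set R) y.1
  * G (i%:R / n.+1%:R) y.2.
apply: (@measurable_fun_cvg _ _ _ _ Gn).
- move=> n; apply: measurable_sum => i; apply: measurable_funM.
    apply: (@jm_fst _ (\1_(`[i%:R / n.+1%:R, i.+1%:R / n.+1%:R[%classic : set R))).
    by apply: measurable_indic; exact: mR_itv.
  apply: (@jm_snd _ (G (i%:R / n.+1%:R))); apply: measurable_funTS.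
  by apply: continuous_measurable_fun; exact: continuous_section.
- move=> [t x] [/= It Ix].
  have -> : Gn ^~ (t, x) = (fun n => G (N n t) x).
    by apply/funext => n; rewrite /Gn (step_sum (fun i => G (i%:R / n.+1%:R) x) n It).
  have Nt : N n t @[n --> \oo] --> t.
    have d0 : t - N n t @[n --> \oo] --> 0.
      apply: squeeze_cvgr (cvg_cst 0) (@cvg_harmonic R).
      by apply: nearW => n; exact: step_near.
    have H : t - (t - N n t) @[n --> \oo] --> t - 0 by apply: cvgB => //; exact: cvg_cst.
    rewrite subr0 in H; have -> // : N^~ t = (fun n => t - (t - N n t)).
    by apply/funext => n; rewrite opprB addrC subrK.
  apply: (@cvg_comp _ _ _ (N ^~ t) (fun t => G t x) _ (nbhs t)) => //.
  exact: (@continuous_section (fun x t => G t x) x (continuous_swap cG) t).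
Qed.

Lemma continuous_bnd2 G : continuous (fun y : R * R => G y.1 y.2) ->
  exists2 C, 0 <= C & forall t x, 0 <= t <= 1 -> 0 <= x <= 1 -> `|G t x| <= C.
Proof.
move=> cG.
have cI : compact (`[0, 1]%classic `*` `[0, 1]%classic : set (R * R)).
  by apply: compact_setX; exact: segment_compact.
have := compact_bounded (continuous_compact (continuous_subspaceT cG) cI).
move=> [M [_ HM]]; exists (`|M| + 1); first by rewrite addr_ge0.
move=> t x t01 x01; apply: (HM (`|M| + 1)).
  by rewrite (le_lt_trans (ler_norm _))// ltrDl.
by exists (t, x) => //; split; rewrite /= in_itv.
Qed.

Lemma testfun2_continuous phi : testfun2 phi ->
  [/\ continuous (fun y : R * R => phi y.1 y.2), continuous (fun y : R * R => dt phi y.1 y.2) &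
      continuous (fun y : R * R => dx phi y.1 y.2)].
Proof.
move=> [H _]; split.
- by have [_] := H [::].
- by have [_] := H [:: false].
- by have [_] := H [:: true].
Qed.

Lemma testfun2_ac_x phi t : testfun2 phi -> ac (phi t) (dx phi t).
Proof.
move=> tp; have [_ _ c2] := testfun2_continuous tp; have [H _] := tp.
have d : D1 (phi t) (dx phi t).
  by apply: D1_derive1 => x; have [/(_ t x)[]] := H [::].
exact: D1_ac d (continuous_section (t := t) c2).
Qed.

Lemma testfun2_ac_t phi x : testfun2 phi -> ac (phi^~ x) (fun t => dt phi t x).
Proof.
move=> tp; have [_ c1 _] := testfun2_continuous tp; have [H _] := tp.
have d : D1 (phi^~ x) (fun t => dt phi t x).
  apply: (@D1_derive1 R (phi^~ x)) => t.
  by have [K _] := H [::]; have [h _] := K t x; exact: h.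
exact: D1_ac d (@continuous_section (fun x t => dt phi t x) x (continuous_swap c1)).
Qed.

Lemma testfun2_0 phi x : testfun2 phi -> phi 0 x = 0 /\ phi 1 x = 0.
Proof.
move=> [_ [a [b [a0 b1 H]]]]; split; apply: H => -[/andP[at_ tb] _].
  by have := lt_le_trans a0 at_; rewrite ltxx.
by have := le_lt_trans tb b1; rewrite ltxx.
Qed.

(** Integrating by parts in [x], the transport term cancels the second part of
the source; what remains is the [t]-derivative of [(rho + t theta) phi]. *)
Lemma affine_weak_transport rho r theta q h : ac rho r -> L2 r -> ac theta q -> L2 q ->
  L2 h -> weak_transport (fun t x => rho x + t * theta x) (fun _ => P h)
    (fun t x => theta x + (r x + t * q x) * P h x).
Proof.
move=> ar r2 at_ q2 h2 phi tp; have [c0 c1 c2] := testfun2_continuous tp.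
have [C0 C00 b0] := continuous_bnd2 c0; have [C1 C10 b1] := continuous_bnd2 c1.
have [_ [Cr br]] := ac_Linf ar; have [_ [Ct bt]] := ac_Linf at_.
pose F t x := (rho x + t * theta x) * dt phi t x + theta x * phi t x.
have aw := ac_P h2; have aw1 := ac_mz (L2_itg h2).
have af t : ac (fun x => rho x + t * theta x) (fun x => r x + t * q x).
  exact: acD ar (acZ t at_).
have phit t : measurable_fun I (dt phi t).
  apply: measurable_funTS; apply: continuous_measurable_fun; exact: continuous_section.
have Lt t : I t -> Linf (dt phi t).
  by move=> It; split; [exact: phit|exists C1 => x Ix; apply: b1; exact: Isub].
have inner t : I t -> \int[mu]_(x in I) ((rho x + t * theta x) * dt phi t x +
     (rho x + t * theta x) * (dx phi t x * P h x + phi t x * wderiv (P h) x) +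
     (theta x + (r x + t * q x) * P h x) * phi t x) = \int[mu]_(x in I) F t x.
  move=> It; have ap := testfun2_ac_x t tp.
  have aM := acM (af t) (acM ap aw); have [iM _] := aM.
  have iF : itg I (F t).
    apply: (itgD measI); first exact: itgM (ac_L2 (af t)) (Linf_L2 (Lt t It)).
    exact: itgM (ac_L2 at_) (ac_L2 ap).
  have EM : \int[mu]_(x in I) ((r x + t * q x) * (phi t x * P h x) +
      (rho x + t * theta x) * (dx phi t x * P h x + phi t x * mz h x)) = 0.
    rewrite (ac_int aM) (_ : P h 1 = 0); last exact: prim_mz0 (L2_itg h2).
    have -> : P h 0 = 0 by exact: prim0.
    by rewrite !mulr0 subrr.
  have [_ E] := has_intD (has_intI iF) (conj iM EM).
  rewrite addr0 in E; rewrite -[RHS]E; apply: eq_Rintegral_ae.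
  apply: filterS (wderiv_ae (P_wderiv h2).1) => x Ex Ix; rewrite (Ex Ix) /F.
  move: (rho x) (theta x) (dt phi t x) (dx phi t x) (P h x) (phi t x) (mz h x) (r x) (q x).
  by move=> *; ring.
transitivity (\int[mu]_(t in I) \int[mu]_(x in I) F t x).
  by apply: eq_Rintegral => t /[!inE] It; exact: inner.
have jF : jm F.
  apply: jmD; apply: jmM.
  - apply: (jmD (F1 := fun _ x => rho x) (F2 := fun t x => t * theta x)).
      exact: (jm_snd (ac_meas ar)).
    apply: (jmM (F1 := fun t _ => t) (F2 := fun _ x => theta x)).
      by apply: (@jm_fst _ id).
    exact: (jm_snd (ac_meas at_)).
  - exact: jm_continuous.
  - exact: (jm_snd (ac_meas at_)).
  - exact: jm_continuous.
have Fb t x : I t -> I x -> `|F t x| <= (Cr + Ct) * C1 + Ct * C0.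
  move=> It Ix; have [t0 t1] := andP (Isub It).
  apply: le_trans (ler_normD _ _) _; rewrite !normrM; apply: lerD.
    apply: ler_pM => //; last exact: b1 (Isub It) (Isub Ix).
    apply: le_trans (ler_normD _ _) _; apply: lerD; first exact: br.
    rewrite normrM (ger0_norm t0); apply: le_trans (bt x Ix).
    by rewrite -[leRHS]mul1r; exact: ler_wpM2r.
  apply: ler_pM => //; [exact: bt|exact: b0 (Isub It) (Isub Ix)].
have mF t : I t -> measurable_fun I (F t) by move=> It; exact: jm_section.
have iF t : I t -> itg I (F t).
  move=> It; apply: (le_itg measI (mF t It) (fun x Ix => Fb t x It Ix)); exact: itg_cstI.
rewrite (fubini_eq measI measI jF iF (itg_cstI ((Cr + Ct) * C1 + Ct * C0))); last first.
  move=> t It; rewrite -[leRHS]int_cstI.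
  exact: (le_int measI (itg_abs measI (iF t It)) (itg_cstI _) (fun x Ix => Fb t x It Ix)).
rewrite -[RHS](int_cstI 0); apply: eq_Rintegral => x /[!inE] Ix.
have alin : ac (fun t => rho x + t * theta x) (fun=> theta x).
  have c1' : continuous (fun _ : R => 1 : R) by move=> y; exact: cvg_cst.
  have := acD (ac_cst (rho x)) (acZ (theta x) (D1_ac (@D1_affine R 1 0) c1')).
  apply: eq_ac => [t _||]; first by rewrite mul1r addr0 mulrC.
    exact: itg_cstI.
  by apply: aeW => t _; rewrite add0r mulr1.
have [p0 p1] := testfun2_0 x tp.
have E := ac_int (acM alin (testfun2_ac_t x tp)); rewrite p0 p1 !mulr0 subrr in E.
rewrite -[RHS]E; apply: eq_Rintegral => t _; rewrite /F addrC; ring.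
Qed.

End WeakTransport.

(** * Upper bound and limits *)

Section Limits.
Context {R : realType}.
Implicit Types (g h u w p q psi : R -> R) (c t x s d e : R).
Local Notation mu := (@lebesgue_measure R).
Local Notation I := (`]0, 1[%classic : set R).
Local Notation mR := (@measurable _ (measurableTypeR R)).
Hint Resolve mR_itv : core.

Lemma P_scale g c x : L2 g -> x <= 1 -> P (fun y => c * g y) x = c * P g x.
Proof.
move=> g2 x1; have := P_lin (c - 1) g2 g2 x1.
rewrite (_ : (fun y => _) = (fun y => c * g y)); last by apply/funext => y; ring.
by move=> ->; ring.
Qed.

Lemma velform_scale kappa lambda eps g c : L2 g ->
  velform kappa lambda eps (fun y => c * g y) (fun y => c * g y) = c ^+ 2 * velform kappa lambda eps g g.
Proof.
move=> g2; have := velform_quad kappa lambda eps (c - 1) g2 g2.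
rewrite (_ : (fun y => _) = (fun y => c * g y)); last by apply/funext => y; ring.
by move=> ->; ring.
Qed.

Lemma lincost_nrm kappa lambda eps theta r g : lincost kappa lambda eps theta r g =
  2^-1 * (velform kappa lambda eps g g + nrm (linsource theta r g) ^+ 2).
Proof. by rewrite nrm_sqr. Qed.

Section Fixed.
Variables (kappa lambda eps : R).
Hypotheses (k0 : 0 < kappa) (l0 : 0 <= lambda) (e0 : 0 < eps).
Variables (theta rho : R -> R).
Hypotheses (ht : H1 theta) (hr : H1 rho).
Local Notation r := (wderiv rho).
Local Notation q := (wderiv theta).
Local Notation velform := (velform kappa lambda eps).
Local Notation lincost := (lincost kappa lambda eps theta r).
Local Notation L := (lincost_inf kappa lambda eps theta r).
Local Notation D s := (sqdHV kappa lambda eps rho (fun x => rho x + s * theta x)).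

(** The competitor moves [rho] linearly with velocity [s * P g], and the equation
prescribes its source. *)
Lemma sqdHV_le g s : L2 g ->
  (D s <= (s ^+ 2 * (2^-1 * (velform g g + (nrm (linsource theta r g) +
     `|s| * nrm (fun x => q x * P g x)) ^+ 2)))%:E)%E.
Proof.
move=> g2; have [rho' ar rE] := H1_ac hr; have [th' at_ tE] := H1_ac ht.
have r2 := L2_wderiv hr; have q2 := L2_wderiv ht.
have t2 := ac_L2 at_.
pose h x := s * g x; have h2 : L2 h := L2Z s g2.
have ast := acZ s at_; have sq2 := L2Z s q2.
have [hP wP] := P_H2 h2; have hP0 := P_H10 h2.
pose p1 x := s * th' x + r x * P h x; pose q1 x := s * q x * P h x.
have p12 : L2 p1 by apply: L2D (L2Z s t2) (L2_MP r2 h2).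
have q12 : L2 q1 by exact: L2_MP sq2 h2.
pose z t x := p1 x + t * q1 x.
have zE : (fun t x => s * th' x + (r x + t * (s * q x)) * P h x) = z.
  by apply/funext => t; apply/funext => x; rewrite /z /p1 /q1; ring.
have adm : admissible rho (fun x => rho x + s * theta x)
    (fun t x => rho' x + t * (s * th' x)) (fun _ => P h) z.
  split.
  - exact: affine_L2_in_time (ac_L2 ar) (L2Z s t2).
  - exact: cst_L2_in_time hP hP0.
  - exact: affine_L2_in_time p12 q12.
  - by rewrite -zE; exact: affine_weak_transport ar r2 ast sq2 h2.
  - apply: affine_continuous_path (ac_L2 ar) (L2Z s t2) (rE) _.
    by apply: filterS2 rE tE => x E1 E2 Ix; rewrite E1// E2.
apply: (@le_trans _ _ (action kappa lambda eps (fun _ => P h) z)).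
  apply: ereal_inf_lbound; exists (fun t x => rho' x + t * (s * th' x)), (fun _ => P h), z.
  by split.
have z2 t : L2 (z t) by apply: L2D p12 (L2Z _ q12).
set b := s ^+ 2 * _.
have np : nrm p1 <= `|s| * nrm (linsource theta r g).
  have Z2 := L2_linsource (H1_L2 ht) r2 g2; rewrite -(nrmZ s Z2).
  rewrite le_eqVlt; apply/orP; left; apply/eqP; apply: nrm_ae.
  apply: filterS tE => x E Ix; rewrite /p1 /h /linsource (P_scale _ g2) ?E//; last first.
    by have /andP[] := Isub Ix.
  by ring.
have nq : nrm q1 <= s ^+ 2 * nrm (fun x => q x * P g x).
  rewrite -{1}(ger0_norm (sqr_ge0 s)) -(nrmZ (s ^+ 2) (L2_MP q2 g2)).
  rewrite le_eqVlt; apply/orP; left; apply/eqP; apply: nrm_ae.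
  apply: aeW => x Ix; rewrite /q1 /h (P_scale _ g2); last by have /andP[] := Isub Ix.
  by ring.
have ele t : I t -> energy kappa lambda eps h (z t) <= b.
  move=> It; have [t0 t1] := andP (Isub It).
  have nz : nrm (z t) <= `|s| * (nrm (linsource theta r g) + `|s| * nrm (fun x => q x * P g x)).
    apply: le_trans (nrmD p12 (L2Z t q12)) _; rewrite mulrDr; apply: lerD => //.
    rewrite mulrA -expr2 real_normK ?num_real//; apply: le_trans nq.
    rewrite (nrmZ t q12) (ger0_norm t0) -[leRHS]mul1r.
    exact: ler_wpM2r (nrm_ge0 _) _ _ t1.
  rewrite /energy (velform_scale _ _ _ _ g2) -nrm_sqr /b [leRHS]mulrCA.
  apply: ler_wpM2l => //; rewrite [leRHS]mulrDr; apply: lerD => //.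
  rewrite -(real_normK (num_real s)) -exprMn.
  by apply: lerXn2r; rewrite ?nnegrE ?nrm_ge0// mulr_ge0// addr_ge0 ?mulr_ge0 ?nrm_ge0.
have e0' t : 0 <= energy kappa lambda eps h (z t).
  by rewrite /energy mulr_ge0// addr_ge0 ?dot_ge0// velform_ge0.
have jz : jm z.
  by have [] := affine_L2_in_time p12 q12.
have ien : itg I (fun t => energy kappa lambda eps h (z t)).
  apply: (le_itg measI (w := fun=> b)).
  - by apply: measurable_funM => //; apply: measurable_funD => //; exact: jm_dot.
  - by move=> t It; rewrite ger0_norm ?ele.
  - exact: itg_cstI.
rewrite (action_energy (g := fun _ => h) (z' := z) (fun _ _ => h2) (fun t _ => z2 t) ien); last first.
  apply: aeW => t It; split => //.
  by apply: filterS wP => x E Ix; rewrite E.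
rewrite lee_fin -[leRHS]int_cstI.
by apply: (le_int measI ien (itg_cstI b)) => t It; exact: ele.
Qed.

Lemma HV_quotient_cvg : HV_quotient kappa lambda eps rho theta s @[s --> 0^'] --> L%:E.
Proof.
have bounds e : 0 < e -> \forall s \near 0^',
    exists2 y, `|L - y| <= e & HV_quotient kappa lambda eps rho theta s = y%:E.
  move=> e00; have e20 : 0 < e / 2 by rewrite divr_gt0.
  have [s0 s00 lo] := sqdHV_ge k0 l0 e0 ht hr e00.
  have [g g2 Jg] : exists2 g, L2 g & lincost g <= L + e / 2 by exact: lincost_inf_approx.
  pose a := nrm (linsource theta r g); pose m := nrm (fun x => q x * P g x).
  have a0 : 0 <= a by exact: nrm_ge0.
  have m0 : 0 <= m by exact: nrm_ge0.
  pose M := 2 * a * m + m ^+ 2 + 1.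
  have M0 : 0 < M by rewrite ltr_wpDl// addr_ge0 ?sqr_ge0// !mulr_ge0.
  near=> s.
  have sn0 : s != 0 by near: s; exact: nbhs_dnbhs_neq.
  have ss0 : `|s| < s0 by near: s; apply: dnbhs0_lt.
  have s1 : `|s| < 1 by near: s; apply: dnbhs0_lt.
  have sM : `|s| < e / M by near: s; apply: dnbhs0_lt; exact: divr_gt0.
  have s2 : 0 < s ^+ 2 by rewrite lt_def sqr_ge0 sqrf_eq0 sn0.
  have := lo s ss0; have := sqdHV_le s g2; rewrite -/a -/m /HV_quotient.
  case: (sqdHV _ _ _ _ _) => [y| |]; rewrite ?lee_fin ?leeNy_eq// => up dn.
  exists (y / s ^+ 2); last by rewrite -EFinM.
  have {}up : y / s ^+ 2 <= L + e.
    rewrite ler_pdivrMr// [leRHS]mulrC; apply: le_trans up _.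
    rewrite ler_pM2l//; apply: le_trans (_ : lincost g + e / 2 <= _); last by move: Jg; lra.
    rewrite (lincost_nrm _ _ _ _ _ g) -/a.
    have : (a + `|s| * m) ^+ 2 <= a ^+ 2 + e.
      have -> : (a + `|s| * m) ^+ 2 = a ^+ 2 + `|s| * (2 * a * m + `|s| * m ^+ 2) by ring.
      rewrite lerD2l; apply: le_trans (_ : `|s| * M <= _); last by rewrite -ler_pdivlMr// ltW.
      apply: ler_wpM2l => //; rewrite /M -addrA lerD2l.
      apply: le_trans (_ : 1 * m ^+ 2 <= _); last by rewrite mul1r lerDl.
      by apply: ler_wpM2r; rewrite ?sqr_ge0// ltW.
    by move: (velform g g) ((a + _) ^+ 2) => b c; lra.
  have {}dn : L - e <= y / s ^+ 2 by rewrite ler_pdivlMr// mulrC.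
  by rewrite ler_norml; apply/andP; split; lra.
apply/fine_cvgP; split.
  by apply: filterS (bounds 1 ltr01) => s [y _ ->].
apply/cvgrPdist_le => e e00; apply: filterS (bounds e e00) => s [y yL E].
by rewrite /= E.
Unshelve. all: by end_near. Qed.

End Fixed.

(** A mean-zero function [mz g] is controlled by its primitive and its
derivative. *)
Lemma nrm_mz_sqr g : L2 g -> nrm (mz g) ^+ 2 <= nrm (P g) * nrm g.
Proof.
move=> g2; have := ac_int (acM (ac_P g2) (ac_mz (L2_itg g2))).
have -> : P g 0 = 0 by exact: prim0.
have -> : P g 1 = 0 by exact: prim_mz0 (L2_itg g2).
rewrite !mul0r subrr (intD measI (itgM (L2_mz g2) (L2_mz g2)) (itgM (L2_P g2) g2)).
rewrite -!dotE -nrm_sqr => /eqP; rewrite addr_eq0 => /eqP ->.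
by apply: le_trans (ler_norm _) _; rewrite normrN; exact: CS (L2_P g2) g2.
Qed.

Lemma lincost_inf_le (kappa lambda eps : R) (theta r : R -> R) : 0 < kappa -> 0 <= lambda -> 0 < eps ->
  L2 theta -> lincost_inf kappa lambda eps theta r <= 2^-1 * nrm theta ^+ 2.
Proof.
move=> k0 l0 e0 t2; have z2 := @L2_cst R 0.
have H : lincost_inf kappa lambda eps theta r <= lincost kappa lambda eps theta r (fun=> 0) by exact: lincost_inf_lb.
apply: le_trans H _.
rewrite lincost_nrm.
have := velform_scale kappa lambda eps 0 z2; rewrite expr0n /= !mul0r => ->.
rewrite add0r; apply: ler_wpM2l => //.
rewrite le_eqVlt; apply/orP; left; apply/eqP; congr (_ ^+ 2); apply: nrm_ae.
apply: aeW => x /Isub/andP[_ x1]; rewrite /linsource.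
have := P_scale 0 z2 x1; rewrite !mul0r => ->.
by rewrite mulr0 addr0.
Qed.

(** Since [nrm (linsource g) >= nrm theta - nrm r * nrm (mz g)], it remains to
complete the square in [nrm (mz g)]. *)
Lemma lincost_inf_ge kappa lambda eps (theta r : R -> R) C : 0 < C -> L2 theta -> L2 r ->
  (forall g, L2 g -> C * nrm (mz g) ^+ 2 <= velform kappa lambda eps g g) ->
  2^-1 * (nrm theta ^+ 2 - (nrm theta * nrm r) ^+ 2 / C) <= lincost_inf kappa lambda eps theta r.
Proof.
move=> C0 t2 r2 H; apply: lincost_inf_glb => g g2; rewrite lincost_nrm; apply: ler_wpM2l => //.
have Zn : nrm theta - nrm r * nrm (mz g) <= nrm (linsource theta r g).
  rewrite lerBlDr.
  have rP2 := L2_MP r2 g2.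
  apply: le_trans (lerD (lexx _) (nrm_MP r2 g2)).
  have := nrmB (L2_linsource t2 r2 g2) rP2; rewrite (_ : (fun x => _) = theta)//.
  by apply/funext => x; rewrite /linsource addrK.
have Z0 := nrm_ge0 (linsource theta r g); have T0 := nrm_ge0 theta.
have b0 := mulr_ge0 (nrm_ge0 r) (nrm_ge0 (mz g)).
have HZ : nrm theta ^+ 2 - 2 * nrm theta * (nrm r * nrm (mz g)) <= nrm (linsource theta r g) ^+ 2.
  move: Zn Z0 T0 b0; move: (nrm theta) (nrm (linsource _ _ _)) (nrm r * nrm (mz g)) => T Z b *.
  have [Tb|Tb] := leP T b; nra.
have := H g g2.
have : 2 * nrm theta * (nrm r * nrm (mz g)) <= C * nrm (mz g) ^+ 2 + (nrm theta * nrm r) ^+ 2 / C.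
  move: (nrm theta) (nrm r) (nrm (mz g)) => T Q b.
  have : 0 <= C * (b - T * Q / C) ^+ 2 by rewrite mulr_ge0 ?sqr_ge0// ltW.
  have -> : C * (b - T * Q / C) ^+ 2 = C * b ^+ 2 - 2 * T * (Q * b) + (T * Q) ^+ 2 / C.
    by field; rewrite gt_eqF.
  by rewrite addrAC subr_ge0.
move: HZ; move: (nrm _ ^+ 2) (2 * _ * _) (nrm _ ^+ 2) (C * _) (_ / C) (velform _ _ _ _ _).
by move=> *; lra.
Qed.

(** In all three regimes the velocity cost eventually dominates any multiple of
the squared norm of the velocity gradient. *)
Lemma iterated_HV_quotient (ka la ea : R -> R) theta rho : H1 rho -> H1 theta ->
  (forall a, 0 < a -> [/\ 0 < ka a, 0 <= la a & 0 < ea a]) ->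
  (forall C, 0 < C -> \forall a \near +oo,
     forall g, L2 g -> C * nrm (mz g) ^+ 2 <= velform (ka a) (la a) (ea a) g g) ->
  iterated_lim (fun a s => HV_quotient (ka a) (la a) (ea a) rho theta s)
    ((2^-1)%:E * sqL2 theta)%E.
Proof.
move=> hr ht pos coer; have t2 := H1_L2 ht; have r2 := L2_wderiv hr.
exists (fun a => lincost_inf (ka a) (la a) (ea a) theta (wderiv rho)); split.
  by move=> a /pos[k0 l0 e0]; exact: HV_quotient_cvg.
rewrite (sqL2E t2) -EFinM; apply: cvg_EFin; first exact: nearW.
apply/cvgrPdist_le => e e0.
set T := (nrm theta * nrm (wderiv rho)) ^+ 2.
have T0 : 0 <= T by exact: sqr_ge0.
have C0 : 0 < (T + 1) / e by rewrite divr_gt0// ltr_wpDl.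
near=> a.
have a0 : 0 < a by near: a; exact: nbhs_pinfty_gt.
have [k0 l0 ea0] := pos a a0.
have up := lincost_inf_le (wderiv rho) k0 l0 ea0 t2.
have lo : 2^-1 * (nrm theta ^+ 2 - T / ((T + 1) / e)) <= lincost_inf (ka a) (la a) (ea a) theta (wderiv rho).
  by apply: (lincost_inf_ge C0 t2 r2); near: a; exact: coer.
have Te : T / ((T + 1) / e) <= e.
  rewrite invf_div mulrA ler_pdivrMr ?ltr_wpDl// mulrC ler_pM2l//.
  by rewrite lerDl.
rewrite /= ger0_norm ?subr_ge0//.
move: up lo Te; move: (nrm theta ^+ 2) (T / _) (lincost_inf _ _ _ _ _) => x y z; lra.
Unshelve. all: by end_near. Qed.

Lemma velform_ge_lambda kappa lambda eps g : 0 < kappa -> 0 < eps ->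
  lambda * nrm (mz g) ^+ 2 <= velform kappa lambda eps g g.
Proof.
move=> k0 e0; rewrite /velform nrm_sqr addrAC lerDr.
by rewrite addr_ge0// mulr_ge0 ?dot_ge0// ltW.
Qed.

Lemma velform_ge_kappa_eps kappa lambda eps g C : 0 < kappa -> 0 <= lambda -> 0 < eps -> 0 < C ->
  C ^+ 2 <= kappa * eps -> L2 g -> C * nrm (mz g) ^+ 2 <= velform kappa lambda eps g g.
Proof.
move=> k0 l0 e0 C0 Cke g2.
apply: le_trans (_ : C * (nrm (P g) * nrm g) <= _).
  by apply: ler_wpM2l (ltW C0) _ _ (nrm_mz_sqr g2).
rewrite /velform -!nrm_sqr; have := mulr_ge0 l0 (sqr_ge0 (nrm (mz g))).
have := nrm_ge0 (P g); have := nrm_ge0 g; move: (nrm (P g)) (nrm g) (lambda * _) => x y w y0 x0 w0.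
suff : C * (x * y) <= kappa * x ^+ 2 + eps * y ^+ 2 by lra.
rewrite -(@ler_pXn2r _ 2) ?nnegrE//; last 2 first.
- by rewrite !mulr_ge0// ltW.
- by rewrite addr_ge0// mulr_ge0 ?sqr_ge0// ltW.
rewrite exprMn; apply: le_trans (_ : kappa * eps * (x * y) ^+ 2 <= _).
  by apply: ler_wpM2r; rewrite ?sqr_ge0.
have : 0 <= (kappa * x ^+ 2) ^+ 2 + (eps * y ^+ 2) ^+ 2 + kappa * eps * (x * y) ^+ 2.
  by rewrite !addr_ge0 ?sqr_ge0// !mulr_ge0 ?sqr_ge0// ltW.
by move=> H; rewrite -subr_ge0; move: H; congr (_ <= _); ring.
Qed.

End Limits.

Theorem proposition4p8 (R : realType) (rho theta : R -> R)
    (hrho : H1 rho) (htheta : H1 theta) :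
  [/\ forall lambda eps : R, 0 <= lambda -> 0 < eps ->
        iterated_lim
          (fun kappa s => HV_quotient kappa lambda eps rho theta s)
          ((2^-1)%:E * sqL2 theta)%E,
      forall kappa eps : R, 0 < kappa -> 0 < eps ->
        iterated_lim
          (fun lambda s => HV_quotient kappa lambda eps rho theta s)
          ((2^-1)%:E * sqL2 theta)%E &
      forall lambda kappa : R, 0 <= lambda -> 0 < kappa ->
        iterated_lim
          (fun eps s => HV_quotient kappa lambda eps rho theta s)
          ((2^-1)%:E * sqL2 theta)%E].
Proof.
split.
- move=> lambda eps l0 e0.
  apply: (iterated_HV_quotient (ka := id) (la := fun=> lambda) (ea := fun=> eps) hrho htheta).
    by move=> a a0; split.
  move=> C C0; near=> a => g g2.
  have a0 : 0 < a by near: a; exact: nbhs_pinfty_gt.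
  apply: velform_ge_kappa_eps g2 => //.
  rewrite -ler_pdivrMr//; by near: a; apply: nbhs_pinfty_ge; exact: num_real.
- move=> kappa eps k0 e0.
  apply: (iterated_HV_quotient (ka := fun=> kappa) (la := id) (ea := fun=> eps) hrho htheta).
    by move=> a a0; split => //; exact: ltW.
  move=> C C0; near=> a => g g2; apply: le_trans (velform_ge_lambda a g k0 e0).
  apply: ler_wpM2r; first exact: sqr_ge0.
  by near: a; apply: nbhs_pinfty_ge; exact: num_real.
- move=> lambda kappa l0 k0.
  apply: (iterated_HV_quotient (ka := fun=> kappa) (la := fun=> lambda) (ea := id) hrho htheta).
    by move=> a a0; split.
  move=> C C0; near=> a => g g2.
  have a0 : 0 < a by near: a; exact: nbhs_pinfty_gt.
  apply: velform_ge_kappa_eps g2 => //.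
  rewrite mulrC -ler_pdivrMr//; by near: a; apply: nbhs_pinfty_ge; exact: num_real.
Unshelve. all: by end_near. Qed.
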